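(* Let $n\ge3$ and $u\in C_c^2(\mathbb H^n\setminus\{0\})$. Then $$\|\Delta_{\mathbb H}u\|^2\ge\frac{(n-1)^4}{16}\|u\|^2+\frac{(n-1)^2}{8}\Big\|\frac u\rho\Big\|^2+\frac9{16}\Big\|\frac u{\rho^2}\Big\|^2+\frac{(n^2-1)(n-3)(n-5)}{16}\Big\|\frac u{(\sinh\rho)^2}\Big\|^2$$ $$+\frac{(n^2-1)(n-3)^2}{8}\Big\|\frac u{\sinh\rho}\Big\|^2+\frac{(n-1)(n-3)}{8}\Big\|\frac u{\rho\sinh\rho}\Big\|^2 .$$ In particular, $\|\Delta_{\mathbb H}u\|^2\ge\|u\|^2+\frac12\|u/\rho\|^2+\frac9{16}\|u/\rho^2\|^2$ for all $u\in C_c^2(\mathbb H^3\setminus\{0\})$, and $\|\Delta_{\mathbb H}u\|^2\ge\frac{81}{16}\|u\|^2+\frac98\|u/\rho\|^2+\frac{15}8\|u/\sinh\rho\|^2$ for all $u\in C_c^2(\mathbb H^4\setminus\{0\})$.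
   Context: $\mathbb H^n$ denotes the Poincaré ball model of hyperbolic space: the unit ball $\{x\in\mathbb R^n:|x|<1\}$ with metric $\frac{4|dx|^2}{(1-|x|^2)^2}$. Write $r=|x|$ and $\rho=\ln\frac{1+r}{1-r}$ (hyperbolic distance to the origin). $\Delta_{\mathbb H}$ is the Laplace–Beltrami operator of $\mathbb H^n$, and $\|\cdot\|$ is the norm of $L^2(\mathbb H^n)$ with respect to the hyperbolic volume measure. *)

(* Defs.v *)
From HB Require Import structures.
From mathcomp Require Import all_boot all_order all_algebra.
From mathcomp Require Import all_classical all_reals all_analysis.
Set Implicit Arguments. Unset Strict Implicit. Unset Printing Implicit Defensive.
Import Order.TTheory GRing.Theory Num.Theory.
Import numFieldNormedType.Exports.
Local Open Scope classical_set_scope.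
Local Open Scope ring_scope.

Section Hyp.
Variable R : realType.
Variable n : nat.

(* Euclidean norm |x| (the library norm on matrices is the sup norm). *)
Definition euclid_norm (x : 'rV[R]_n) : R := Num.sqrt (\sum_(i < n) x 0 i ^+ 2).

Definition sinh (t : R) : R := (expR t - expR (- t)) / 2.

(* rho(x) = ln((1+r)/(1-r)), the hyperbolic distance to the origin *)
Definition hdist (x : 'rV[R]_n) : R :=
  ln ((1 + euclid_norm x) / (1 - euclid_norm x)).

(* conformal factor lambda(x) = 2/(1-|x|^2): metric = lambda^2 |dx|^2 *)
Definition conf (x : 'rV[R]_n) : R := 2 / (1 - euclid_norm x ^+ 2).

(* the open unit ball (Poincare model of H^n) minus the origin *)
Definition punctured_ball : set 'rV[R]_n :=
  [set x | 0 < euclid_norm x < 1].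

Definition partial (i : 'I_n) (f : 'rV[R]_n -> R) : 'rV[R]_n -> R :=
  fun x => 'D_(delta_mx 0 i) f x.

Definition C2 (u : 'rV[R]_n -> R) : Prop :=
  continuous u /\
  (forall i x, derivable u x (delta_mx 0 i)) /\
  (forall i, continuous (partial i u)) /\
  (forall i j x, derivable (partial i u) x (delta_mx 0 j)) /\
  (forall i j, continuous (partial j (partial i u))).

(* u in C_c^2(H^n \ {0}): C^2 with compact support contained in the
   punctured ball (u extended by zero to R^n). *)
Definition Cc2_punctured (u : 'rV[R]_n -> R) : Prop :=
  C2 u /\ exists K : set 'rV[R]_n,
    compact K /\ K `<=` punctured_ball /\ (forall x, ~ K x -> u x = 0).

(* Laplace-Beltrami operator of the metric g = conf^2 delta:
   Delta u = (1/sqrt g) d_i (sqrt g g^{ij} d_j u) = conf^-n d_i(conf^(n-2) d_i u) *)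
Definition LB (u : 'rV[R]_n -> R) : 'rV[R]_n -> R :=
  fun x => (conf x ^+ n)^-1 *
    \sum_(i < n) partial i (fun y => conf y ^+ (n - 2) * partial i u y) x.

Fixpoint iint (k : nat) (g : (nat -> R) -> \bar R) : (nat -> R) -> \bar R :=
  match k with
  | 0 => g
  | k'.+1 => fun y =>
      (\int[@lebesgue_measure R]_t
         iint k' g (fun j => if j == k' then t else y j))%E
  end.

(* Lebesgue integral over R^n of a nonnegative function (via Tonelli,
   as an iterated integral) *)
Definition integral_Rn (f : 'rV[R]_n -> \bar R) : \bar R :=
  iint n (fun y => f (\row_(i < n) y i)) (fun _ => 0).

(* squared L^2(H^n) norm w.r.t. hyperbolic volume conf^n dx on the ball *)
Definition hnorm2 (f : 'rV[R]_n -> R) : \bar R :=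
  integral_Rn (fun x =>
    if euclid_norm x < 1 then ((f x ^+ 2) * conf x ^+ n)%:E else 0%E).

End Hyp.

(* Main.v *)
Require Import Defs.
From HB Require Import structures.
From mathcomp Require Import all_boot all_order all_algebra.
From mathcomp Require Import all_classical all_reals all_analysis.
From mathcomp Require Import measurable_realfun.
From mathcomp Require Import ring lra.
Import Order.TTheory GRing.Theory Num.Theory.
Import numFieldNormedType.Exports.
Local Open Scope classical_set_scope.
Local Open Scope ring_scope.
Set Implicit Arguments. Unset Strict Implicit. Unset Printing Implicit Defensive.

(** Write [E = d/drho], [del i] for the projection of [|x| d_i] to the spheres,
    [Lam = sum_i del_i^2] for the Laplacian of the unit sphere, [K = (n-1)/2]
    and [v = (sinh rho)^K u].  Then [(sinh rho)^K LB u = T] with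
    [T = v'' - W v + Lam v / sinh^2] and [W = K^2 + (K^2 - K) / sinh^2], and the
    hyperbolic volume becomes [drho dsigma].  Integrating [T^2] by parts leaves,
    besides the claimed potential, only squares: the radial ones come from the
    one-dimensional Hardy and Rellich inequalities, and the angular terms are
    nonnegative by the spectral gap [|Lam v|^2 >= (n-1) |grad_S v|^2] of the
    sphere, obtained from Bochner's formula.

    No polar coordinates are used: [E] and [del i] are vector fields on [R^n], and
    the iterated integral is only used through its linearity, positivity and
    translation invariance on continuous compactly supported functions.  As [u]
    is merely [C^2], Bochner's formula cannot be obtained by differentiating
    three times; it rests instead on [J_swap], proved by difference quotients. *)

(** * Integration of continuous compactly supported functions *)

(** Put [a = K^2], [b = K^2 - K], [p = 1 / rho], [k = 1 / sinh rho]. Hardy's inequality for [v'],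
    then with weight [p^2] for [v], turns the square of [v''] into [9/16 p^4 v^2], where [9/16] is
    [1/4] times [9/4]. The cross terms [-2 (a + b k^2) v v''] yield the multiples of [v'^2] that
    feed Hardy's inequality for [v] and for [k v], whence [a/2] and [b/2]. The obstacle is the mixed
    term [2 k^2 v'' Lam v], which has no sign. After integration by parts it is completed to a
    square, at the cost of [2 coth^2 k^2 G = 2 (k^2 + k^4) G] with [G = |grad_S v|^2]. The terms
    [2 a k^2 G + 2 b k^4 G] that are at hand cover the [k^2] part, as [a >= 1], but not the [k^4]
    part in dimensions 3 and 4, where [b < 1]. The spectral gap extracts the missing [2 K k^4 G]
    from [k^4 (Lam v)^2]. In dimension 3 both [a - 1] and [2 b + 2 K - 2] vanish, so the full gap
    constant [n - 1] is required. The condition [n >= 3] enters as [K >= 1] and through a division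
    by [n - 2] in the proof of the gap. *)

Section OneDim.
Context {R : realType}.
Implicit Types (h : R -> R) (M : R).
Local Notation mu := (@lebesgue_measure R).

Definition lint h : R := Rintegral mu setT h.

Lemma cc_integrable M h : continuous h -> (forall t, M < `|t| -> h t = 0) ->
  mu.-integrable setT (EFin \o h).
Proof.
move=> ch sh.
have -> : EFin \o h = (EFin \o h) \_ `[(- M), M]%classic.
  apply/funext => t; rewrite patchE; case: ifPn => //.
  rewrite notin_setE /= in_itv /= -ler_norml => /negP; rewrite -ltNge => tM.
  by rewrite sh.
rewrite -integrable_mkcond //; apply: continuous_compact_integrable.
  exact: segment_compact.
exact: continuous_subspaceT.
Qed.

Lemma cc_lint_fin M h : continuous h -> (forall t, M < `|t| -> h t = 0) ->
  (\int[mu]_t (h t)%:E)%E = (lint h)%:E.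
Proof.
move=> ch sh; rewrite /lint /Rintegral fineK //.
by apply: integrable_fin_num => //; exact: (cc_integrable (M := M)).
Qed.

Lemma cc_lint_bound M C h : 0 <= M -> continuous h ->
  (forall t, M < `|t| -> h t = 0) -> (forall t, `|h t| <= C) ->
  `|lint h| <= C * (2 * M).
Proof.
move=> M0 ch sh hC.
have hE : lint h = Rintegral mu `[(- M), M]%classic h.
  rewrite /lint [RHS]Rintegral_mkcond; apply: eq_Rintegral => t _.
  rewrite patchE; case: ifPn => //.
  rewrite notin_setE /= in_itv /= -ler_norml => /negP; rewrite -ltNge => tM.
  by rewrite sh.
have ih : mu.-integrable `[(- M), M]%classic (EFin \o h).
  apply: continuous_compact_integrable; first exact: segment_compact.
  exact: continuous_subspaceT.
rewrite hE; apply: (le_trans (le_normr_Rintegral _ ih)) => //.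
have -> : C * (2 * M) = Rintegral mu `[(- M), M]%classic (cst C).
  rewrite Rintegral_cst //= lebesgue_measure_itv /= lte_fin.
  case: ltP => [_|MM] /=; first by congr (_ * _); ring.
  have -> : M = 0 by lra.
  by rewrite !mulr0.
apply: le_Rintegral => //.
- apply: continuous_compact_integrable; first exact: segment_compact.
  apply: continuous_subspaceT => t; apply: (continuous_comp (ch t)).
  exact: norm_continuous.
- apply: continuous_compact_integrable; first exact: segment_compact.
  by apply: continuous_subspaceT => t; exact: cvg_cst.
Qed.

Lemma cc_lint_shift M a h : continuous h -> (forall t, M < `|t| -> h t = 0) ->
  lint (fun t => h (t + a)) = lint h.
Proof.
move=> ch sh; rewrite /lint /Rintegral; congr fine.
pose phi : measurableTypeR R -> measurableTypeR R := fun t => t + a.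
have cphi : continuous (fun t : R => t + a).
  by move=> t; apply: cvgD; [exact: cvg_id|exact: cvg_cst].
have mphi : measurable_fun setT phi.
  by apply: continuous_measurable_fun.
transitivity (\int[pushforward mu phi]_t (h t)%:E)%E; last first.
  (* Lebesgue measure is determined by its values on the intervals []b, c]], so it suffices that
     translation preserves their length. *)
  apply: eq_measure_integral => A mA _; apply/esym/lebesgue_measure_unique => //.
  move=> _ [[b c]] _ <- /=; rewrite /pushforward.
  have -> : phi @^-1` `]b, c]%classic = `]b - a, c - a]%classic.
    by apply/seteqP; split => t /=; rewrite !in_itv /= ltrBlDr lerBrDr.
  rewrite !lebesgue_measure_itv /= !lte_fin ltrD2r.
  by case: ifP => // _; congr (_%:E); ring.
rewrite (@integral_pushforward _ _ _ _ _ phi mphi mu setT (EFin \o h)) //.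
- by apply/measurable_EFinP; exact: continuous_measurable_fun.
- rewrite preimage_setT; apply: (@cc_integrable (M + `|a|) (h \o phi)).
    by move=> t; apply: continuous_comp; [exact: cphi|exact: ch].
  move=> t Mt; apply: sh; have := ler_normB (t + a) a; rewrite addrK /phi; lra.
Qed.

Lemma cc_lintD M (f g : R -> R) : continuous f -> (forall t, M < `|t| -> f t = 0) ->
  continuous g -> (forall t, M < `|t| -> g t = 0) ->
  lint (fun t => f t + g t) = lint f + lint g.
Proof.
by move=> cf sf cg sg; apply: RintegralD => //; apply: (cc_integrable (M := M)).
Qed.

Lemma cc_lintZ M a (f : R -> R) : continuous f -> (forall t, M < `|t| -> f t = 0) ->
  lint (fun t => a * f t) = a * lint f.
Proof.
by move=> cf sf; apply: RintegralZl => //; apply: (cc_integrable (M := M)).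
Qed.

Lemma lint_ge0 (f : R -> R) : (forall t, 0 <= f t) -> 0 <= lint f.
Proof. by move=> f0; apply: Rintegral_ge0. Qed.

End OneDim.

(** * Iterated integrals of functions of finitely many coordinates *)

Section Iterated.
Context {R : realType}.
Variable d : nat.
Implicit Types (g : (nat -> R) -> R) (y : nat -> R) (M a : R).

Definition upd y k t : nat -> R := fun j => if j == k then t else y j.

Lemma upd_swap y i k s t : i != k -> upd (upd y i s) k t = upd (upd y k t) i s.
Proof.
move=> ik; apply/funext => j; rewrite /upd.
by case: (eqVneq j k) => // ->; rewrite eq_sym (negbTE ik).
Qed.

(** Uniformity is what survives an integration over a bounded range, see [ucont_step]. Only the
    coordinates below [d] are tested, since the integrand sees a sequence through its first [d]
    entries. *)
Definition ucont g := forall e : R, 0 < e -> exists2 dl : R, 0 < dl &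
  forall y y', (forall j, (j < d)%N -> `|y j - y' j| <= dl) -> `|g y - g y'| <= e.

(** The coordinates below [k] are exempt: after [k] integrations they no longer influence the
    value. *)
Definition bsupp k M g :=
  forall y j, (k <= j < d)%N -> M < `|y j| -> g y = 0.

Fixpoint Ir k g : (nat -> R) -> R :=
  match k with
  | 0 => g
  | k'.+1 => fun y => lint (fun t => Ir k' g (upd y k' t))
  end.

Lemma ucont_upd g y k : (k < d)%N -> ucont g -> continuous (fun t => g (upd y k t)).
Proof.
move=> kd ug t; apply/cvgrPdist_le => e e0.
have [dl dl0 H] := ug _ e0.
near=> s; apply: H => j jd; rewrite /upd; case: ifP => _.
  by near: s; apply: cvgr_dist_le.
by rewrite subrr normr0 ltW.
Unshelve. all: by end_near. Qed.

Lemma bsupp_upd g y k M : (k < d)%N -> bsupp k M g ->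
  forall t, M < `|t| -> g (upd y k t) = 0.
Proof.
by move=> kd sg t Mt; apply: (sg _ k); rewrite ?leqnn ?kd // /upd eqxx.
Qed.

Lemma ucont_step g k M : 0 <= M -> (k < d)%N -> ucont g -> bsupp k M g ->
  ucont (fun y => lint (fun t => g (upd y k t))).
Proof.
move=> M0 kd ug sg e e0.
(* The integral over [[-M, M]] multiplies a bound by [2 * M]; the added 1 keeps the quotient
   meaningful for [M = 0]. *)
have e1 : 0 < e / (2 * M + 1) by rewrite divr_gt0 //; lra.
have [dl dl0 H] := ug _ e1; exists dl => // y y' yy'.
have cg z := @ucont_upd g z k kd ug.
have s0 z := @bsupp_upd g z k M kd sg.
have -> : lint (fun t => g (upd y k t)) - lint (fun t => g (upd y' k t)) =
    lint (fun t => g (upd y k t) + -1 * g (upd y' k t)).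
  rewrite (@cc_lintD _ M) //; first by rewrite (@cc_lintZ _ M) ?mulN1r //; exact: s0.
    exact: s0.
    by move=> t; apply: cvgM; [exact: cvg_cst|exact: cg].
  by move=> t Mt; rewrite s0 // mulr0.
apply: (@le_trans _ _ (e / (2 * M + 1) * (2 * M))); last first.
  rewrite mulrAC ler_pdivrMr; last lra.
  by rewrite ler_pM2l //; lra.
apply: cc_lint_bound => //.
- move=> t; apply: cvgD; first exact: cg.
  by apply: cvgM; [exact: cvg_cst|exact: cg].
- by move=> t Mt; rewrite !s0 // mulr0 addr0.
- move=> t; rewrite mulN1r; apply: H => j jd; rewrite /upd.
  by case: ifP => _; [rewrite subrr normr0 ltW|exact: yy'].
Qed.

Lemma bsupp_step g k M : (k < d)%N -> bsupp k M g ->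
  bsupp k.+1 M (fun y => lint (fun t => g (upd y k t))).
Proof.
move=> kd sg y j /andP[kj jd] My.
(* A coordinate [j > k] keeps its value under [upd y k t], so the integrand vanishes for every [t],
   not only for large ones. *)
have -> : (fun t => g (upd y k t)) = (fun t => 0 * g (fun=> M + 1)).
  apply/funext => t; rewrite mul0r; apply: (sg _ j).
    by rewrite jd (ltnW kj).
  by rewrite /upd gtn_eqF.
rewrite /lint /Rintegral; under eq_integral do rewrite mul0r.
by rewrite integral0.
Qed.

Lemma Ir_regular k g M : 0 <= M -> (k <= d)%N -> ucont g -> bsupp 0 M g ->
  ucont (Ir k g) /\ bsupp k M (Ir k g).
Proof.
move=> M0; elim: k => [//|k IH] kd ug sg.
have [uk sk] := IH (ltnW kd) ug sg.
by split; [exact: (ucont_step M0 kd uk sk)|exact: bsupp_step].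
Qed.

(** Bridge from the extended real integral of the statement to a real one: each inner integral is
    finite and stays in the same class of functions, which carries the induction. *)
Lemma iint_Ir k g M : 0 <= M -> (k <= d)%N -> ucont g -> bsupp 0 M g ->
  forall y, iint k (EFin \o g) y = (Ir k g y)%:E.
Proof.
move=> M0; elim: k => [//|k IH] kd ug sg y /=.
have [uk sk] := Ir_regular M0 (ltnW kd) ug sg.
under eq_integral do rewrite (IH (ltnW kd)) //.
apply: (@cc_lint_fin _ M); first exact: ucont_upd.
exact: bsupp_upd.
Qed.

Lemma IrD k f g M : 0 <= M -> (k <= d)%N -> ucont f -> bsupp 0 M f ->
  ucont g -> bsupp 0 M g ->
  Ir k (fun y => f y + g y) = (fun y => Ir k f y + Ir k g y).
Proof.
move=> M0 + uf sf ug sg; elim: k => [//|k IH] kd /=.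
have [ufk sfk] := Ir_regular M0 (ltnW kd) uf sf.
have [ugk sgk] := Ir_regular M0 (ltnW kd) ug sg.
rewrite (IH (ltnW kd)) //; apply/funext => y.
by apply: (@cc_lintD _ M); [exact: ucont_upd|exact: bsupp_upd|exact: ucont_upd|exact: bsupp_upd].
Qed.

Lemma IrZ k a g M : 0 <= M -> (k <= d)%N -> ucont g -> bsupp 0 M g ->
  Ir k (fun y => a * g y) = (fun y => a * Ir k g y).
Proof.
move=> M0 + ug sg; elim: k => [//|k IH] kd /=.
have [ugk sgk] := Ir_regular M0 (ltnW kd) ug sg.
rewrite (IH (ltnW kd)) //; apply/funext => y.
by apply: (@cc_lintZ _ M); [exact: ucont_upd|exact: bsupp_upd].
Qed.

Lemma Ir_ge0 k g : (forall y, 0 <= g y) -> forall y, 0 <= Ir k g y.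
Proof. by move=> g0; elim: k => [//|k IH] y /=; exact: lint_ge0. Qed.

Lemma Ir_bound k g M (C : R) : 0 <= M -> 0 <= C -> (k <= d)%N -> ucont g ->
  bsupp 0 M g -> (forall y, `|g y| <= C) ->
  forall y, `|Ir k g y| <= C * (2 * M) ^+ k.
Proof.
move=> M0 C0 + ug sg gC; elim: k => [|k IH] kd y /=; first by rewrite mulr1.
have [ugk sgk] := Ir_regular M0 (ltnW kd) ug sg.
rewrite exprSr (mulrA C); apply: cc_lint_bound => //.
- exact: ucont_upd.
- exact: bsupp_upd.
- by move=> t; apply: IH; exact: ltnW.
Qed.

(** While [i] is still a parameter the shift passes through the integrals unchanged; at the step
    [k = i] one-dimensional translation invariance removes it. The induction needs both regimes in
    one statement. *)
Lemma Ir_shift k i a g M : 0 <= M -> (k <= d)%N -> ucont g ->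
  bsupp 0 M g ->
  forall y, Ir k (fun z => g (upd z i (z i + a))) y =
    if (i < k)%N then Ir k g y else Ir k g (upd y i (y i + a)).
Proof.
move=> M0 + ug sg; elim: k => [//|k IH] kd y /=.
have [ugk sgk] := Ir_regular M0 (ltnW kd) ug sg.
have [ik|ki] := ltnP i k.
  rewrite ltnS (ltnW ik); congr lint; apply/funext => t.
  by rewrite (IH (ltnW kd)) // ik.
rewrite ltnS; case: (eqVneq i k) ki => [ik|ik] ki.
  subst i; rewrite leqnn -(@cc_lint_shift _ M a (fun t => Ir k g (upd y k t))).
  - congr lint; apply/funext => t; rewrite (IH (ltnW kd)) // ltnn.
    congr (Ir k g _); apply/funext => j; rewrite /upd eqxx.
    by case: (j == k).
  - exact: ucont_upd.
  - exact: bsupp_upd.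
rewrite leqNgt ltn_neqAle eq_sym ik ki /=; congr lint; apply/funext => t.
rewrite (IH (ltnW kd)) // ltnNge ki /=; congr (Ir k g _).
by rewrite upd_swap 1?eq_sym // /upd (negbTE ik).
Qed.

End Iterated.

(** * The integral as a linear functional on compactly supported functions *)

Section CcFunctional.
Context {R : realType} {n : nat}.
Implicit Types (f g : 'rV[R]_n -> R) (x : 'rV[R]_n).

Lemma coord_le_norm x i : `|x 0 i| <= `|x|.
Proof.
rewrite [leRHS]/Num.norm /= mx_normrE; apply/bigmax_geP; right => /=.
by exists (0, i).
Qed.

Lemma rV_norm_le x (e : R) : 0 <= e -> (forall i, `|x 0 i| <= e) -> `|x| <= e.
Proof.
move=> e0 H; rewrite [leLHS]/Num.norm /= mx_normrE; apply/bigmax_leP; split => //.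
by move=> [j i] _ /=; rewrite ord1.
Qed.

Lemma norm_delta_le i : `|delta_mx 0 i : 'rV[R]_n| <= 1.
Proof.
apply: rV_norm_le => // j; rewrite mxE eqxx /=.
by case: (j == i); rewrite ?normr1 ?normr0.
Qed.

(** The norm is the sup norm of matrices, so one large coordinate already forces the value zero, as
    [bsupp] demands. *)
Definition supp_le (M : R) f := forall x, M < `|x| -> f x = 0.

Definition Cc f := continuous f /\ exists M, supp_le M f.

Lemma for_contD x f g : {for x, continuous f} -> {for x, continuous g} ->
  {for x, continuous (fun y => f y + g y)}.
Proof. exact: continuousD. Qed.

Lemma for_contM x f g : {for x, continuous f} -> {for x, continuous g} ->
  {for x, continuous (fun y => f y * g y)}.
Proof. exact: continuousM. Qed.

Lemma for_cont_cst x (c : R) : {for x, continuous (fun _ : 'rV[R]_n => c)}.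
Proof. exact: cst_continuous. Qed.

Lemma supp_leW M M' f : M <= M' -> supp_le M f -> supp_le M' f.
Proof. by move=> MM sf x /(le_lt_trans MM)/sf. Qed.

Lemma Cc_supp f : Cc f -> exists2 M : R, 0 <= M & supp_le M f.
Proof.
move=> [_ [M sM]]; exists (Num.max 0 M); first by rewrite le_max lexx.
by apply: supp_leW sM; rewrite le_max lexx orbT.
Qed.

Lemma Cc_supp2 f g : Cc f -> Cc g ->
  exists2 M : R, 0 <= M & supp_le M f /\ supp_le M g.
Proof.
move=> /Cc_supp[M M0 sf] /Cc_supp[N N0 sg]; exists (Num.max M N).
  by rewrite le_max M0.
by split; [apply: supp_leW sf|apply: supp_leW sg]; rewrite le_max lexx ?orbT.
Qed.

Lemma CcD f g : Cc f -> Cc g -> Cc (fun x => f x + g x).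
Proof.
move=> cf cg; have [M _ [sf sg]] := Cc_supp2 cf cg.
split; first by move=> x; apply: for_contD; [exact: cf.1|exact: cg.1].
by exists M => x Mx; rewrite sf // sg // addr0.
Qed.

Lemma CcM f g : Cc f -> Cc g -> Cc (fun x => f x * g x).
Proof.
move=> cf cg; have [M _ [sf sg]] := Cc_supp2 cf cg.
split; first by move=> x; apply: for_contM; [exact: cf.1|exact: cg.1].
by exists M => x Mx; rewrite sf // mul0r.
Qed.

Lemma CcZ (a : R) f : Cc f -> Cc (fun x => a * f x).
Proof.
move=> cf; have [M _ sf] := Cc_supp cf.
split; first by move=> x; apply: for_contM; [exact: for_cont_cst|exact: cf.1].
by exists M => x Mx; rewrite sf // mulr0.
Qed.

Lemma Cc0 : Cc (fun _ => 0 : R).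
Proof. by split; [move=> x; exact: for_cont_cst|exists 0]. Qed.

Lemma Cc_ext f g : f =1 g -> Cc f -> Cc g.
Proof. by move=> /funext ->. Qed.

Lemma CcB f g : Cc f -> Cc g -> Cc (fun x => f x - g x).
Proof.
move=> cf cg; apply: (@Cc_ext (fun x => f x + -1 * g x)).
  by move=> x; rewrite mulN1r.
by apply: CcD => //; exact: CcZ.
Qed.

Lemma Cc_sum m (F : 'I_m -> 'rV[R]_n -> R) : (forall i, Cc (F i)) ->
  Cc (fun x => \sum_i F i x).
Proof.
elim: m F => [|m IH] F cF.
  by apply: (Cc_ext _ Cc0) => x; rewrite big_ord0.
apply: (@Cc_ext (fun x => (\sum_(i < m) F (widen_ord (leqnSn m) i) x) + F ord_max x)).
  by move=> x; rewrite big_ord_recr.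
by apply: CcD => //; exact: IH.
Qed.

Lemma Cc_shift (a : 'rV[R]_n) f : Cc f -> Cc (fun x => f (x + a)).
Proof.
move=> cf; have [M M0 sf] := Cc_supp cf; split.
  move=> x; suff : {for x, continuous (f \o (fun y => y + a))} by [].
  apply: continuous_comp; last exact: cf.1.
  by apply: (@continuousD _ _ _ id (fun=> a)); [exact: cvg_id|exact: cst_continuous].
exists (M + `|a|) => x Mx; apply: sf.
have := ler_normB (x + a) a; rewrite addrK; lra.
Qed.

Lemma compact_norm_le (M : R) : compact [set x : 'rV[R]_n | `|x| <= M].
Proof.
apply: bounded_closed_compact.
  by exists M; split; [exact: num_real|move=> N MN x /= /le_trans; apply; exact: ltW].
apply: (@closed_comp _ _ _ [set t | t <= M]); last exact: closed_le.
by move=> x _; exact: norm_continuous.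
Qed.

(** Heine-Cantor on the closed ball that carries the support, with compactness in its near-covering
    form. A pair that leaves the ball is handled by symmetry, or because [f] vanishes at both
    points. *)
Lemma Cc_unif f (e : R) : Cc f -> 0 < e ->
  exists2 dl : R, 0 < dl & forall x y, `|x - y| <= dl -> `|f x - f y| <= e.
Proof.
move=> cf e0; have [M M0 sf] := Cc_supp cf.
pose K : set 'rV[R]_n := [set x | `|x| <= M].
have cK : compact K by exact: compact_norm_le.
pose P (dl : R) x := forall y, `|x - y| <= dl -> `|f x - f y| <= e.
have H : \forall dl \near (0 : R)^'+, K `<=` P dl.
  move/compact_near_coveringP : cK; apply => x _.
  have /cvgrPdist_le/(_ (e / 2)) := cf.1 x.
  rewrite divr_gt0 // => /(_ isT) /nbhs_normP[r /= r0 Hr].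
  (* Half of the radius [r] is for the distance from [x] to [z] and half for the step from [z] to
     [y], so both points stay within reach of [Hr]. *)
  exists (ball x (r / 2), [set dl : R | dl <= r / 2]).
    split => /=; first by apply: nbhsx_ballx; rewrite divr_gt0.
    by apply: nbhs_right_le; rewrite divr_gt0.
  move=> [z dl] /= [xz dlr] y zy; rewrite -ball_normE /= in xz.
  have h1 : `|f x - f z| <= e / 2 by apply: Hr => /=; lra.
  have h2 : `|f x - f y| <= e / 2.
    apply: Hr => /=; have := ler_normD (x - z) (z - y); rewrite subrKA; lra.
  have := ler_normB (f x - f y) (f x - f z).
  have -> : f x - f y - (f x - f z) = f z - f y by ring.
  lra.
have [dl /= [dl0 Hdl]] : exists dl, 0 < dl /\ K `<=` P dl.
  near (0 : R)^'+ => dl; exists dl; split; first by near: dl; exact: nbhs_right_gt.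
  by near: dl.
exists dl => // x y xy.
case: (leP `|x| M) => [Kx|xM]; first exact: Hdl.
case: (leP `|y| M) => [Ky|yM]; last by rewrite sf // sf // subrr normr0 ltW.
by rewrite distrC; apply: Hdl => //; rewrite distrC.
Unshelve. all: by end_near. Qed.

Lemma Cc_bounded f : Cc f -> exists2 C : R, 0 <= C & forall x, `|f x| <= C.
Proof.
move=> cf; have [M M0 sf] := Cc_supp cf.
pose K : set 'rV[R]_n := [set x | `|x| <= M].
have cnf : continuous (fun x => `|f x|).
  move=> x; suff : {for x, continuous ((fun t : R => `|t|) \o f)} by [].
  by apply: continuous_comp; [exact: cf.1|exact: norm_continuous].
have [|||c _ Hc] := @compact_EVT_max _ R (fun x => `|f x|) K.
- by exists 0; rewrite /K /= normr0.
- exact: compact_norm_le.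
- exact: continuous_subspaceT.
exists `|f c| => // x; case: (leP `|x| M) => [Kx|xM]; last by rewrite sf // normr0.
by apply: Hc; rewrite inE.
Qed.

Definition J f : R := Ir n (fun y => f (\row_i y i)) (fun=> 0).

Lemma row_ucont f : Cc f -> ucont n (fun y => f (\row_i y i)).
Proof.
move=> cf e e0; have [dl dl0 H] := Cc_unif cf e0; exists dl => // y y' yy'.
apply: H; apply: rV_norm_le; first exact: ltW.
by move=> i; rewrite !mxE; apply: yy'.
Qed.

Lemma row_bsupp f M : supp_le M f -> bsupp n 0 M (fun y => f (\row_i y i)).
Proof.
move=> sf y j jn My; apply: sf; apply: (lt_le_trans My).
by have := coord_le_norm (\row_i y i) (Ordinal jn); rewrite mxE.
Qed.

Lemma integral_Rn_Cc f : Cc f -> integral_Rn (fun x => (f x)%:E) = (J f)%:E.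
Proof.
move=> cf; have [M M0 sf] := Cc_supp cf.
by apply: (iint_Ir M0 _ (row_ucont cf)) => //; exact: row_bsupp.
Qed.

Lemma JD f g : Cc f -> Cc g -> J (fun x => f x + g x) = J f + J g.
Proof.
move=> cf cg; have [M M0 [sf sg]] := Cc_supp2 cf cg.
rewrite /J (@IrD _ n n (fun y => f (\row_i y i)) (fun y => g (\row_i y i)) M) //.
- exact: row_ucont.
- exact: row_bsupp.
- exact: row_ucont.
- exact: row_bsupp.
Qed.

Lemma JZ (a : R) f : Cc f -> J (fun x => a * f x) = a * J f.
Proof.
move=> cf; have [M M0 sf] := Cc_supp cf.
rewrite /J (@IrZ _ n n a (fun y => f (\row_i y i)) M) //.
- exact: row_ucont.
- exact: row_bsupp.
Qed.

Lemma J_ext f g : f =1 g -> J f = J g.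
Proof. by move=> /funext ->. Qed.

Lemma JB f g : Cc f -> Cc g -> J (fun x => f x - g x) = J f - J g.
Proof.
move=> cf cg; rewrite -(mulN1r (J g)) -JZ // -JD //; last exact: CcZ.
by apply: J_ext => x; rewrite mulN1r.
Qed.

Lemma J0 : J (fun=> 0) = 0.
Proof.
by rewrite -[RHS](mul0r (J (fun=> 0))) -JZ; [apply: J_ext => x; rewrite mul0r|exact: Cc0].
Qed.

Lemma J_sum m (F : 'I_m -> 'rV[R]_n -> R) : (forall i, Cc (F i)) ->
  J (fun x => \sum_i F i x) = \sum_i J (F i).
Proof.
elim: m F => [|m IH] F cF.
  by rewrite big_ord0 -[RHS]J0; apply: J_ext => x; rewrite big_ord0.
rewrite big_ord_recr /= -IH // -JD //; last exact: Cc_sum.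
by apply: J_ext => x; rewrite big_ord_recr.
Qed.

Lemma J_ge0 f : (forall x, 0 <= f x) -> 0 <= J f.
Proof. by move=> f0; apply: Ir_ge0. Qed.

Lemma J_bound f M (C : R) : 0 <= M -> 0 <= C -> Cc f -> supp_le M f ->
  (forall x, `|f x| <= C) -> `|J f| <= C * (2 * M) ^+ n.
Proof.
move=> M0 C0 cf sf fC; apply: (@Ir_bound _ n) => //; first exact: row_ucont.
exact: row_bsupp.
Qed.

(** Shifts along the coordinate axes are what an iterated integral gives directly, and they suffice
    for difference quotients. *)
Lemma J_shift (a : R) i f : Cc f -> J (fun x => f (x + a *: delta_mx 0 i)) = J f.
Proof.
move=> cf; have [M M0 sf] := Cc_supp cf.
have := @Ir_shift R n n i a (fun y => f (\row_i y i)) M M0 (leqnn n) (row_ucont cf) (row_bsupp sf) (fun=> 0).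
rewrite ltn_ord /J => <-; congr (Ir n _ _); apply/funext => z.
congr f; apply/rowP => j; rewrite !mxE /upd eqxx /=.
by rewrite (inj_eq val_inj); case: eqVneq => [->|_]; rewrite ?mulr1 // mulr0 addr0.
Qed.

End CcFunctional.

(** * Difference quotients and partial derivatives *)

Section Partial.
Context {R : realType} {n : nat}.
Implicit Types (f g : 'rV[R]_n -> R) (x v : 'rV[R]_n).

(** Plays the part of a limit: the estimates below have the form [K * e] with [K] independent of
    [e]. *)
Lemma eq0_of_small (t K : R) : (forall e : R, 0 < e -> e <= 1 -> `|t| <= K * e) -> t = 0.
Proof.
move=> H; apply/eqP; rewrite -normr_eq0 eq_le normr_ge0 andbT leNgt; apply/negP => t0.
have K0 : 0 < K by have := H 1 ltr01 (lexx 1); lra.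
(* For this [e] the hypothesis would give [|t| <= |t| / 2]. *)
pose e := Num.min 1 (`|t| / (2 * K)).
have e1 : 0 < `|t| / (2 * K) by rewrite divr_gt0 // mulr_gt0.
have e0 : 0 < e by rewrite lt_min ltr01 e1.
have := H e e0; rewrite ge_min lexx => /(_ isT).
have : K * e <= K * (`|t| / (2 * K)) by rewrite ler_pM2l // ge_min lexx orbT.
have -> : K * (`|t| / (2 * K)) = `|t| / 2 by field; rewrite gt_eqF.
lra.
Qed.

(** Identifies difference quotients along [v] with those of a function of one real variable; through
    this the mean value theorem and the chain rule carry over to directional derivatives. *)
Lemma line_growth f x v (t : R) :
  (fun h : R => h^-1 *: (((fun s : R => f (x + s *: v)) \o shift t) (h *: 1) -
     (fun s : R => f (x + s *: v)) t)) =
  (fun h : R => h^-1 *: ((f \o shift (x + t *: v)) (h *: v) - f (x + t *: v))).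
Proof.
apply/funext => h /=; congr (_ *: (f _ - _)).
have -> : h *: (1 : R) = h by rewrite /GRing.scale /= mulr1.
by rewrite scalerDl addrCA.
Qed.

Lemma is_derive_line f x v (t : R) : derivable f (x + t *: v) v ->
  is_derive t (1 : R) (fun s : R => f (x + s *: v)) ('D_v f (x + t *: v)).
Proof.
move=> df; split; first by rewrite /derivable line_growth.
by rewrite /derive line_growth.
Qed.

Lemma MVT_line_pos f x v (h : R) : (forall y, derivable f y v) -> 0 < h ->
  exists2 c : R, 0 <= c <= h & f (x + h *: v) - f x = h * 'D_v f (x + c *: v).
Proof.
move=> df h0.
have [||c] := @MVT R (fun s : R => f (x + s *: v)) (fun s => 'D_v f (x + s *: v)) 0 h h0.
- by move=> t _; exact: is_derive_line.
- apply: derivable_within_continuous => t _.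
  by have [] := is_derive_line (df (x + t *: v)).
rewrite in_itv /= => /andP[c0 ch]; rewrite scale0r addr0 subr0 => ->.
by exists c; rewrite ?(ltW c0) ?(ltW ch) // mulrC.
Qed.

Lemma MVT_line f x v (h : R) : (forall y, derivable f y v) -> h != 0 ->
  exists2 c : R, `|c| <= `|h| & f (x + h *: v) - f x = h * 'D_v f (x + c *: v).
Proof.
move=> df h0; case: (ltgtP h 0) => [hn|hp|/eqP]; last by rewrite (negbTE h0).
  (* For negative [h] the segment is traversed from its other end, with the positive step [- h]. *)
  have [|c /andP[c0 ch] E] := @MVT_line_pos f (x + h *: v) v (- h) df.
    by rewrite oppr_gt0.
  exists (h + c); first by rewrite ler0_norm ?ltr0_norm //; lra.
  move: E; rewrite -addrA -scalerDl subrr scale0r addr0 -addrA -scalerDl mulNr => E.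
  by rewrite -[LHS]opprB E opprK.
have [c /andP[c0 ch] E] := MVT_line_pos x df hp.
by exists c => //; rewrite !ger0_norm // ltW.
Qed.

Definition dq i (h : R) f x := h^-1 * (f (x + h *: delta_mx 0 i) - f x).

(** By the mean value theorem the quotient is a value of [partial i f] at a point within [|h|] of
    [x], and [partial i f] is uniformly continuous. *)
Lemma dq_unif i f (e : R) : (forall y, derivable f y (delta_mx 0 i)) ->
  Cc (partial i f) -> 0 < e ->
  exists2 dl : R, 0 < dl &
    forall h : R, h != 0 -> `|h| <= dl -> forall x, `|dq i h f x - partial i f x| <= e.
Proof.
move=> df cf e0; have [dl dl0 H] := Cc_unif cf e0; exists dl => // h h0 hd x.
have [c ch E] := MVT_line x df h0.
rewrite /dq E mulKf //; apply: H.
rewrite addrAC subrr add0r normrZ; apply: le_trans hd; apply: le_trans ch.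
by rewrite -[leRHS]mulr1 ler_wpM2l // norm_delta_le.
Qed.

Lemma Cc_dq i h f : Cc f -> Cc (dq i h f).
Proof. by move=> cf; apply: CcZ; apply: CcB => //; exact: Cc_shift. Qed.

Lemma supp_dq i h f M : `|h| <= 1 -> supp_le M f -> supp_le (M + 1) (dq i h f).
Proof.
move=> h1 sf x Mx; rewrite /dq !sf ?subrr ?mulr0 //; first lra.
have : `|h *: (delta_mx 0 i : 'rV[R]_n)| <= 1.
  by rewrite normrZ mulr_ile1 // norm_delta_le.
have := ler_normB (x + h *: delta_mx 0 i) (h *: delta_mx 0 i); rewrite addrK; lra.
Qed.

Lemma J_dq i h f : Cc f -> J (dq i h f) = 0.
Proof.
move=> cf; rewrite JZ; last by apply: CcB => //; exact: Cc_shift.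
by rewrite JB ?J_shift ?subrr ?mulr0 //; exact: Cc_shift.
Qed.

Definition C1c f := [/\ Cc f, forall i x, derivable f x (delta_mx 0 i) &
  forall i, Cc (partial i f)].

Lemma supp_partial i f M : supp_le M f -> supp_le M (partial i f).
Proof.
move=> sf x Mx; rewrite /partial.
rewrite (@near_eq_derive _ _ _ f (fun=> 0)) ?derive_cst //.
near=> z; apply: sf; near: z.
have : {for x, continuous (fun z : 'rV[R]_n => `|z|)} by exact: norm_continuous.
by move=> /cvgr_gt; apply.
Unshelve. all: by end_near. Qed.

(** Translation invariance makes the integral of every difference quotient zero, and the quotients
    converge uniformly with supports in a fixed cube. *)
Lemma J_partial i f : C1c f -> J (partial i f) = 0.
Proof.
move=> [cf df cpf]; have [M M0 sf] := Cc_supp cf.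
(* For [|h| <= 1] quotient and derivative vanish outside the cube of half-side [M + 1], whose volume
   is this constant. *)
apply: (@eq0_of_small _ ((2 * (M + 1)) ^+ n)) => e e0 e1.
have [dl dl0 H] := dq_unif (df i) (cpf i) e0.
pose h := Num.min 1 dl.
have h0 : 0 < h by rewrite lt_min ltr01.
have h1 : h <= 1 by rewrite ge_min lexx.
have hd : h <= dl by rewrite ge_min lexx orbT.
have -> : J (partial i f) = - J (fun x => dq i h f x - partial i f x).
  by rewrite JB ?J_dq ?sub0r ?opprK //; exact: Cc_dq.
rewrite normrN [leRHS]mulrC; apply: J_bound.
- lra.
- exact: ltW.
- by apply: CcB => //; exact: Cc_dq.
- move=> x Mx; rewrite (@supp_dq i h f M) ?gtr0_norm // (@supp_partial i f M) ?subr0 //; lra.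
- by move=> x; apply: H; rewrite ?gt_eqF // gtr0_norm.
Qed.

(** Expanded, both sides consist of four products of translates of [f] and [g], which a shift by
    [a], by [b] or by both matches. Moving [f] back instead of [g] forward is what turns [h] into
    [- h]. *)
Lemma J_dq_swap i j (h : R) f g : h != 0 -> Cc f -> Cc g ->
  J (fun x => dq i h f x * dq j h g x) = J (fun x => dq j (- h) f x * dq i (- h) g x).
Proof.
move=> h0 cf cg.
pose a : 'rV[R]_n := h *: delta_mx 0 i; pose b : 'rV[R]_n := h *: delta_mx 0 j.
have cs c : Cc (fun x => f (x + c)) by exact: Cc_shift.
have ct c : Cc (fun x => g (x + c)) by exact: Cc_shift.
have cfg : Cc (fun x => f x * g x) by exact: CcM.
have E1 : J (fun x => dq i h f x * dq j h g x) = h^-1 ^+ 2 *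
    (J (fun x => f (x + a) * g (x + b)) - J (fun x => f (x + a) * g x)
     - J (fun x => f x * g (x + b)) + J (fun x => f x * g x)).
  rewrite -JB; try exact: CcM.
  rewrite -JB; try (apply: CcB; exact: CcM); try exact: CcM.
  rewrite -JD; try (apply: CcB; [apply: CcB; exact: CcM|exact: CcM]); try exact: CcM.
  rewrite -JZ; last by apply: CcD => //; apply: CcB; [apply: CcB; exact: CcM|exact: CcM].
  by apply: J_ext => x; rewrite /dq -/a -/b; ring.
have E2 : J (fun x => dq j (- h) f x * dq i (- h) g x) = h^-1 ^+ 2 *
    (J (fun x => f (x - b) * g (x - a)) - J (fun x => f (x - b) * g x)
     - J (fun x => f x * g (x - a)) + J (fun x => f x * g x)).
  rewrite -JB; try exact: CcM.
  rewrite -JB; try (apply: CcB; exact: CcM); try exact: CcM.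
  rewrite -JD; try (apply: CcB; [apply: CcB; exact: CcM|exact: CcM]); try exact: CcM.
  rewrite -JZ; last by apply: CcD => //; apply: CcB; [apply: CcB; exact: CcM|exact: CcM].
  by apply: J_ext => x; rewrite /dq !scaleNr -/a -/b invrN; ring.
have s1 : J (fun x => f (x - b) * g x) = J (fun x => f x * g (x + b)).
  rewrite -(@J_shift _ _ h j (fun x => f (x - b) * g x)); last exact: CcM.
  by apply: J_ext => x; rewrite -/b addrK.
have s2 : J (fun x => f x * g (x - a)) = J (fun x => f (x + a) * g x).
  rewrite -(@J_shift _ _ h i (fun x => f x * g (x - a))); last exact: CcM.
  by apply: J_ext => x; rewrite -/a addrK.
have s3 : J (fun x => f (x - b) * g (x - a)) = J (fun x => f (x + a) * g (x + b)).
  rewrite -(@J_shift _ _ h i (fun x => f (x - b) * g (x - a))); last exact: CcM.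
  rewrite -(@J_shift _ _ h j (fun x => f (x + a - b) * g (x + a - a))); last first.
    apply: CcM; first exact: (Cc_shift a (cs (- b))).
    exact: (Cc_shift a (ct (- a))).
  by apply: J_ext => x; rewrite -/b addrK (addrAC x b a) addrK.
by rewrite E1 E2 s1 s2 s3; congr (_ * _); ring.
Qed.

Lemma dist_le_sum (p q r e K1 K2 : R) :
  `|q - p| <= K1 * e -> `|q - r| <= K2 * e -> `|p - r| <= (K1 + K2) * e.
Proof.
move=> h1 h2; have := ler_normB (q - r) (q - p).
have -> : q - r - (q - p) = p - r by ring.
rewrite mulrDl; lra.
Qed.

(** For [C^2] functions this is two integrations by parts. Here second derivatives need not exist,
    and the identity is the limit of [J_dq_swap] as [h] tends to 0. *)
Lemma J_swap i j f g : C1c f -> C1c g ->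
  J (fun x => partial i f x * partial j g x) = J (fun x => partial j f x * partial i g x).
Proof.
move=> [cf df cpf] [cg dg cpg]; have [M M0 [sf sg]] := Cc_supp2 cf cg.
(* The rate is linear in [e] with a constant independent of [e], and the threshold holds for both
   signs of [h]: one side is used at [h], the other at [- h]. *)
have approx k l : exists2 K : R, 0 <= K & forall e : R, 0 < e -> e <= 1 ->
    exists2 dl : R, 0 < dl & forall h : R, h != 0 -> `|h| <= dl ->
    `|J (fun x => dq k h f x * dq l h g x) - J (fun x => partial k f x * partial l g x)| <= K * e.
  have [C C0 Cf] := Cc_bounded (cpf k); have [D D0 Dg] := Cc_bounded (cpg l).
  have M1 : 0 <= 2 * (M + 1) by lra.
  exists ((C + 1 + D) * (2 * (M + 1)) ^+ n).
    by apply: mulr_ge0; [lra|exact: exprn_ge0].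
  move=> e e0 e1.
  have [d1 d10 H1] := dq_unif (df k) (cpf k) e0.
  have [d2 d20 H2] := dq_unif (dg l) (cpg l) e0.
  exists (Num.min 1 (Num.min d1 d2)); first by rewrite !lt_min ltr01 d10 d20.
  move=> h h0; rewrite !le_min => /andP[h1 /andP[hd1 hd2]].
  rewrite -JB; [|by apply: CcM; exact: Cc_dq|exact: CcM].
  rewrite mulrAC; apply: J_bound; first lra.
  - by apply: mulr_ge0; lra.
  - by apply: CcB; apply: CcM => //; exact: Cc_dq.
  - move=> x Mx; rewrite (@supp_dq k h f M) // (@supp_partial k f M) ?mul0r ?subr0 //; lra.
  - move=> x.
    have -> : dq k h f x * dq l h g x - partial k f x * partial l g x =
      dq k h f x * (dq l h g x - partial l g x) + (dq k h f x - partial k f x) * partial l g x.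
      by ring.
    apply: (le_trans (ler_normD _ _)); rewrite (normrM (dq k h f x)) (normrM (_ - _)).
    have a1 := H1 _ h0 hd1 x; have a2 := H2 _ h0 hd2 x.
    have a3 : `|dq k h f x| <= C + 1.
      have := ler_normD (dq k h f x - partial k f x) (partial k f x).
      rewrite subrK; have := Cf x; lra.
    have -> : (C + 1 + D) * e = (C + 1) * e + e * D by ring.
    by apply: lerD; apply: ler_pM.
have [K1 K10 A1] := approx i j; have [K2 K20 A2] := approx j i.
apply/eqP; rewrite -subr_eq0; apply/eqP.
apply: (@eq0_of_small _ (K1 + K2)) => e e0 e1.
have [d1 d10 H1] := A1 _ e0 e1; have [d2 d20 H2] := A2 _ e0 e1.
pose h := Num.min d1 d2.
have h0 : 0 < h by rewrite lt_min d10.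
have hn : h != 0 by rewrite gt_eqF.
have := H1 h hn; rewrite gtr0_norm // ge_min lexx => /(_ isT) B1.
have := H2 (- h); rewrite oppr_eq0 normrN hn gtr0_norm // ge_min lexx orbT => /(_ isT isT).
rewrite -J_dq_swap // => B2.
exact: (dist_le_sum B1 B2).
Qed.

End Partial.

(** * Functions of class [C^k] on an open set *)

Section Calculus.
Context {R : realType} {n : nat}.
Implicit Types (f g : 'rV[R]_n -> R) (x v : 'rV[R]_n).

Lemma is_derive_lineP f x v (d : R) :
  is_derive (0 : R) (1 : R) (fun s : R => f (x + s *: v)) d <-> is_derive x v f d.
Proof.
have E : (fun h : R => h^-1 *: (((fun s : R => f (x + s *: v)) \o shift (0 : R)) (h *: 1) -
     (fun s : R => f (x + s *: v)) 0)) =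
  (fun h : R => h^-1 *: ((f \o shift x) (h *: v) - f x)).
  by rewrite line_growth scale0r addr0.
split => -[H1 H2]; split.
- by rewrite /derivable -E.
- by rewrite /derive -E.
- by rewrite /derivable E.
- by rewrite /derive E.
Qed.

Lemma is_derive_comp_out (phi : R -> R) f x v (a d : R) :
  is_derive (f x) (1 : R) phi a -> is_derive x v f d ->
  is_derive x v (fun y => phi (f y)) (a * d).
Proof.
move=> dphi /is_derive_lineP df; apply/is_derive_lineP.
apply: (@is_derive1_comp R phi (fun s : R => f (x + s *: v))) => //.
by rewrite scale0r addr0.
Qed.

Variable Om : set 'rV[R]_n.
Hypothesis openOm : open Om.

(** Regularity is required at the points of [Om] only, as functions such as [ri] lose it at the
    origin. The inductive wrappers keep these predicates from being unfolded. *)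
Variant C0on f : Prop := MkC0on of forall x, Om x -> {for x, continuous f}.
Variant C1on f : Prop := MkC1on of C0on f &
  forall i, (forall x, Om x -> derivable f x (delta_mx 0 i)) /\ C0on (partial i f).
Variant C2on f : Prop := MkC2on of C1on f & forall i, C1on (partial i f).

Lemma C0onP f : C0on f -> forall x, Om x -> {for x, continuous f}.
Proof. by case. Qed.

Lemma nearOm x : Om x -> \forall z \near x, Om z.
Proof. by move=> Ox; move: openOm; rewrite openE; apply. Qed.

Lemma C0on_ext f g : (forall x, Om x -> f x = g x) -> C0on f -> C0on g.
Proof.
move=> fg cf; split => x Ox; have cfx := C0onP cf Ox; rewrite /prop_for /continuous_at -fg //.
have H : {near x, f =1 g} by apply: filterS (nearOm Ox) => z; exact: fg.
exact: (cvg_trans (near_eq_cvg H) cfx).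
Qed.

Lemma derivable_ext f g x v : (forall x, Om x -> f x = g x) -> Om x ->
  derivable f x v -> derivable g x v.
Proof.
move=> fg Ox; apply: near_eq_derivable; near=> z; apply: fg.
by near: z; exact: nearOm.
Unshelve. all: by end_near. Qed.

Lemma partial_ext i f g x : (forall x, Om x -> f x = g x) -> Om x ->
  partial i f x = partial i g x.
Proof.
move=> fg Ox; apply: near_eq_derive; near=> z; apply: fg.
by near: z; exact: nearOm.
Unshelve. all: by end_near. Qed.

Lemma C1on_ext f g : (forall x, Om x -> f x = g x) -> C1on f -> C1on g.
Proof.
move=> fg [cf df]; split; first exact: C0on_ext cf.
move=> i; have [di ci] := df i; split.
  by move=> x Ox; apply: (derivable_ext fg) => //; exact: di.
by apply: C0on_ext ci => x Ox; exact: partial_ext.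
Qed.

Lemma C1on_of f (df : 'I_n -> 'rV[R]_n -> R) : C0on f ->
  (forall i x, Om x -> is_derive x (delta_mx 0 i) f (df i x)) ->
  (forall i, C0on (df i)) -> C1on f.
Proof.
move=> cf hd cd; split => // i; split.
  by move=> x Ox; have [] := hd i x Ox.
by apply: C0on_ext (cd i) => x Ox; have [] := hd i x Ox.
Qed.

Lemma is_derive_C1on f i x : C1on f -> Om x ->
  is_derive x (delta_mx 0 i) f (partial i f x).
Proof. by move=> [_ /(_ i)[df _]] Ox; exact/derivableP/df. Qed.

Lemma C0onD f g : C0on f -> C0on g -> C0on (fun x => f x + g x).
Proof. by move=> [cf] [cg]; split => x Ox; apply: for_contD; [exact: cf|exact: cg]. Qed.

Lemma C0onM f g : C0on f -> C0on g -> C0on (fun x => f x * g x).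
Proof. by move=> [cf] [cg]; split => x Ox; apply: for_contM; [exact: cf|exact: cg]. Qed.

Lemma C0on_cst (c : R) : C0on (fun=> c).
Proof. by split => x Ox; exact: for_cont_cst. Qed.

Lemma C0onZ (c : R) f : C0on f -> C0on (fun x => c * f x).
Proof. by move=> cf; apply: C0onM => //; exact: C0on_cst. Qed.

Lemma C0onN f : C0on f -> C0on (fun x => - f x).
Proof.
by move=> cf; apply: (@C0on_ext (fun x => -1 * f x)); [move=> x _; rewrite mulN1r|exact: C0onZ].
Qed.

Lemma C0onB f g : C0on f -> C0on g -> C0on (fun x => f x - g x).
Proof. by move=> cf cg; apply: C0onD => //; exact: C0onN. Qed.

Lemma C0onX k f : C0on f -> C0on (fun x => f x ^+ k).
Proof.
move=> cf; elim: k => [|k IH]; first exact: C0on_cst.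
by apply: (C0on_ext _ (C0onM cf IH)) => x _; rewrite exprS.
Qed.

Lemma C0on_sum m (F : 'I_m -> 'rV[R]_n -> R) : (forall i, C0on (F i)) ->
  C0on (fun x => \sum_i F i x).
Proof.
elim: m F => [|m IH] F cF.
  by apply: (C0on_ext _ (@C0on_cst 0)) => x; rewrite big_ord0.
apply: (@C0on_ext (fun x => (\sum_(i < m) F (widen_ord (leqnSn m) i) x) + F ord_max x)).
  by move=> x _; rewrite big_ord_recr.
by apply: C0onD => //; exact: IH.
Qed.

Lemma C0on_comp (phi : R -> R) f : C0on f ->
  (forall x, Om x -> {for f x, continuous phi}) -> C0on (fun x => phi (f x)).
Proof.
move=> [cf] cphi; split => x Ox; suff : {for x, continuous (phi \o f)} by [].
by apply: continuous_comp; [exact: cf|exact: cphi].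
Qed.

Lemma C1on_cst (c : R) : C1on (fun=> c).
Proof.
apply: (@C1on_of _ (fun _ _ => 0)); first exact: C0on_cst.
by move=> i; exact: C0on_cst.
Qed.

Lemma partial_cst i (c : R) x : partial i (fun=> c) x = 0.
Proof. exact: derive_cst. Qed.

Lemma C1onD f g : C1on f -> C1on g -> C1on (fun x => f x + g x).
Proof.
move=> cf cg; apply: (@C1on_of _ (fun i x => partial i f x + partial i g x)).
- by apply: C0onD; [case: cf|case: cg].
- by move=> i x Ox; apply: is_deriveD; exact: is_derive_C1on.
- by move=> i; apply: C0onD; [case: cf => _ /(_ i)[]|case: cg => _ /(_ i)[]].
Qed.

Lemma partialD i f g x : C1on f -> C1on g -> Om x ->
  partial i (fun x => f x + g x) x = partial i f x + partial i g x.
Proof.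
move=> cf cg Ox; have [_ H] := is_deriveD (is_derive_C1on i cf Ox) (is_derive_C1on i cg Ox); exact: H.
Qed.

Lemma C1onM f g : C1on f -> C1on g -> C1on (fun x => f x * g x).
Proof.
move=> cf cg; apply: (@C1on_of _ (fun i x => f x * partial i g x + g x * partial i f x)).
- by apply: C0onM; [case: cf|case: cg].
- by move=> i x Ox; apply: is_deriveM; exact: is_derive_C1on.
- move=> i; case: cf => c0f /(_ i)[_ cif]; case: cg => c0g /(_ i)[_ cig].
  by apply: C0onD; exact: C0onM.
Qed.

Lemma partialM i f g x : C1on f -> C1on g -> Om x ->
  partial i (fun x => f x * g x) x = f x * partial i g x + g x * partial i f x.
Proof.
move=> cf cg Ox; have [_ H] := is_deriveM (is_derive_C1on i cf Ox) (is_derive_C1on i cg Ox); exact: H.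
Qed.

Lemma C1on_comp (phi dphi : R -> R) f : C1on f ->
  (forall x, Om x -> is_derive (f x) (1 : R) phi (dphi (f x))) ->
  (forall x, Om x -> {for f x, continuous dphi}) -> C1on (fun x => phi (f x)).
Proof.
move=> cf hd cd; apply: (@C1on_of _ (fun i x => dphi (f x) * partial i f x)).
- apply: C0on_comp; first by case: cf.
  move=> x Ox; apply: differentiable_continuous; apply/derivable1_diffP.
  by have [] := hd x Ox.
- by move=> i x Ox; apply: is_derive_comp_out; [exact: hd|exact: is_derive_C1on].
- move=> i; case: cf => c0f /(_ i)[_ cif]; apply: C0onM => //.
  exact: C0on_comp.
Qed.

Lemma partial_comp i (phi dphi : R -> R) f x : C1on f -> Om x ->
  is_derive (f x) (1 : R) phi (dphi (f x)) ->
  partial i (fun x => phi (f x)) x = dphi (f x) * partial i f x.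
Proof.
move=> cf Ox hd; have [_ H] := is_derive_comp_out hd (is_derive_C1on i cf Ox); exact: H.
Qed.

Lemma is_derive_coord k x v : is_derive x v (fun y : 'rV[R]_n => y 0 k) (v 0 k).
Proof.
apply/is_derive_lineP.
have -> : (fun s : R => (x + s *: v) 0 k) = (fun s : R => x 0 k + s * v 0 k).
  by apply/funext => s; rewrite !mxE.
have H := is_deriveD (is_derive_cst (x 0 k) (0 : R) 1)
  (is_deriveM (is_derive_id (0 : R) 1) (is_derive_cst (v 0 k) (0 : R) 1)).
apply: (is_derive_eq H).
by rewrite /GRing.scale /= mulr0 mulr1 !add0r.
Qed.

Lemma C1on_coord k : C1on (fun y => y 0 k).
Proof.
apply: (@C1on_of _ (fun i _ => (k == i)%:R)).
- by split => x Ox; exact: coord_continuous.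
- move=> i x Ox; have := is_derive_coord k x (delta_mx 0 i).
  by rewrite mxE eqxx.
- by move=> i; exact: C0on_cst.
Qed.

Lemma partial_coord i k x : partial i (fun y => y 0 k) x = (k == i)%:R.
Proof.
by have [_ H] := is_derive_coord k x (delta_mx 0 i); rewrite /partial H mxE eqxx.
Qed.

End Calculus.

(** * Symmetry of second partial derivatives *)

Section Schwarz.
Context {R : realType} {n : nat}.
Implicit Types (f g : 'rV[R]_n -> R) (x v : 'rV[R]_n).

(** Two mean value theorems: in direction [i] for the increment [g] of [f] along [j], then in
    direction [j] for [partial i f]. *)
Lemma second_difference i j f x (h : R) : h != 0 ->
  (forall y, derivable f y (delta_mx 0 i)) ->
  (forall y, derivable (partial i f) y (delta_mx 0 j)) ->
  exists2 z, `|z - x| <= 2 * `|h| &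
  f (x + h *: delta_mx 0 i + h *: delta_mx 0 j) - f (x + h *: delta_mx 0 j) -
  (f (x + h *: delta_mx 0 i) - f x) = h ^+ 2 * partial j (partial i f) z.
Proof.
move=> h0 df ddf; set a := h *: delta_mx 0 i; set b := h *: delta_mx 0 j.
pose g y := f (y + b) - f y.
have dgE y : is_derive y (delta_mx 0 i) g (partial i f (y + b) - partial i f y).
  apply: is_deriveB; last exact/derivableP/df.
  apply/is_derive_lineP.
  have E : (fun s : R => f (y + s *: delta_mx 0 i + b)) =
      (fun s : R => f (y + b + s *: delta_mx 0 i)).
    by apply/funext => s; rewrite addrAC.
  suff : is_derive (0 : R) (1 : R) (fun s : R => f (y + s *: delta_mx 0 i + b))
    (partial i f (y + b)) by [].
  rewrite E; apply/is_derive_lineP; exact/derivableP/df.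
have dg y : derivable g y (delta_mx 0 i) by have [] := dgE y.
have [c ch E] := MVT_line x dg h0.
have [d dh E2] := MVT_line (x + c *: delta_mx 0 i) ddf h0.
exists (x + c *: delta_mx 0 i + d *: delta_mx 0 j).
  have -> : x + c *: delta_mx 0 i + d *: delta_mx 0 j - x =
      c *: delta_mx 0 i + d *: delta_mx 0 j by rewrite -(addrA x) [LHS]addrC addKr.
  have nd k (t : R) : `|t *: (delta_mx 0 k : 'rV[R]_n)| <= `|t|.
    by rewrite normrZ -[leRHS]mulr1 ler_wpM2l // norm_delta_le.
  apply: (le_trans (ler_normD _ _)).
  by have := nd i c; have := nd j d; lra.
have -> : f (x + a + b) - f (x + b) - (f (x + a) - f x) = g (x + a) - g x.
  by rewrite /g; ring.
have [_ D] := dgE (x + c *: delta_mx 0 i).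
by rewrite E D E2 -/(partial j _) mulrA expr2.
Qed.

Lemma dist_le_via (e p p' q r : R) :
  p' = p -> `|p' - r| <= e -> `|p - q| <= e -> `|r - q| <= 2 * e.
Proof.
move=> -> b1 b2; have := ler_normB (p - q) (p - r).
have -> : p - q - (p - r) = r - q by ring.
lra.
Qed.

Lemma partialC i j f : C1c f -> (forall k, C1c (partial k f)) ->
  partial j (partial i f) =1 partial i (partial j f).
Proof.
move=> [cf df _] C x.
apply/eqP; rewrite -subr_eq0; apply/eqP.
apply: (@eq0_of_small _ _ 2) => e e0 _.
have [_ dif cif] := C i; have [_ djf cjf] := C j.
have [d1 d10 H1] := Cc_unif (cif j) e0.
have [d2 d20 H2] := Cc_unif (cjf i) e0.
pose h := Num.min d1 d2 / 2.
have m0 : 0 < Num.min d1 d2 by rewrite lt_min d10.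
have h0 : 0 < h by rewrite divr_gt0.
have hn : h != 0 by rewrite gt_eqF.
have h2 : 2 * `|h| = Num.min d1 d2 by rewrite gtr0_norm // /h; field.
have [z zx E1] := second_difference x hn (df i) (dif j).
have [w wx E2] := second_difference x hn (df j) (djf i).
(* The second difference is symmetric in the two directions, so the mixed derivatives agree, though
   at two different points near [x]. *)
have zw : partial j (partial i f) z = partial i (partial j f) w.
  apply: (mulfI (expf_neq0 2 hn)); apply: (etrans (esym E1)); apply: etrans E2.
  by rewrite (addrAC x (h *: delta_mx 0 j)); ring.
have a1 : `|partial j (partial i f) z - partial j (partial i f) x| <= e.
  by apply: H1; apply: (le_trans zx); rewrite h2 ge_min lexx.
have a2 : `|partial i (partial j f) w - partial i (partial j f) x| <= e.
  by apply: H2; apply: (le_trans wx); rewrite h2 ge_min lexx orbT.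
exact: (dist_le_via zw a1 a2).
Qed.

End Schwarz.

(** * Vector fields and integration by parts *)

Section VectorFields.
Context {R : realType} {n : nat}.
Implicit Types (f g : 'rV[R]_n -> R) (x : 'rV[R]_n) (a b : 'I_n -> 'rV[R]_n -> R).
Variables (Om K : set 'rV[R]_n).
Hypotheses (openOm : open Om) (compactK : compact K) (KOm : K `<=` Om).

Local Notation C0on := (C0on Om).
Local Notation C1on := (C1on Om).
Local Notation C2on := (C2on Om).

Definition zeroK f := forall x, ~ K x -> f x = 0.

(** Vanishing off a compact subset of [Om] absorbs whatever the coefficients do outside [Om]:
    regularity known on [Om] alone then yields a function that [J] can integrate, see [inK_Cc]. *)
Variant inK f : Prop := MkInK of C0on f & zeroK f.

Lemma near_notK x : ~ K x -> \forall z \near x, ~ K z.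
Proof.
move=> Kx; have cK : closed K by apply: compact_closed => //; exact: norm_hausdorff.
by have := closed_openC cK; rewrite openE; apply.
Qed.

Lemma inK_Cc f : inK f -> Cc f.
Proof.
move=> [cf zf]; split.
  move=> x; have [Kx|Kx] := pselect (K x); first by apply: (C0onP cf); exact: KOm.
  have H : {near x, (fun=> 0) =1 f}.
    by apply: filterS (near_notK Kx) => z Kz; rewrite zf.
  have c0 : {for x, continuous (fun _ : 'rV[R]_n => 0 : R)} by exact: for_cont_cst.
  rewrite /prop_for /continuous_at zf //.
  exact: (cvg_trans (near_eq_cvg H) c0).
have [M [_ HM]] := compact_bounded compactK.
exists (M + 1) => x Mx; apply: zf => Kx.
by have := HM (M + 1) _ x Kx; rewrite ltrDl ltr01 => /(_ isT) /= ; lra.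
Qed.

Lemma zeroK_partial i f : zeroK f -> zeroK (partial i f).
Proof.
move=> zf x Kx; rewrite /partial (@near_eq_derive _ _ _ f (fun=> 0)) ?derive_cst //.
by apply: filterS (near_notK Kx) => z Kz; rewrite zf.
Qed.

Lemma zeroKMr f g : zeroK g -> zeroK (fun x => f x * g x).
Proof. by move=> zg x Kx; rewrite zg // mulr0. Qed.

Lemma C1c_of f : C1on f -> zeroK f -> C1c f.
Proof.
move=> [c0f c1f] zf; split.
- exact: inK_Cc.
- move=> i x; have [Kx|Kx] := pselect (K x).
    by have [H _] := c1f i; apply: H; exact: KOm.
  apply: (@near_eq_derivable _ _ _ (fun=> 0)); last exact: derivable_cst.
  by apply: filterS (near_notK Kx) => z Kz; rewrite zf.
- by move=> i; apply: inK_Cc; split; [have [_] := c1f i|exact: zeroK_partial].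
Qed.

Lemma inKD f g : inK f -> inK g -> inK (fun x => f x + g x).
Proof.
move=> [cf zf] [cg zg]; split; first exact: C0onD.
by move=> x Kx; rewrite zf // zg // addr0.
Qed.

Lemma inKM f g : C0on f -> inK g -> inK (fun x => f x * g x).
Proof. by move=> cf [cg zg]; split; [exact: C0onM|exact: zeroKMr]. Qed.

Lemma inK_sum m (F : 'I_m -> 'rV[R]_n -> R) : (forall i, inK (F i)) ->
  inK (fun x => \sum_i F i x).
Proof.
move=> iF; split; first by apply: C0on_sum => // i; have [] := iF i.
by move=> x Kx; rewrite big1 // => i _; have [_ ->] := iF i.
Qed.

(** The derivative of [f] along the vector field with coefficients [a]; one calculus serves radial,
    tangential and coordinate fields. *)
Definition op a f x : R := \sum_j a j x * partial j f x.

Lemma opM a f g x : C1on f -> C1on g -> Om x ->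
  op a (fun x => f x * g x) x = f x * op a g x + g x * op a f x.
Proof.
move=> cf cg Ox; rewrite /op !big_distrr -big_split /=; apply: eq_bigr => j _.
by rewrite (partialM j cf cg Ox); ring.
Qed.

Lemma opD a f g x : C1on f -> C1on g -> Om x ->
  op a (fun x => f x + g x) x = op a f x + op a g x.
Proof.
move=> cf cg Ox; rewrite /op -big_split /=; apply: eq_bigr => j _.
by rewrite (partialD j cf cg Ox); ring.
Qed.

Lemma op_cst a (c : R) x : op a (fun=> c) x = 0.
Proof. by rewrite /op big1 // => j _; rewrite partial_cst mulr0. Qed.

Lemma opZ a (c : R) f x : C1on f -> Om x -> op a (fun x => c * f x) x = c * op a f x.
Proof.
move=> cf Ox; rewrite opM ?op_cst ?mulr0 ?addr0 //; exact: C1on_cst.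
Qed.

Lemma op_ext a f g x : (forall x, Om x -> f x = g x) -> Om x -> op a f x = op a g x.
Proof.
by move=> fg Ox; apply: eq_bigr => j _; rewrite (partial_ext openOm j fg Ox).
Qed.

Lemma op_comp a (phi dphi : R -> R) f x : C1on f -> Om x ->
  is_derive (f x) (1 : R) phi (dphi (f x)) ->
  op a (fun x => phi (f x)) x = dphi (f x) * op a f x.
Proof.
move=> cf Ox hd; rewrite /op big_distrr; apply: eq_bigr => j _ /=.
by rewrite (partial_comp j cf Ox hd) mulrCA.
Qed.

Lemma op_coord a k x : op a (fun y => y 0 k) x = a k x.
Proof.
rewrite /op (bigD1 k) //= partial_coord eqxx mulr1 big1 ?addr0 // => j jk.
by rewrite partial_coord eq_sym (negbTE jk) mulr0.
Qed.

Lemma C1on_sum m (F : 'I_m -> 'rV[R]_n -> R) : (forall i, C1on (F i)) ->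
  C1on (fun x => \sum_i F i x).
Proof.
elim: m F => [|m IH] F cF.
  by apply: (C1on_ext openOm _ (C1on_cst openOm 0)) => x _; rewrite big_ord0.
apply: (@C1on_ext _ _ _ openOm (fun x => (\sum_(i < m) F (widen_ord (leqnSn m) i) x) + F ord_max x)).
  by move=> x _; rewrite big_ord_recr.
by apply: C1onD => //; exact: IH.
Qed.

Lemma op_sum a m (F : 'I_m -> 'rV[R]_n -> R) x : (forall i, C1on (F i)) -> Om x ->
  op a (fun y => \sum_i F i y) x = \sum_i op a (F i) x.
Proof.
move=> cF Ox; elim: m F cF => [|m IH] F cF.
  rewrite big_ord0; apply: (etrans _ (op_cst a 0 x)); apply: op_ext => // y _.
  by rewrite big_ord0.
rewrite big_ord_recr /= -IH // -opD //; last exact: C1on_sum.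
by apply: op_ext => // y _; rewrite big_ord_recr.
Qed.

Lemma C1on0 f : C1on f -> C0on f. Proof. by case. Qed.

Lemma C1on_partial i f : C1on f -> C0on (partial i f).
Proof. by case=> _ /(_ i)[]. Qed.

Lemma C2on1 f : C2on f -> C1on f. Proof. by case. Qed.

Lemma C0on_op a f : (forall j, C0on (a j)) -> C1on f -> C0on (op a f).
Proof.
move=> ca cf; apply: C0on_sum => // j; apply: C0onM => //; exact: C1on_partial.
Qed.

Lemma C1on_op a f : (forall j, C1on (a j)) -> C2on f -> C1on (op a f).
Proof.
by move=> ca [_ cf]; apply: C1on_sum => j; apply: C1onM.
Qed.

Lemma zeroK_op a f : zeroK f -> zeroK (op a f).
Proof.
by move=> zf x Kx; rewrite /op big1 // => j _; rewrite zeroK_partial // mulr0.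
Qed.

Lemma inK_op a f : (forall j, C0on (a j)) -> C1on f -> zeroK f -> inK (op a f).
Proof. by move=> ca cf zf; split; [exact: C0on_op|exact: zeroK_op]. Qed.

Lemma op_op a b f x : (forall j, C1on (b j)) -> C2on f -> Om x ->
  op a (op b f) x = \sum_k op a (b k) x * partial k f x
    + \sum_k \sum_l b k x * a l x * partial l (partial k f) x.
Proof.
move=> cb [_ cf] Ox.
rewrite [op b f](_ : _ = fun y => \sum_k b k y * partial k f y) //.
rewrite op_sum //; last by move=> k; exact: C1onM.
rewrite -big_split /=; apply: eq_bigr => k _; rewrite opM //.
rewrite [LHS]addrC; congr (_ + _); first by rewrite mulrC.
by rewrite /op big_distrr; apply: eq_bigr => l _ /=; rewrite mulrA.
Qed.

(** The second-order parts cancel by symmetry of second derivatives, which [partialC] provides for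
    functions on the whole space; [zeroK f] grants the extension. *)
Lemma op_commutator a b f x : (forall j, C1on (a j)) -> (forall j, C1on (b j)) ->
  C2on f -> zeroK f -> Om x ->
  op a (op b f) x - op b (op a f) x =
  \sum_k (op a (b k) x - op b (a k) x) * partial k f x.
Proof.
move=> ca cb cf zf Ox; rewrite !op_op //.
have -> : \sum_k \sum_l a k x * b l x * partial l (partial k f) x =
    \sum_k \sum_l b k x * a l x * partial l (partial k f) x.
  rewrite exchange_big /=; apply: eq_bigr => k _; apply: eq_bigr => l _.
  rewrite (@partialC _ _ k l) ?(mulrC (a l x)) //.
    by apply: C1c_of => //; case: cf.
  by move=> i; apply: C1c_of; [case: cf => _|exact: zeroK_partial].
rewrite opprD addrACA subrr addr0 -sumrB; apply: eq_bigr => k _.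
by rewrite mulrBl.
Qed.

Variable m : 'rV[R]_n -> R.
Hypothesis C1m : C1on m.

(** [dv] is the divergence of the field [a] for the measure [m dx]. *)
Definition has_div a dv :=
  forall x, Om x -> \sum_j partial j (fun y => m y * a j y) x = m x * dv x.

(** The difference of the two sides is the integral of the Euclidean divergence of the field
    [m * g * a]. *)
Lemma J_op a dv g : (forall j, C1on (a j)) -> C0on dv -> has_div a dv ->
  C1on g -> zeroK g ->
  J (fun x => m x * op a g x) = - J (fun x => m x * (dv x * g x)).
Proof.
move=> ca cdv hdv cg zg.
have cma j : C1on (fun y => m y * a j y) by exact: C1onM.
have E : J (fun x => \sum_j partial j (fun y => m y * a j y * g y) x) = 0.
  rewrite J_sum => [|j].
    rewrite big1 // => j _; apply: J_partial; apply: C1c_of; last exact: zeroKMr.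
    exact: C1onM.
  apply: inK_Cc; split; first by apply: C1on_partial; exact: C1onM.
  by apply: zeroK_partial; exact: zeroKMr.
apply/eqP; rewrite -addr_eq0 -JD; last 2 first.
- by apply: inK_Cc; apply: inKM; [exact: C1on0|apply: inK_op => // j; exact: C1on0].
- apply: inK_Cc; apply: inKM; first exact: C1on0.
  by apply: inKM => //; split => //; exact: C1on0.
apply/eqP; rewrite -E; apply: J_ext => x.
have [Kx|Kx] := pselect (K x); last first.
  rewrite zeroK_op // zg // !mulr0 addr0 big1 // => j _.
  by rewrite zeroK_partial //; exact: zeroKMr.
have Ox := KOm Kx.
under eq_bigr => j _ do rewrite (partialM j (cma j) cg Ox).
rewrite big_split /= -big_distrr /= hdv // /op big_distrr /=; congr (_ + _).
  by apply: eq_bigr => j _; rewrite mulrA.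
by ring.
Qed.

(** Moving the fields across one at a time would need second derivatives of [f] or [g]. Exchanging
    them avoids this and costs only the divergences and the commutator, of first order in [g].
    Bochner's formula is this identity applied to first derivatives of a [C^2] function. *)
Lemma J_op_swap a b dva dvb f g :
  (forall j, C1on (a j)) -> (forall j, C1on (b j)) -> C0on dva -> C0on dvb ->
  has_div a dva -> has_div b dvb ->
  C1on f -> zeroK f -> C1on g -> zeroK g ->
  J (fun x => m x * (op a f x * op b g x)) =
  J (fun x => m x * (op b f x * op a g x)) +
  J (fun x => m x * (f x * (dvb x * op a g x - dva x * op b g x
    + \sum_k (op b (a k) x - op a (b k) x) * partial k g x))).
Proof.
move=> ca cb cdva cdvb ha hb cf zf cg zg.
pose c j l y := m y * a j y * b l y.
have cc j l : C1on (c j l) := C1onM openOm (C1onM openOm C1m (ca j)) (cb l).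
have ccf j l : C1c (fun y => c j l y * f y).
  by apply: C1c_of; [exact: (C1onM openOm (cc j l) cf)|exact: zeroKMr].
have c1g : C1c g by exact: C1c_of.
have Ccp j l k k' : Cc (fun x => partial k (fun y => c j l y * f y) x * partial k' g x).
  by case: (ccf j l) => _ _ H; case: c1g => _ _ H'; exact: CcM.
(* Each pair [j], [l] has integral zero by [J_swap], with the coefficient [c j l] attached to
   [f]. *)
have E : J (fun x => \sum_j \sum_l (partial j (fun y => c j l y * f y) x * partial l g x
     - partial l (fun y => c j l y * f y) x * partial j g x)) = 0.
  rewrite J_sum => [|j]; last by apply: Cc_sum => l; exact: CcB.
  rewrite big1 // => j _; rewrite J_sum => [|l]; last exact: CcB.
  rewrite big1 // => l _; rewrite JB //.
  by rewrite (J_swap j l (ccf j l) c1g) subrr.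
have cop h h' : (forall j, C1on (h j)) -> C1on h' -> zeroK h' -> inK (op h h').
  by move=> ch ch' zh'; apply: inK_op => // j; exact: C1on0.
have cm0 := C1on0 C1m.
have cfz : inK f by split => //; exact: C1on0.
have c0a j : C0on (a j) by exact: C1on0.
have c0b j : C0on (b j) by exact: C1on0.
have I1 : Cc (fun x => m x * (op a f x * op b g x)).
  by apply: inK_Cc; apply: inKM cm0 _; apply: inKM (C0on_op c0a cf) (cop _ _ cb cg zg).
have I2 : Cc (fun x => m x * (op b f x * op a g x)).
  by apply: inK_Cc; apply: inKM cm0 _; apply: inKM (C0on_op c0b cf) (cop _ _ ca cg zg).
have I3 : Cc (fun x => m x * (f x * (dvb x * op a g x - dva x * op b g x
    + \sum_k (op b (a k) x - op a (b k) x) * partial k g x))).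
  apply: inK_Cc; apply: inKM cm0 _; apply: inKM (C1on0 cf) _; apply: inKD.
    split; last first.
      by move=> x Kx; rewrite (zeroK_op _ zg Kx) (zeroK_op _ zg Kx) !mulr0 subr0.
    exact: (C0onB openOm (C0onM cdvb (C0on_op c0a cg)) (C0onM cdva (C0on_op c0b cg))).
  apply: inK_sum => k; apply: inKM.
    exact: (C0onB openOm (C0on_op c0b (ca k)) (C0on_op c0a (cb k))).
  by split; [exact: C1on_partial|exact: zeroK_partial].
rewrite -(JD I2 I3); apply/eqP; rewrite -subr_eq0 -(JB I1 (CcD I2 I3)).
apply/eqP; rewrite -[RHS]E; apply: J_ext => x.
have [Kx|Kx] := pselect (K x); last first.
  rewrite [op a f x]zeroK_op // [op b f x]zeroK_op // zf // !(mul0r, mulr0, addr0, subr0).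
  rewrite big1 // => j _; rewrite big1 // => l _.
  by rewrite (zeroK_partial _ zg Kx) (zeroK_partial _ zg Kx) !mulr0 subr0.
have Ox := KOm Kx.
have Ep j l k : partial k (fun y => c j l y * f y) x = c j l x * partial k f x +
    f x * partial k (c j l) x by exact: partialM.
(* The same derivative in two groupings, keeping [m * b l] or [m * a j] together, so that the
   divergence of either field is recognised after summation. *)
have Eca j l k : partial k (c j l) x =
    a j x * partial k (fun y => m y * b l y) x + m x * b l x * partial k (a j) x.
  rewrite (@partial_ext _ _ _ openOm k (c j l) (fun y => a j y * (m y * b l y))) //; last first.
    by move=> y _; rewrite /c; ring.
  by rewrite (partialM k (ca j) (C1onM openOm C1m (cb l)) Ox).
have Ecb j l k : partial k (c j l) x =
    b l x * partial k (fun y => m y * a j y) x + m x * a j x * partial k (b l) x.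
  rewrite (@partial_ext _ _ _ openOm k (c j l) (fun y => b l y * (m y * a j y))) //; last first.
    by move=> y _; rewrite /c; ring.
  by rewrite (partialM k (cb l) (C1onM openOm C1m (ca j)) Ox).
have S1 : \sum_j \sum_l (c j l x * partial j f x * partial l g x) = m x * (op a f x * op b g x).
  rewrite /op big_distrl /= big_distrr /=; apply: eq_bigr => j _.
  by rewrite !big_distrr /=; apply: eq_bigr => l _; rewrite /c; ring.
have S2 : \sum_j \sum_l (c j l x * partial l f x * partial j g x) = m x * (op b f x * op a g x).
  rewrite exchange_big /= /op big_distrl /= big_distrr /=; apply: eq_bigr => l _.
  by rewrite !big_distrr /=; apply: eq_bigr => j _; rewrite /c; ring.
have S3 : \sum_j \sum_l (f x * partial j (c j l) x * partial l g x) =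
    m x * (f x * (dva x * op b g x + \sum_k op a (b k) x * partial k g x)).
  rewrite exchange_big /=.
  have -> : m x * (f x * (dva x * op b g x + \sum_k op a (b k) x * partial k g x)) =
    \sum_k (f x * partial k g x * (b k x * (m x * dva x) + m x * op a (b k) x)).
    rewrite /op mulrDr mulrDr !big_distrr -big_split /=; apply: eq_bigr => k _.
    by ring.
  apply: eq_bigr => l _; rewrite -ha // /op !big_distrr -big_split big_distrr /=.
  by apply: eq_bigr => j _; rewrite Ecb; ring.
have S4 : \sum_j \sum_l (f x * partial l (c j l) x * partial j g x) =
    m x * (f x * (dvb x * op a g x + \sum_k op b (a k) x * partial k g x)).
  have -> : m x * (f x * (dvb x * op a g x + \sum_k op b (a k) x * partial k g x)) =
    \sum_k (f x * partial k g x * (a k x * (m x * dvb x) + m x * op b (a k) x)).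
    rewrite /op mulrDr mulrDr !big_distrr -big_split /=; apply: eq_bigr => k _.
    by ring.
  apply: eq_bigr => j _; rewrite -hb // /op !big_distrr -big_split big_distrr /=.
  by apply: eq_bigr => l _; rewrite Eca; ring.
have -> : \sum_k (op b (a k) x - op a (b k) x) * partial k g x =
    \sum_k op b (a k) x * partial k g x - \sum_k op a (b k) x * partial k g x.
  by rewrite -sumrB; apply: eq_bigr => k _; rewrite mulrBl.
transitivity (m x * (op a f x * op b g x) + m x * (f x * (dva x * op b g x + \sum_k op a (b k) x * partial k g x))
  - (m x * (op b f x * op a g x) + m x * (f x * (dvb x * op a g x + \sum_k op b (a k) x * partial k g x)))).
  by ring.
rewrite -S1 -S2 -S3 -S4 -!big_split -sumrB /=; apply: eq_bigr => j _.
rewrite -!big_split -sumrB /=; apply: eq_bigr => l _.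
by rewrite !Ep; ring.
Qed.

End VectorFields.

(** * Closure properties of [C^1] and [C^2] functions and chain rules *)

Section SecondOrder.
Context {R : realType} {n : nat}.
Implicit Types (f g : 'rV[R]_n -> R) (x : 'rV[R]_n).
Variable Om : set 'rV[R]_n.
Hypothesis openOm : open Om.

Lemma C1onZ (c : R) f : C1on Om f -> C1on Om (fun x => c * f x).
Proof. by move=> cf; exact: (C1onM openOm (C1on_cst openOm c) cf). Qed.

Lemma C1onN f : C1on Om f -> C1on Om (fun x => - f x).
Proof.
move=> cf; apply: (C1on_ext openOm _ (C1onZ (-1) cf)) => x _.
by rewrite mulN1r.
Qed.

Lemma C1onB f g : C1on Om f -> C1on Om g -> C1on Om (fun x => f x - g x).
Proof. by move=> cf cg; exact: (C1onD openOm cf (C1onN cg)). Qed.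

Lemma C1onX k f : C1on Om f -> C1on Om (fun x => f x ^+ k).
Proof.
move=> cf; elim: k => [|k IH]; first exact: (C1on_cst openOm 1).
by apply: (C1on_ext openOm _ (C1onM openOm cf IH)) => x _; rewrite exprS.
Qed.

Lemma C2on_cst (c : R) : C2on Om (fun=> c).
Proof.
split; first exact: C1on_cst.
move=> i; apply: (C1on_ext openOm _ (C1on_cst openOm 0)) => x _.
by rewrite partial_cst.
Qed.

Lemma C2on_coord k : C2on Om (fun x => x 0 k).
Proof.
split; first exact: C1on_coord.
move=> i; apply: (C1on_ext openOm _ (C1on_cst openOm (k == i)%:R)) => x _.
by rewrite partial_coord.
Qed.

Lemma C2onD f g : C2on Om f -> C2on Om g -> C2on Om (fun x => f x + g x).
Proof.
move=> [cf df] [cg dg]; split; first exact: C1onD.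
move=> i; apply: (C1on_ext openOm _ (C1onD openOm (df i) (dg i))) => x Ox.
by rewrite (partialD i cf cg Ox).
Qed.

Lemma C2onM f g : C2on Om f -> C2on Om g -> C2on Om (fun x => f x * g x).
Proof.
move=> [cf df] [cg dg]; split; first exact: C1onM.
move=> i.
apply: (C1on_ext openOm _ (C1onD openOm (C1onM openOm cf (dg i)) (C1onM openOm cg (df i)))) => x Ox.
by rewrite (partialM i cf cg Ox).
Qed.

Lemma C2onZ (c : R) f : C2on Om f -> C2on Om (fun x => c * f x).
Proof. by move=> cf; exact: (C2onM (C2on_cst c) cf). Qed.

Lemma C2on_sum m (F : 'I_m -> 'rV[R]_n -> R) : (forall i, C2on Om (F i)) ->
  C2on Om (fun x => \sum_i F i x).
Proof.
move=> cF; split; first by apply: C1on_sum => // i; case: (cF i).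
elim: m F cF => [|m IH] F cF i.
  apply: (C1on_ext openOm _ (C1on_cst openOm 0)) => x Ox.
  rewrite -[LHS](partial_cst i 0 x); apply: (partial_ext openOm) => // y _.
  by rewrite big_ord0.
have cF' j : C2on Om (F (widen_ord (leqnSn m) j)) by [].
apply: (C1on_ext openOm _ (C1onD openOm (IH _ cF' i) (match cF ord_max with MkC2on _ h => h i end))) => x Ox.
rewrite -(partialD i _ _ Ox).
- by apply: (partial_ext openOm) => // y _; rewrite big_ord_recr.
- by apply: C1on_sum => // j; case: (cF' j).
- by case: (cF ord_max).
Qed.

Lemma C2on_comp (phi dphi ddphi : R -> R) f : C2on Om f ->
  (forall x, Om x -> is_derive (f x) (1 : R) phi (dphi (f x))) ->
  (forall x, Om x -> is_derive (f x) (1 : R) dphi (ddphi (f x))) ->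
  (forall x, Om x -> {for f x, continuous ddphi}) -> C2on Om (fun x => phi (f x)).
Proof.
move=> [cf df] h1 h2 h3.
have cd : forall x, Om x -> {for f x, continuous dphi}.
  move=> x Ox; apply: differentiable_continuous; apply/derivable1_diffP.
  by have [] := h2 x Ox.
split; first exact: (C1on_comp openOm cf h1 cd).
move=> i; apply: (C1on_ext openOm _ (C1onM openOm (C1on_comp openOm cf h2 h3) (df i))) => x Ox.
by rewrite (partial_comp i cf Ox (h1 x Ox)).
Qed.

Lemma C2on_expR f : C2on Om f -> C2on Om (fun x => expR (f x)).
Proof.
move=> cf; apply: (@C2on_comp expR expR expR) => // x _.
exact: continuous_expR.
Qed.

Lemma C2on_ln f : C2on Om f -> (forall x, Om x -> 0 < f x) -> C2on Om (fun x => ln (f x)).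
Proof.
move=> cf f0; apply: (@C2on_comp _ (fun y => y^-1) (fun y => - y ^- 2)) => // x Ox.
- exact: is_derive1_ln (f0 x Ox).
- apply: (is_derive_eq (is_deriveV (f := id) _ _)); first by rewrite gt_eqF // f0.
  by rewrite /GRing.scale /= mulr1.
- apply: (@continuousN _ _ _ (fun y : R => y ^- 2)).
  have n0 : f x ^+ 2 != 0 by rewrite expf_neq0 // gt_eqF // f0.
  apply: (@continuousV _ _ (fun y : R => y ^+ 2)) => //.
  exact: exprn_continuous.
Qed.

Lemma C1on_ln f : C1on Om f -> (forall x, Om x -> 0 < f x) -> C1on Om (fun x => ln (f x)).
Proof.
move=> cf f0; apply: (@C1on_comp _ _ _ openOm _ (fun y => y^-1)) => // x Ox.
  exact: is_derive1_ln (f0 x Ox).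
apply: (@continuousV _ _ (fun y : R => y)); last exact: cvg_id.
by rewrite gt_eqF // f0.
Qed.

Lemma C1on_inv f : C1on Om f -> (forall x, Om x -> f x != 0) -> C1on Om (fun x => (f x)^-1).
Proof.
move=> cf f0; apply: (@C1on_comp _ _ _ openOm (fun y => y^-1) (fun y => - y ^- 2)) => // x Ox.
- apply: (is_derive_eq (is_deriveV (f := id) _ _)); first exact: f0.
  by rewrite /GRing.scale /= mulr1.
- apply: (@continuousN _ _ _ (fun y : R => y ^- 2)).
  apply: (@continuousV _ _ (fun y : R => y ^+ 2)); first by rewrite expf_neq0 // f0.
  exact: exprn_continuous.
Qed.

Lemma op_inv (a : 'I_n -> 'rV[R]_n -> R) f x : C1on Om f -> Om x -> f x != 0 ->
  op a (fun x => (f x)^-1) x = - f x ^- 2 * op a f x.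
Proof.
move=> cf Ox f0; apply: (@op_comp _ _ Om a (fun y => y^-1) (fun y => - y ^- 2) f) => //.
apply: (is_derive_eq (is_deriveV (f := id) _ _)) => //.
by rewrite /GRing.scale /= mulr1.
Qed.

Lemma op_ln (a : 'I_n -> 'rV[R]_n -> R) f x : C1on Om f -> Om x -> 0 < f x ->
  op a (fun x => ln (f x)) x = (f x)^-1 * op a f x.
Proof.
move=> cf Ox f0; apply: (@op_comp _ _ Om a _ (fun y => y^-1) f) => //.
exact: is_derive1_ln.
Qed.

Lemma op_expR (a : 'I_n -> 'rV[R]_n -> R) f x : C1on Om f -> Om x ->
  op a (fun x => expR (f x)) x = expR (f x) * op a f x.
Proof. by move=> cf Ox; exact: (@op_comp _ _ Om a _ expR f). Qed.

Lemma opN (a : 'I_n -> 'rV[R]_n -> R) f x : C1on Om f -> Om x ->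
  op a (fun x => - f x) x = - op a f x.
Proof.
move=> cf Ox; rewrite -mulN1r -(opZ openOm a (-1) cf Ox).
by apply: (op_ext openOm) => // y _; rewrite mulN1r.
Qed.

Lemma opB (a : 'I_n -> 'rV[R]_n -> R) f g x : C1on Om f -> C1on Om g -> Om x ->
  op a (fun x => f x - g x) x = op a f x - op a g x.
Proof. by move=> cf cg Ox; rewrite (opD a cf (C1onN cg) Ox) opN. Qed.

End SecondOrder.

(** * Polar vector fields *)

Section Polar.
Context {R : realType} {n : nat}.
Implicit Types (f g : 'rV[R]_n -> R) (x : 'rV[R]_n) (a : 'I_n -> 'rV[R]_n -> R).

Local Notation Om := (@punctured_ball R n).
Local Notation r := (@euclid_norm R n).

(** On the punctured ball [cs = 1 / sinh rho] and [ct = coth rho], see [sinh_rho]. *)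
Definition sqn x : R := \sum_i x 0 i ^+ 2.
Definition ri x : R := (r x)^-1.
Definition cs x : R := (1 - sqn x) / 2 * ri x.
Definition ct x : R := (1 + sqn x) / 2 * ri x.

Lemma sqn_ge0 x : 0 <= sqn x.
Proof. by apply: sumr_ge0 => i _; rewrite sqr_ge0. Qed.

Lemma r_sqr x : r x ^+ 2 = sqn x.
Proof. by rewrite /euclid_norm sqr_sqrtr // sqn_ge0. Qed.

Lemma r_continuous : continuous r.
Proof.
have H : C0on setT r.
  apply: (@C0on_comp _ _ setT Num.sqrt sqn); last by move=> x _; exact: sqrt_continuous.
  apply: (C0on_sum openT) => i; apply: (C0onX openT).
  by split => x _; exact: coord_continuous.
by move=> x; apply: (C0onP H).
Qed.

Lemma open_Om : open Om.
Proof.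
have -> : Om = r @^-1` [set` `]0, 1[ ].
  by apply/seteqP; split => x; rewrite /punctured_ball /= in_itv.
by apply: open_comp; [move=> x _; exact: r_continuous|exact: itv_open].
Qed.

Let oO := open_Om.

Section AtPoint.
Variable x : 'rV[R]_n.
Hypothesis Ox : Om x.

Lemma r_gt0 : 0 < r x. Proof. by case/andP: Ox. Qed.
Lemma r_lt1 : r x < 1. Proof. by case/andP: Ox. Qed.
Lemma r_neq0 : r x != 0. Proof. by rewrite gt_eqF // r_gt0. Qed.
Lemma sqn_gt0 : 0 < sqn x. Proof. by rewrite -r_sqr exprn_gt0 // r_gt0. Qed.
Lemma sqn_lt1 : sqn x < 1.
Proof. by rewrite -r_sqr expr_lt1 // ?r_lt1 // ltW // r_gt0. Qed.
Lemma ri_gt0 : 0 < ri x. Proof. by rewrite invr_gt0 r_gt0. Qed.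
Lemma cs_gt0 : 0 < cs x.
Proof. by rewrite mulr_gt0 ?ri_gt0 // divr_gt0 // subr_gt0 sqn_lt1. Qed.
Lemma r_ri : r x * ri x = 1. Proof. by rewrite mulfV // r_neq0. Qed.
Lemma sqn_ri : sqn x * ri x = r x.
Proof. by rewrite -r_sqr expr2 -mulrA r_ri mulr1. Qed.
Lemma ct_sqr : ct x ^+ 2 = 1 + cs x ^+ 2.
Proof.
have -> : ct x ^+ 2 = (sqn x * ri x) * ri x + cs x ^+ 2 by rewrite /ct /cs; field.
by rewrite sqn_ri r_ri.
Qed.

End AtPoint.

Lemma C2_sqn : C2on Om sqn.
Proof.
apply: (C2on_sum oO) => i; apply: (C2onM oO) => //; exact: C2on_coord.
Qed.

Lemma C2_lnq : C2on Om (fun x => ln (sqn x)).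
Proof. by apply: (C2on_ln oO C2_sqn) => x; exact: sqn_gt0. Qed.

Lemma C2_1q : C2on Om (fun x => 1 + -1 * sqn x).
Proof. by apply: (C2onD oO (C2on_cst oO 1)); apply: (C2onZ oO); exact: C2_sqn. Qed.

Lemma C2_ln1q : C2on Om (fun x => ln (1 + -1 * sqn x)).
Proof.
by apply: (C2on_ln oO C2_1q) => x Ox; rewrite mulN1r subr_gt0 sqn_lt1.
Qed.

(** Regularity of the square root is drawn from [expR] and [ln], as [sqn] is positive away from the
    origin. *)
Lemma r_expR x : Om x -> r x = expR (2^-1 * ln (sqn x)).
Proof.
move=> Ox; have e2 : expR (2^-1 * ln (sqn x)) ^+ 2 = sqn x.
  rewrite -expRM_natl mulrA mulfV ?mul1r ?lnK // posrE; exact: sqn_gt0.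
rewrite /euclid_norm -/(sqn x) -[in LHS]e2 sqrtr_sqr ger0_norm.
  by [].
exact: expR_ge0.
Qed.

Lemma C1_r : C1on Om r.
Proof.
have [H _] := C2on_expR oO (C2onZ oO 2^-1 C2_lnq).
by apply: (C1on_ext oO _ H) => x Ox; rewrite r_expR.
Qed.

Lemma C1_ri : C1on Om ri.
Proof. by apply: (C1on_inv oO C1_r) => x; exact: r_neq0. Qed.

Lemma C1_sqn : C1on Om sqn. Proof. by case: C2_sqn. Qed.

Lemma C1_cs : C1on Om cs.
Proof.
apply: (C1on_ext oO _ (C1onM oO (C1onZ oO 2^-1 (C2on1 C2_1q)) C1_ri)) => x _.
by rewrite /cs; ring.
Qed.

Lemma C1_ct : C1on Om ct.
Proof.
apply: (C1on_ext oO _ (C1onM oO (C1onZ oO 2^-1 (C1onD oO (C1on_cst oO 1) C1_sqn)) C1_ri)) => x _.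
by rewrite /ct; ring.
Qed.

(** [radc a] is the radial component of the vector field [a], scaled by [|x|]. *)
Definition radc a x := \sum_j a j x * x 0 j.

(** The radial functions below are all differentiated through this one; hence each result is a
    factor times [radc a], and zero for a tangential field. *)
Lemma op_sqn a x : Om x -> op a sqn x = 2 * radc a x.
Proof.
move=> Ox; rewrite (op_sum oO) //; last first.
  by move=> i; apply: (C1onM oO); exact: C1on_coord.
rewrite /radc big_distrr; apply: eq_bigr => j _ /=.
have c := C1on_coord oO j.
rewrite (opM a c c Ox) op_coord; ring.
Qed.

Lemma op_r a x : Om x -> op a r x = ri x * radc a x.
Proof.
move=> Ox.
have [c1 _] := C2_lnq; have c2 := C1onZ oO 2^-1 c1.
rewrite (op_ext oO a (g := fun x => expR (2^-1 * ln (sqn x)))) //; last exact: r_expR.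
rewrite (op_expR a c2 Ox) (opZ oO a 2^-1 c1 Ox) (op_ln a C1_sqn Ox (sqn_gt0 Ox)).
rewrite -r_expR // op_sqn // -r_sqr /ri; field.
exact: r_neq0.
Qed.

Lemma op_ri a x : Om x -> op a ri x = - ri x ^+ 3 * radc a x.
Proof.
move=> Ox; rewrite /ri (op_inv a C1_r Ox (r_neq0 Ox)) op_r // /ri; field.
exact: r_neq0.
Qed.

Lemma op_cs a x : Om x -> op a cs x = - ct x * ri x ^+ 2 * radc a x.
Proof.
move=> Ox.
have c1 := C1onB oO (C1on_cst oO 1) C1_sqn.
rewrite (op_ext oO a (g := fun x => (2^-1 * (1 - sqn x)) * ri x)) //; last first.
  by move=> y _; rewrite /cs; ring.
rewrite (opM a (C1onZ oO 2^-1 c1) C1_ri Ox) (opZ oO a 2^-1 c1 Ox).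
rewrite (opB oO a (C1on_cst oO 1) C1_sqn Ox) op_cst op_sqn // op_ri // /ct.
rewrite -r_sqr /ri; field; exact: r_neq0.
Qed.

Lemma op_ct a x : Om x -> op a ct x = - cs x * ri x ^+ 2 * radc a x.
Proof.
move=> Ox.
have c1 := C1onD oO (C1on_cst oO 1) C1_sqn.
rewrite (op_ext oO a (g := fun x => (2^-1 * (1 + sqn x)) * ri x)) //; last first.
  by move=> y _; rewrite /ct; ring.
rewrite (opM a (C1onZ oO 2^-1 c1) C1_ri Ox) (opZ oO a 2^-1 c1 Ox).
rewrite (opD a (C1on_cst oO 1) C1_sqn Ox) op_cst op_sqn // op_ri // /cs.
rewrite -r_sqr /ri; field; exact: r_neq0.
Qed.

Local Notation rho := (@hdist R n).

Lemma rho_ln x : Om x -> rho x = ln (1 + r x) - ln (1 - r x).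
Proof.
move=> Ox; have := r_gt0 Ox; have := r_lt1 Ox => r1 r0.
rewrite /hdist lnM ?lnV ?posrE ?invr_gt0 //; lra.
Qed.

Lemma rho_gt0 x : Om x -> 0 < rho x.
Proof.
move=> Ox; have := r_gt0 Ox; have := r_lt1 Ox => r1 r0.
rewrite rho_ln // subr_gt0 ltr_ln ?posrE; lra.
Qed.

Lemma C1_rho : C1on Om rho.
Proof.
have c1 := C1onD oO (C1on_cst oO 1) C1_r; have c2 := C1onB oO (C1on_cst oO 1) C1_r.
apply: (@C1on_ext _ _ _ oO (fun x => ln (1 + r x) - ln (1 - r x))).
  by move=> x Ox; rewrite rho_ln.
apply: (C1onB oO); apply: (C1on_ln oO) => // x Ox.
  by have := r_gt0 Ox; lra.
by have := r_lt1 Ox; lra.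
Qed.

Lemma op_rho a x : Om x -> op a rho x = 2 / (1 - sqn x) * ri x * radc a x.
Proof.
move=> Ox; have r0 := r_gt0 Ox; have r1 := r_lt1 Ox.
have c1 := C1onD oO (C1on_cst oO 1) C1_r; have c2 := C1onB oO (C1on_cst oO 1) C1_r.
have p1 y : Om y -> 0 < 1 + r y by move=> Oy; have := r_gt0 Oy; lra.
have p2 y : Om y -> 0 < 1 - r y by move=> Oy; have := r_lt1 Oy; lra.
rewrite (op_ext oO a rho_ln Ox) (opB oO a (C1on_ln oO c1 p1) (C1on_ln oO c2 p2) Ox).
rewrite (op_ln a c1 Ox (p1 x Ox)) (op_ln a c2 Ox (p2 x Ox)).
rewrite (opD a (C1on_cst oO 1) C1_r Ox) (opB oO a (C1on_cst oO 1) C1_r Ox) op_cst op_r //.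
have a1 := p1 x Ox; have a2 := p2 x Ox.
have E : 1 - sqn x = (1 - r x) * (1 + r x) by rewrite -r_sqr; ring.
by rewrite E; field; rewrite !gt_eqF.
Qed.

Lemma expR_rho x : Om x -> expR (rho x) = (1 + r x) / (1 - r x).
Proof.
move=> Ox; have r0 := r_gt0 Ox; have r1 := r_lt1 Ox.
by rewrite /hdist lnK // posrE divr_gt0 //; lra.
Qed.

Lemma sinh_rho x : Om x -> sinh (rho x) = (cs x)^-1.
Proof.
move=> Ox; have r0 := r_gt0 Ox; have r1 := r_lt1 Ox.
rewrite /sinh expRN expR_rho // /cs /ri -r_sqr.
have -> : 1 - r x ^+ 2 = (1 - r x) * (1 + r x) by ring.
field; rewrite !gt_eqF //; lra.
Qed.

End Polar.

(** The derivative of [sinh] is at least 1. This gives [1 / sinh rho <= 1 / rho], on which the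
    estimate in dimension 4 relies. *)
Lemma ler_sinh (R : realType) (t : R) : 0 <= t -> t <= sinh t.
Proof.
rewrite le_eqVlt => /predU1P[<-|t0]; first by rewrite /sinh oppr0 subrr mul0r.
have D (s : R) : is_derive s (1 : R) (@sinh R) ((expR s + expR (- s)) / 2).
  have H : is_derive s (1 : R) (fun s : R => 2^-1 * (expR s - expR (- s)))
      (2^-1 * (expR s + expR (- s))).
    have h1 := @is_derive1_comp R expR (fun s => - s) s _ _ (is_derive_expR (- s)) (is_deriveNid s 1).
    have h2 := is_deriveB (is_derive_expR s) h1.
    apply: (is_derive_eq (is_deriveZ (2^-1) h2)).
    by rewrite /GRing.scale /= mulrN1 opprK.
  have -> : @sinh R = (fun s : R => 2^-1 * (expR s - expR (- s))).
    by apply/funext => y; rewrite /sinh mulrC.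
  by rewrite mulrC.
have [|c] := @MVT R (@sinh R) (fun s => (expR s + expR (- s)) / 2) 0 t t0 (fun s _ => D s).
  by apply: derivable_within_continuous => s _; have [] := D s.
move=> _; have s0 : sinh (0 : R) = 0 by rewrite /sinh oppr0 subrr mul0r.
rewrite s0 !subr0 => ->; rewrite -[leLHS]mul1r ler_wpM2r ?(ltW t0) //.
rewrite expRN; have e0 := expR_gt0 c; set e := expR c in e0 *.
rewrite -subr_ge0; have -> : (e + e^-1) / 2 - 1 = (e - 1) ^+ 2 / (2 * e).
  by field; rewrite gt_eqF.
by rewrite divr_ge0 ?sqr_ge0 // mulr_ge0 // ltW.
Qed.

(** * Derivatives, commutators and divergences of the polar fields *)

Section Fields.
Context {R : realType} {n : nat}.
Implicit Types (f g : 'rV[R]_n -> R) (x : 'rV[R]_n) (a : 'I_n -> 'rV[R]_n -> R).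

Local Notation Om := (@punctured_ball R n).
Local Notation r := (@euclid_norm R n).
Local Notation rho := (@hdist R n).
Let oO : open Om := open_Om.

(** The derivative along [Efield] is [d/drho]; the fields [del i] are the
    orthogonal projections of [|x| d_i] to the spheres. *)
Definition Efield (j : 'I_n) x : R := cs x * x 0 j.
Definition del (i j : 'I_n) x : R := r x * (i == j)%:R - x 0 i * x 0 j * ri x.
Definition ee (i : 'I_n) x : R := x 0 i * ri x.
Definition pp x : R := (rho x)^-1.
(** [dens x dx = drho dsigma], so that [Efield] is divergence free for it. *)
Definition dens x : R := (cs x)^-1 * ri x ^+ n.

Lemma radc_E x : radc Efield x = cs x * sqn x.
Proof.
by rewrite /radc big_distrr; apply: eq_bigr => j _; rewrite /Efield /= expr2 mulrA.
Qed.

Lemma radc_del i x : Om x -> radc (del i) x = 0.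
Proof.
move=> Ox; rewrite /radc /del.
have -> : \sum_j (r x * (i == j)%:R - x 0 i * x 0 j * ri x) * x 0 j =
    \sum_j r x * ((i == j)%:R * x 0 j) - \sum_j (x 0 i * ri x) * x 0 j ^+ 2.
  by rewrite -sumrB; apply: eq_bigr => j _; ring.
rewrite -!big_distrr /= -/(sqn x) (bigD1 i) //= eqxx mul1r big1 ?addr0; last first.
  by move=> j ji; rewrite eq_sym (negbTE ji) mul0r.
by rewrite -mulrA [ri x * _]mulrC sqn_ri // mulrC subrr.
Qed.

Lemma C1_E j : C1on Om (Efield j).
Proof. exact: (C1onM oO C1_cs (C1on_coord oO j)). Qed.

Lemma C1_ee j : C1on Om (ee j).
Proof. exact: (C1onM oO (C1on_coord oO j) C1_ri). Qed.

Lemma C1_xxri i j : C1on Om (fun x => x 0 i * x 0 j * ri x).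
Proof. exact: (C1onM oO (C1onM oO (C1on_coord oO i) (C1on_coord oO j)) C1_ri). Qed.

Lemma C1_rd i j : C1on Om (fun x => r x * (i == j :> 'I_n)%:R).
Proof. exact: (C1onM oO C1_r (C1on_cst oO _)). Qed.

Lemma C1_del i j : C1on Om (del i j).
Proof. exact: (C1onB oO (C1_rd i j) (C1_xxri i j)). Qed.

Lemma C1_pp : C1on Om pp.
Proof. by apply: (C1on_inv oO C1_rho) => x Ox; rewrite gt_eqF // rho_gt0. Qed.

Lemma C1_dens : C1on Om dens.
Proof.
apply: (C1onM oO _ (C1onX oO n C1_ri)); apply: (C1on_inv oO C1_cs) => x Ox.
by rewrite gt_eqF // cs_gt0.
Qed.

Lemma E_cs x : Om x -> op Efield cs x = - ct x * cs x.
Proof.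
move=> Ox; rewrite op_cs // radc_E.
have -> : - ct x * ri x ^+ 2 * (cs x * sqn x) = - ct x * cs x * (sqn x * ri x * ri x) by ring.
by rewrite sqn_ri // r_ri // mulr1.
Qed.

Lemma E_ct x : Om x -> op Efield ct x = - cs x ^+ 2.
Proof.
move=> Ox; rewrite op_ct // radc_E.
have -> : - cs x * ri x ^+ 2 * (cs x * sqn x) = - cs x ^+ 2 * (sqn x * ri x * ri x) by ring.
by rewrite sqn_ri // r_ri // mulr1.
Qed.

Lemma E_ri x : Om x -> op Efield ri x = - cs x * ri x.
Proof.
move=> Ox; rewrite op_ri // radc_E.
have -> : - ri x ^+ 3 * (cs x * sqn x) = - cs x * ri x * (sqn x * ri x * ri x) by ring.
by rewrite sqn_ri // r_ri // mulr1.
Qed.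

Lemma E_r x : Om x -> op Efield r x = cs x * r x.
Proof.
move=> Ox; rewrite op_r // radc_E -[in RHS]sqn_ri //; ring.
Qed.

Lemma E_rho x : Om x -> op Efield rho x = 1.
Proof.
move=> Ox; rewrite op_rho // radc_E /cs.
have q1 : 1 - sqn x != 0 by rewrite gt_eqF // subr_gt0 sqn_lt1.
have -> : 2 / (1 - sqn x) * ri x * ((1 - sqn x) / 2 * ri x * sqn x) =
  sqn x * ri x * ri x by field.
by rewrite sqn_ri // r_ri.
Qed.

Lemma E_pp x : Om x -> op Efield pp x = - pp x ^+ 2.
Proof.
move=> Ox; have r0 : rho x != 0 by rewrite gt_eqF // rho_gt0.
by rewrite (op_inv _ C1_rho Ox r0) E_rho // mulr1 exprVn.
Qed.

Lemma del_cs i x : Om x -> op (del i) cs x = 0.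
Proof. by move=> Ox; rewrite op_cs // radc_del // mulr0. Qed.
Lemma del_ct i x : Om x -> op (del i) ct x = 0.
Proof. by move=> Ox; rewrite op_ct // radc_del // mulr0. Qed.
Lemma del_ri i x : Om x -> op (del i) ri x = 0.
Proof. by move=> Ox; rewrite op_ri // radc_del // mulr0. Qed.
Lemma del_r i x : Om x -> op (del i) r x = 0.
Proof. by move=> Ox; rewrite op_r // radc_del // mulr0. Qed.

Lemma opX a f x k : C1on Om f -> Om x ->
  op a (fun y => f y ^+ k) x = k%:R * f x ^+ k.-1 * op a f x.
Proof.
move=> cf Ox; elim: k => [|k IH].
  by rewrite !mul0r (op_ext oO a (g := fun=> 1)) ?op_cst.
rewrite (op_ext oO a (g := fun y => f y * f y ^+ k)) //; last first.
  by move=> y _; rewrite exprS.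
rewrite (opM a cf (C1onX oO k cf) Ox) IH /=.
case: k {IH} => [|k]; first by rewrite !mul0r mulr0 add0r expr0 !mul1r.
by rewrite /= exprS -[in RHS]natr1; ring.
Qed.

Lemma del_sym i j x : del i j x = del j i x.
Proof. by rewrite /del eq_sym (mulrC (x 0 i)). Qed.

(** [Efield] is [cs] times the Euler field and [del i j] is homogeneous of degree one. Together with
    [del_E] this makes [Efield] and [del i] commute. *)
Lemma E_del i j x : Om x -> op Efield (del i j) x = cs x * del i j x.
Proof.
move=> Ox; rewrite (opB oO _ (C1_rd i j) (C1_xxri i j) Ox).
have ci := C1on_coord oO i; have cj := C1on_coord oO j.
rewrite (opM _ C1_r (C1on_cst oO _) Ox) op_cst E_r //.
rewrite (opM _ (C1onM oO ci cj) C1_ri Ox) (opM _ ci cj Ox) !op_coord E_ri //.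
by rewrite /Efield /del; ring.
Qed.

Lemma del_E i j x : Om x -> op (del i) (Efield j) x = cs x * del i j x.
Proof.
move=> Ox; rewrite (opM _ C1_cs (C1on_coord oO j) Ox) op_coord del_cs //.
by rewrite mulr0 addr0.
Qed.

(** The first term is symmetric in [i] and [j], so the commutator of [del i] and [del j] is [ee i]
    times [del j] minus [ee j] times [del i]. *)
Lemma del_del i j l x : Om x ->
  op (del i) (del j l) x = - (del i j x * ee l x + ee j x * del i l x).
Proof.
move=> Ox; rewrite (opB oO _ (C1_rd j l) (C1_xxri j l) Ox).
have cl := C1on_coord oO l; have cj := C1on_coord oO j.
rewrite (opM _ C1_r (C1on_cst oO _) Ox) op_cst del_r //.
rewrite (opM _ (C1onM oO cj cl) C1_ri Ox) (opM _ cj cl Ox) !op_coord del_ri //.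
by rewrite /ee; ring.
Qed.

Lemma del_ee i j x : Om x -> op (del i) (ee j) x = (i == j)%:R - ee i x * ee j x.
Proof.
move=> Ox; rewrite (opM _ (C1on_coord oO j) C1_ri Ox) op_coord del_ri //.
have -> : x 0 j * 0 + ri x * del i j x = (r x * ri x) * (i == j)%:R - ee i x * ee j x.
  by rewrite /del /ee; ring.
by rewrite r_ri // mul1r.
Qed.

Lemma E_ee j x : Om x -> op Efield (ee j) x = 0.
Proof.
move=> Ox; rewrite (opM _ (C1on_coord oO j) C1_ri Ox) op_coord E_ri //.
by rewrite /Efield; ring.
Qed.

Lemma sum_ee2 x : Om x -> \sum_i ee i x ^+ 2 = 1.
Proof.
move=> Ox; under eq_bigr do rewrite /ee exprMn.
by rewrite -big_distrl /= -/(sqn x) expr2 mulrA sqn_ri // r_ri.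
Qed.

Lemma sum_ee_del j x : Om x -> \sum_i ee i x * del i j x = 0.
Proof.
move=> Ox; transitivity (ri x * radc (del j) x); last by rewrite radc_del // mulr0.
by rewrite /radc big_distrr; apply: eq_bigr => i _; rewrite /ee del_sym /=; ring.
Qed.

(** The [n] fields [del i] span a tangent space of dimension [n - 1]; this is the relation between
    them. It cancels divergence terms after summation over [i]. *)
Lemma sum_ee_op f x : Om x -> \sum_i ee i x * op (del i) f x = 0.
Proof.
move=> Ox; under eq_bigr do rewrite /op big_distrr /=.
rewrite exchange_big /= big1 // => j _.
under eq_bigr do rewrite mulrA; rewrite -big_distrl /= sum_ee_del // mul0r //.
Qed.

Lemma div_prod a x : (forall j, C1on Om (a j)) -> Om x ->
  \sum_j partial j (fun y => dens y * a j y) x =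
  op a dens x + dens x * \sum_j partial j (a j) x.
Proof.
move=> ca Ox; rewrite /op big_distrr -big_split /=; apply: eq_bigr => j _.
by rewrite (partialM j C1_dens (ca j) Ox) addrC.
Qed.

(** Seen as a field with constant coefficients, a partial derivative obeys the rules for radial
    functions. *)
Lemma partial_op_delta j f x : partial j f x = op (fun i _ => (i == j)%:R) f x.
Proof.
rewrite /op (bigD1 j) //= eqxx mul1r big1 ?addr0 // => i ij.
by rewrite (negbTE ij) mul0r.
Qed.

Lemma radc_delta j x : radc (fun i _ => (i == j)%:R) x = x 0 j.
Proof.
rewrite /radc (bigD1 j) //= eqxx mul1r big1 ?addr0 // => i ij.
by rewrite (negbTE ij) mul0r.
Qed.

Lemma sum_1 : \sum_(j < n) (1 : R) = n%:R.
Proof. by rewrite sumr_const card_ord. Qed.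

Lemma has_div_E : has_div Om dens Efield (fun=> 0).
Proof.
move=> x Ox; have k0 : cs x != 0 by rewrite gt_eqF // cs_gt0.
rewrite div_prod //; last exact: C1_E.
have ck : C1on Om (fun y => (cs y)^-1).
  by apply: (C1on_inv oO C1_cs) => y Oy; rewrite gt_eqF // cs_gt0.
rewrite (opM _ ck (C1onX oO n C1_ri) Ox) opX //; last exact: C1_ri.
rewrite (op_inv _ C1_cs Ox k0) E_cs // E_ri //.
have -> : \sum_j partial j (Efield j) x = cs x * n%:R - ct x.
  have -> : \sum_j partial j (Efield j) x =
      \sum_(j < n) (cs x * 1 + - ct x * ri x ^+ 2 * x 0 j ^+ 2).
    apply: eq_bigr => j _; rewrite partial_op_delta.
    rewrite (opM _ C1_cs (C1on_coord oO j) Ox) op_cs // op_coord radc_delta eqxx /=; ring.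
  rewrite big_split -!big_distrr /= sum_1 -/(sqn x).
  have -> : - ct x * ri x ^+ 2 * sqn x = - ct x * (sqn x * ri x * ri x) by ring.
  by rewrite sqn_ri // r_ri // mulr1.
have -> : n%:R * ri x ^+ n.-1 * (- cs x * ri x) = - n%:R * cs x * ri x ^+ n.
  (* For [n = 0] the truncated exponent [n.-1] is harmless, because both sides carry the factor
     [n]. *)
  have [n0|n0] := posnP n; first by rewrite [in n%:R]n0 oppr0 !mul0r.
  have -> : ri x ^+ n = ri x * ri x ^+ n.-1 by rewrite -exprS prednK.
  by set w := _ ^+ n.-1; ring.
by rewrite /dens; field.
Qed.

(** The weight [dens] is radial and contributes nothing. What is left is the Euclidean divergence of
    [del i], where [n - 1] comes from the mean curvature of the spheres. *)
Lemma has_div_del i : has_div Om dens (del i) (fun x => - (n%:R - 1) * ee i x).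
Proof.
move=> x Ox; have k0 : cs x != 0 by rewrite gt_eqF // cs_gt0.
rewrite div_prod //; last exact: C1_del.
have ck : C1on Om (fun y => (cs y)^-1).
  by apply: (C1on_inv oO C1_cs) => y Oy; rewrite gt_eqF // cs_gt0.
rewrite (opM _ ck (C1onX oO n C1_ri) Ox) opX //; last exact: C1_ri.
rewrite (op_inv _ C1_cs Ox k0) del_cs // del_ri // !mulr0 addr0 add0r; congr (_ * _).
have E j : partial j (del i j) x =
    (i == j)%:R * (ri x * x 0 j - x 0 j * ri x) - x 0 i * ri x * 1
    + x 0 i * ri x ^+ 3 * x 0 j ^+ 2.
  rewrite partial_op_delta.
  rewrite (opB oO _ (C1_rd i j) (C1_xxri i j) Ox).
  have ci := C1on_coord oO i; have cj := C1on_coord oO j.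
  rewrite (opM _ C1_r (C1on_cst oO _) Ox) op_cst op_r //.
  rewrite (opM _ (C1onM oO ci cj) C1_ri Ox) (opM _ ci cj Ox) !op_coord op_ri //.
  rewrite !radc_delta eqxx /=; ring.
under eq_bigr do rewrite E (mulrC (ri x)) subrr mulr0 add0r.
rewrite big_split /= sumrN -!big_distrr /= sum_1 -/(sqn x) /ee.
have -> : x 0 i * ri x ^+ 3 * sqn x = x 0 i * ri x * (sqn x * ri x * ri x) by ring.
by rewrite sqn_ri // r_ri //; ring.
Qed.

End Fields.

(** Meant for [M i j = del_i del_j v], which is not symmetric. Adding [v i * e j] gives a symmetric
    [S] that kills [e], and [P] is the projection orthogonal to [e]. The claim is Cauchy-Schwarz for
    [S] and [P] in the Hilbert-Schmidt product: their product is the trace of [M], the squared norm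
    of [P] is [n - 1], that of [S] is the double sum on the right. *)
Lemma trace_sqr_le (R : realFieldType) n (M : 'I_n -> 'I_n -> R) (v e : 'I_n -> R) :
  (1 < n)%N -> \sum_i e i ^+ 2 = 1 -> \sum_i e i * v i = 0 ->
  (forall j, \sum_i e i * M i j = 0) ->
  (forall i, \sum_j M i j * e j = - v i) ->
  (forall i j, M i j - M j i = e i * v j - e j * v i) ->
  (\sum_i M i i) ^+ 2 <= (n%:R - 1) * \sum_i \sum_j M i j * M j i.
Proof.
move=> n1 e1 ev eM Me Masym; set T := \sum_i M i i; set N : R := n%:R - 1.
have N0 : 0 < N by rewrite /N subr_gt0 ltr1n.
pose S i j := M i j + v i * e j.
pose P i j : R := (i == j)%:R - e i * e j.
have Ssym i j : S i j = S j i.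
  have /eqP := Masym i j; rewrite subr_eq => /eqP H.
  by rewrite /S H; ring.
have SS : \sum_i \sum_j S i j ^+ 2 = \sum_i \sum_j M i j * M j i.
  have -> : \sum_i \sum_j S i j ^+ 2 = \sum_i \sum_j (M i j * M j i) +
      \sum_i \sum_j ((e i * M i j) * v j + v i * (e j * M j i) + (e i * v i) * (e j * v j)).
    rewrite -big_split; apply: eq_bigr => i _ /=; rewrite -big_split; apply: eq_bigr => j _ /=.
    by rewrite expr2 [in X in _ * X]Ssym /S; ring.
  suff -> : \sum_i \sum_j ((e i * M i j) * v j + v i * (e j * M j i) + (e i * v i) * (e j * v j)) = 0.
    by rewrite addr0.
  under eq_bigr => i _ do rewrite !big_split /= -[X in _ + X + _]big_distrr
    -[X in _ + X]big_distrr /= eM ev !mulr0 !addr0.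
  by rewrite exchange_big /= big1 // => j _; rewrite -big_distrl /= eM mul0r.
have dsum (F : 'I_n -> R) i : \sum_j (i == j)%:R * F j = F i.
  rewrite (bigD1 i) //= eqxx mul1r big1 ?addr0 // => j ji.
  by rewrite eq_sym (negbTE ji) mul0r.
have SP : \sum_i \sum_j S i j * P i j = T.
  have -> : \sum_i \sum_j S i j * P i j = \sum_i (M i i + v i * e i
      - e i * \sum_j M i j * e j - (e i * v i) * \sum_j e j ^+ 2).
    apply: eq_bigr => i _.
    have -> : M i i + v i * e i = \sum_j (i == j)%:R * (M i j + v i * e j) by rewrite dsum.
    rewrite (big_distrr (e i)) (big_distrr (e i * v i)) /= -!sumrB.
    by apply: eq_bigr => j _; rewrite /S /P; ring.
  under eq_bigr => i _ do rewrite Me e1.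
  transitivity (T + \sum_i e i * v i); last by rewrite ev addr0.
  by rewrite /T -big_split /=; apply: eq_bigr => i _; ring.
have PP : \sum_i \sum_j P i j ^+ 2 = N.
  have -> : \sum_i \sum_j P i j ^+ 2 = \sum_i (1 - 2 * e i ^+ 2 + e i ^+ 2 * \sum_j e j ^+ 2).
    apply: eq_bigr => i _; rewrite big_distrr /=.
    have -> : 1 - 2 * e i ^+ 2 = \sum_j (i == j)%:R * (1 - 2 * (e i * e j)) by rewrite dsum; ring.
    rewrite -big_split; apply: eq_bigr => j _ /=; rewrite /P.
    by case: (i == j) => /=; ring.
  rewrite e1; under eq_bigr => i _ do rewrite mulr1.
  have -> : \sum_i (1 - 2 * e i ^+ 2 + e i ^+ 2) = \sum_(i < n) 1 - \sum_i e i ^+ 2.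
    by rewrite -sumrB; apply: eq_bigr => i _; ring.
  by rewrite e1 sumr_const card_ord.
have pos : 0 <= \sum_i \sum_j (N * S i j - T * P i j) ^+ 2.
  by apply: sumr_ge0 => i _; apply: sumr_ge0 => j _; exact: sqr_ge0.
have E (t : R) : \sum_i \sum_j (N * S i j - t * P i j) ^+ 2 =
    N ^+ 2 * \sum_i \sum_j S i j ^+ 2 - 2 * N * t * (\sum_i \sum_j S i j * P i j)
    + t ^+ 2 * \sum_i \sum_j P i j ^+ 2.
  rewrite !big_distrr /= -sumrB -big_split /=; apply: eq_bigr => i _.
  rewrite !big_distrr /= -sumrB -big_split /=; apply: eq_bigr => j _.
  by ring.
rewrite E SS SP PP in pos; set Q := \sum_i _ in pos *.
rewrite -subr_ge0 -(pmulr_rge0 _ N0).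
by have <- : N ^+ 2 * Q - 2 * N * T * T + T ^+ 2 * N = N * (N * Q - T ^+ 2) by ring.
Qed.

(** * Angular integral identities *)

(** [A], [B], [C] are the integrals of [(Lam v)^2], of the trace of the squared matrix
    [del_i del_j v], and of the squared gradient. Bochner's formula inserted into the trace
    inequality bounds [(n - 2) A] below by [(n - 1) (n - 2) C]. *)
Lemma gap_arith (R : realFieldType) n (A B C : R) : (2 < n)%N ->
  A = B + (n%:R - 2) * C -> 0 <= (n%:R - 1) * B + -1 * A -> (n%:R - 1) * C <= A.
Proof.
move=> n2 E H; have N0 : 0 < n%:R - 2 :> R by rewrite subr_gt0 ltr_nat.
have EB : B = A - (n%:R - 2) * C by rewrite E addrK.
rewrite EB in H; rewrite -subr_ge0 -(pmulr_rge0 _ N0).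
by have <- : (n%:R - 1) * (A - (n%:R - 2) * C) + -1 * A = (n%:R - 2) * (A - (n%:R - 1) * C) by ring.
Qed.

Section Integrals.
Context {R : realType} {n : nat}.
Implicit Types (f g h v w : 'rV[R]_n -> R) (x : 'rV[R]_n) (a : 'I_n -> 'rV[R]_n -> R).

Local Notation Om := (@punctured_ball R n).
Let oO : open Om := open_Om.
Variable K : set 'rV[R]_n.
Hypotheses (compactK : compact K) (KOm : K `<=` Om).

Local Notation inK := (inK Om K).
Local Notation zeroK := (zeroK K).

Definition Mint g : R := J (fun x => dens x * g x).

Let c0dens : C0on Om dens := C1on0 C1_dens.

Lemma inK_dens g : inK g -> Cc (fun x => dens x * g x).
Proof. by move=> ig; apply: (inK_Cc compactK KOm); exact: (inKM c0dens ig). Qed.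

Lemma MintD f g : inK f -> inK g -> Mint (fun x => f x + g x) = Mint f + Mint g.
Proof.
move=> i1 i2; rewrite /Mint -(JD (inK_dens i1) (inK_dens i2)); apply: J_ext => x.
by rewrite mulrDr.
Qed.

Lemma MintZ (c : R) f : inK f -> Mint (fun x => c * f x) = c * Mint f.
Proof.
move=> i1; rewrite /Mint -(JZ c (inK_dens i1)); apply: J_ext => x.
by rewrite mulrCA.
Qed.

Lemma Mint_ext f g : (forall x, Om x -> f x = g x) -> zeroK f -> zeroK g ->
  Mint f = Mint g.
Proof.
move=> fg zf zg; apply: J_ext => x; have [Kx|Kx] := pselect (K x).
  by rewrite fg //; exact: KOm.
by rewrite zf // zg.
Qed.

Lemma Mint_sum m (F : 'I_m -> 'rV[R]_n -> R) : (forall i, inK (F i)) ->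
  Mint (fun x => \sum_i F i x) = \sum_i Mint (F i).
Proof.
move=> iF; rewrite /Mint -J_sum => [|i]; last exact: (inK_dens (iF i)).
by apply: J_ext => x; rewrite big_distrr.
Qed.

Lemma dens_ge0 x : Om x -> 0 <= dens x.
Proof.
move=> Ox; rewrite mulr_ge0 ?invr_ge0 ?exprn_ge0 //; apply: ltW.
  exact: cs_gt0.
exact: ri_gt0.
Qed.

Lemma Mint_ge0 g : zeroK g -> (forall x, Om x -> 0 <= g x) -> 0 <= Mint g.
Proof.
move=> zg g0; apply: J_ge0 => x; have [Kx|Kx] := pselect (K x).
  by rewrite mulr_ge0 ?g0 ?dens_ge0 //; exact: KOm.
by rewrite zg // mulr0.
Qed.

Lemma Mint_E g : C1on Om g -> zeroK g -> Mint (op Efield g) = 0.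
Proof.
move=> cg zg; rewrite /Mint.
rewrite (J_op oO compactK KOm C1_dens C1_E (C0on_cst _ 0) has_div_E cg zg).
rewrite (J_ext (g := fun=> 0)) ?J0 ?oppr0 // => x.
by rewrite mul0r mulr0.
Qed.

Lemma C0_divdel i : C0on Om (fun x => - (n%:R - 1) * ee i x).
Proof. exact: (C0onZ _ (C1on0 (C1_ee i))). Qed.

Lemma Mint_del i g : C1on Om g -> zeroK g ->
  Mint (op (del i) g) = (n%:R - 1) * Mint (fun x => ee i x * g x).
Proof.
move=> cg zg; rewrite /Mint.
rewrite (J_op oO compactK KOm C1_dens (C1_del i) (C0_divdel i) (has_div_del i) cg zg).
have ig : inK (fun x => ee i x * g x) by apply: (inKM (C1on0 (C1_ee i))); split => //; exact: C1on0.
have H1 : Cc (fun x => dens x * (ee i x * g x)) := inK_dens ig.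
have H2 : Cc (fun x => dens x * (- (n%:R - 1) * ee i x * g x)).
  apply: (@inK_dens (fun x => - (n%:R - 1) * ee i x * g x)).
  by apply: (inKM (C0_divdel i)); split => //; exact: C1on0.
rewrite -(JZ _ H1) -[LHS]mulN1r /= -(JZ _ H2).
by apply: J_ext => x; ring.
Qed.

Definition Lam v x : R := \sum_i op (del i) (op (del i) v) x.

Section OneFunction.
Variable v : 'rV[R]_n -> R.
Hypotheses (C2v : C2on Om v) (zv : zeroK v).

Lemma C1_opE : C1on Om (op Efield v).
Proof. exact: (C1on_op oO C1_E C2v). Qed.

Lemma C1_opdel i : C1on Om (op (del i) v).
Proof. exact: (C1on_op oO (C1_del i) C2v). Qed.

Lemma zero_op a : zeroK (op a v). Proof. exact: zeroK_op. Qed.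

Lemma zero_opop a b : zeroK (op a (op b v)).
Proof. by apply: zeroK_op => //; exact: zero_op. Qed.

Lemma C0_opop a i : (forall j, C1on Om (a j)) -> C0on Om (op a (op (del i) v)).
Proof. by move=> ca; apply: (C0on_op oO); [move=> j; exact: (C1on0 (ca j))|exact: C1_opdel]. Qed.

Lemma C0_opEE : C0on Om (op Efield (op Efield v)).
Proof. by apply: (C0on_op oO); [move=> j; exact: (C1on0 (C1_E j))|exact: C1_opE]. Qed.

Lemma inK_Lam : inK (Lam v).
Proof.
apply: inK_sum => // i; split; last exact: zero_opop.
by apply: C0_opop => j; exact: C1_del.
Qed.

Lemma E_del_comm i x : Om x -> op (del i) (op Efield v) x = op Efield (op (del i) v) x.
Proof.
move=> Ox; apply/eqP; rewrite -subr_eq0; apply/eqP.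
rewrite (op_commutator oO compactK KOm (C1_del i) C1_E C2v zv Ox) big1 // => k _.
by rewrite E_del // del_E // subrr mul0r.
Qed.

Lemma del_del_comm i j x : Om x ->
  op (del i) (op (del j) v) x - op (del j) (op (del i) v) x =
  ee i x * op (del j) v x - ee j x * op (del i) v x.
Proof.
move=> Ox; rewrite (op_commutator oO compactK KOm (C1_del i) (C1_del j) C2v zv Ox).
rewrite /op !big_distrr -sumrB; apply: eq_bigr => k _ /=; rewrite -!/(op _ _ _) !del_del //.
by rewrite (del_sym j i); ring.
Qed.

(** The relation [sum_ee_op] differentiated along [Efield], which annihilates [ee]. *)
Lemma sum_ee_Edel x : Om x -> \sum_i ee i x * op Efield (op (del i) v) x = 0.
Proof.
move=> Ox; have H : op Efield (fun y => \sum_i ee i y * op (del i) v y) x = 0.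
  by rewrite (op_ext oO _ (g := fun=> 0)) ?op_cst // => y Oy; exact: sum_ee_op.
rewrite -[RHS]H (op_sum oO) //; last by move=> i; exact: (C1onM oO (C1_ee i) (C1_opdel i)).
apply: eq_bigr => i _; rewrite (opM _ (C1_ee i) (C1_opdel i) Ox) E_ee //.
by rewrite mulr0 addr0.
Qed.

(** The relation [sum_ee_op] differentiated along [del i]: the derivative of [ee] is the tangential
    projection, which produces the right-hand side. *)
Lemma sum_ee_deldel i x : Om x ->
  \sum_j op (del i) (op (del j) v) x * ee j x = - op (del i) v x.
Proof.
move=> Ox; have H : op (del i) (fun y => \sum_j ee j y * op (del j) v y) x = 0.
  by rewrite (op_ext oO _ (g := fun=> 0)) ?op_cst // => y Oy; exact: sum_ee_op.
move: H; rewrite (op_sum oO) //; last by move=> j; exact: (C1onM oO (C1_ee j) (C1_opdel j)).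
under eq_bigr => j _ do rewrite (opM _ (C1_ee j) (C1_opdel j) Ox) del_ee //.
rewrite big_split /= => /eqP; rewrite addr_eq0 => /eqP H.
under eq_bigr do rewrite mulrC; rewrite H; congr (- _).
under eq_bigr do rewrite mulrBr mulrCA; rewrite sumrB -big_distrr /=.
under [X in _ - _ * X]eq_bigr do rewrite mulrC.
rewrite sum_ee_op // mulr0 subr0 (bigD1 i) //= eqxx mulr1 big1 ?addr0 // => j ji.
by rewrite eq_sym (negbTE ji) mulr0.
Qed.

(** Green's formula on the spheres. The fields [del i] are not divergence free, but their
    divergences are multiples of [ee i] and cancel in the sum by [sum_ee_op]. *)
Lemma Mint_Lam h : C1on Om h ->
  Mint (fun x => h x * Lam v x) =
  - Mint (fun x => \sum_i op (del i) h x * op (del i) v x).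
Proof.
move=> ch.
have zh i : zeroK (fun x => h x * op (del i) v x) by apply: zeroKMr; exact: zero_op.
have c1 i : C1on Om (fun x => h x * op (del i) v x) by exact: (C1onM oO ch (C1_opdel i)).
have S0 : \sum_i Mint (op (del i) (fun x => h x * op (del i) v x)) = 0.
  under eq_bigr => i _ do rewrite (Mint_del i (c1 i) (zh i)).
  rewrite -big_distrr -Mint_sum /=; last first.
    move=> i; apply: (inKM (C1on0 (C1_ee i))); split => //; exact: C1on0.
  rewrite (@Mint_ext _ (fun=> 0)) //.
  - by rewrite /Mint (J_ext (g := fun=> 0)) ?J0 ?mulr0 // => x; rewrite mulr0.
  - move=> x Ox; transitivity (h x * \sum_i ee i x * op (del i) v x).
      by rewrite big_distrr; apply: eq_bigr => i _ /=; rewrite mulrCA.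
    by rewrite sum_ee_op // mulr0.
  - by move=> x Kx; rewrite big1 // => i _; rewrite zh // mulr0.
have id1 i : C0on Om (op (del i) h) by apply: (C0on_op oO) => // j; exact: (C1on0 (C1_del i j)).
have id2 i : inK (op (del i) v).
  by split; [exact: (C1on0 (C1_opdel i))|exact: zero_op].
have I1 : inK (fun x => h x * Lam v x) by exact: (inKM (C1on0 ch) inK_Lam).
have I2 : inK (fun x => \sum_i op (del i) h x * op (del i) v x).
  by apply: inK_sum => // i; exact: (inKM (id1 i) (id2 i)).
apply/eqP; rewrite -addr_eq0 -(MintD I1 I2); apply/eqP; apply: etrans S0.
rewrite -Mint_sum; last first.
  move=> i; apply: (inK_op oO compactK) => // j; exact: (C1on0 (C1_del i j)).
apply: Mint_ext.
- move=> x Ox; rewrite /Lam big_distrr /= -big_split; apply: eq_bigr => i _ /=.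
  by rewrite (opM _ ch (C1_opdel i) Ox) [op (del i) h x * _]mulrC.
- by case: (inKD I1 I2).
- by move=> x Kx; rewrite big1 // => i _; rewrite (zeroK_op compactK _ (zh i) Kx).
Qed.

Variable w : 'rV[R]_n -> R.
Hypotheses (C1w : C1on Om w) (radw : forall i x, Om x -> op (del i) w x = 0).

(** Formally two integrations by parts, which would differentiate [v] three times. Instead
    [J_op_swap] exchanges [Efield] and [del i] between the factors [w * v'] and [del i v]. The
    fields commute, so only the divergence of [del i] remains, and [sum_ee_Edel] removes it. *)
Lemma Mint_ELam :
  Mint (fun x => op Efield (fun y => w y * op Efield v y) x * Lam v x) =
  Mint (fun x => w x * \sum_i op Efield (op (del i) v) x ^+ 2).
Proof.
pose f x := w x * op Efield v x.
have cf : C1on Om f by exact: (C1onM oO C1w C1_opE).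
have zf : zeroK f by apply: zeroKMr; exact: zero_op.
have c0E : forall j, C0on Om (Efield j) by move=> j; exact: (C1on0 (C1_E j)).
have c0d : forall i j, C0on Om (del i j) by move=> i j; exact: (C1on0 (C1_del i j)).
have iE i : inK (op Efield (op (del i) v)).
  by apply: (inK_op oO compactK) => //; [exact: C1_opdel|exact: zero_op].
have key i : Mint (fun x => op Efield f x * op (del i) (op (del i) v) x) =
    Mint (fun x => w x * op Efield (op (del i) v) x ^+ 2) +
    Mint (fun x => (- (n%:R - 1) * f x) * (ee i x * op Efield (op (del i) v) x)).
  apply: (etrans (J_op_swap oO compactK KOm C1_dens C1_E (C1_del i) (C0on_cst _ 0)
    (C0_divdel i) has_div_E (has_div_del i) cf zf (C1_opdel i) (zero_op _))).
  congr (_ + _).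
    apply: (@Mint_ext (fun x => op (del i) f x * op Efield (op (del i) v) x)
      (fun x => w x * op Efield (op (del i) v) x ^+ 2)).
    - move=> x Ox; rewrite (opM _ C1w C1_opE Ox) radw // mulr0 addr0 E_del_comm //.
      by rewrite expr2 mulrA.
    - by move=> x Kx; rewrite (zeroK_op compactK _ zf Kx) mul0r.
    - by move=> x Kx; rewrite zero_opop // expr0n /= mulr0.
  apply: (@Mint_ext (fun x => f x * (- (n%:R - 1) * ee i x * op Efield (op (del i) v) x
      - 0 * op (del i) (op (del i) v) x + \sum_k (op (del i) (Efield k) x
      - op Efield (del i k) x) * partial k (op (del i) v) x))
    (fun x => - (n%:R - 1) * f x * (ee i x * op Efield (op (del i) v) x))).
  - move=> x Ox; rewrite big1 ?addr0 ?mul0r ?subr0; last first.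
      by move=> k _; rewrite del_E // E_del // subrr mul0r.
    by ring.
  - by move=> x Kx; rewrite zf // mul0r.
  - by move=> x Kx; rewrite zf // mulr0 mul0r.
transitivity (\sum_i Mint (fun x => op Efield f x * op (del i) (op (del i) v) x)).
  rewrite -Mint_sum.
    by apply: J_ext => x; rewrite /Lam -big_distrr.
  move=> i; apply: inKM; first exact: (C0on_op oO).
  by apply: (inK_op oO compactK) => //; [exact: C1_opdel|exact: zero_op].
under eq_bigr do rewrite key.
rewrite big_split /= -Mint_sum; last first.
  move=> i; apply: (inKM (C1on0 C1w)); split; first by apply: (C0onX oO); case: (iE i).
  by move=> x Kx; rewrite zero_opop // expr0n.
rewrite -[X in _ + X]Mint_sum; last first.
  move=> i; apply: inKM; first exact: (C0onZ _ (C1on0 cf)).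
  exact: (inKM (C1on0 (C1_ee i)) (iE i)).
rewrite [X in _ + X](@Mint_ext _ (fun=> 0)) //.
- rewrite [X in _ + X]/Mint [X in _ + X](J_ext (g := fun=> 0)) ?J0 ?addr0.
    by apply: J_ext => x; congr (_ * _); rewrite /Lam big_distrr.
  by move=> x; rewrite mulr0.
- move=> x Ox; rewrite -big_distrr /= sum_ee_Edel // mulr0 //.
- by move=> x Kx; rewrite big1 // => i _; rewrite zf // mulr0 mul0r.
Qed.

(** Bochner's formula in integrated form, with the Ricci constant [n - 2] of the unit sphere: in the
    exchange of [del i] and [del j] the divergences contribute [n - 1] and the commutator [-1]. *)
Lemma Mint_Lam_sqr_eq :
  Mint (fun x => w x * Lam v x ^+ 2) =
  Mint (fun x => w x * \sum_i \sum_j op (del i) (op (del j) v) x * op (del j) (op (del i) v) x)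
  + (n%:R - 2) * Mint (fun x => w x * \sum_i op (del i) v x ^+ 2).
Proof.
pose f i x := w x * op (del i) v x.
have cf i : C1on Om (f i) by exact: (C1onM oO C1w (C1_opdel i)).
have zf i : zeroK (f i) by apply: zeroKMr; exact: zero_op.
have id2 i j : inK (op (del i) (op (del j) v)).
  split; last exact: zero_opop.
  by apply: C0_opop => k; exact: C1_del.
have c0w := C1on0 C1w.
pose G i j x := f i x * (- (n%:R - 1) * ee j x * op (del i) (op (del j) v) x
   - (- (n%:R - 1) * ee i x) * op (del j) (op (del j) v) x
   + (ee j x * op (del i) (op (del j) v) x - ee i x * op (del j) (op (del j) v) x)).
have zG i j : zeroK (G i j) by move=> x Kx; rewrite /G zf // mul0r.
have iG i j : inK (G i j).
  split => //; apply: (C0onM (C1on0 (cf i))).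
  have [ci _] := id2 i j; have [cj _] := id2 j j.
  have ei : C0on Om (ee i) := C1on0 (C1_ee i).
  have ej : C0on Om (ee j) := C1on0 (C1_ee j).
  apply: C0onD; apply: (C0onB oO); try exact: (C0onM ej ci); try exact: (C0onM ei cj).
    exact: (C0onM (C0onZ _ ej) ci).
  exact: (C0onM (C0onZ _ ei) cj).
have key i j : Mint (fun x => w x * (op (del i) (op (del i) v) x * op (del j) (op (del j) v) x)) =
    Mint (fun x => w x * (op (del i) (op (del j) v) x * op (del j) (op (del i) v) x)) + Mint (G i j).
  have zz k l k' l' : zeroK (fun x => w x * (op (del k) (op (del l) v) x * op (del k') (op (del l') v) x)).
    by move=> x Kx; rewrite zero_opop // mul0r mulr0.
  have zff k l : zeroK (op (del k) (f l)) by exact: (zeroK_op compactK _ (zf l)).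
  have opf k l x : Om x -> op (del k) (f l) x = w x * op (del k) (op (del l) v) x.
    by move=> Ox; rewrite (opM _ C1w (C1_opdel l) Ox) radw // mulr0 addr0.
  transitivity (Mint (fun x => op (del i) (f i) x * op (del j) (op (del j) v) x)).
    apply: Mint_ext => // x H; first by rewrite opf // mulrA.
    by rewrite zff // mul0r.
  apply: (etrans (J_op_swap oO compactK KOm C1_dens (C1_del i) (C1_del j) (C0_divdel i)
    (C0_divdel j) (has_div_del i) (has_div_del j) (cf i) (zf i) (C1_opdel j) (zero_op _))).
  congr (_ + _).
    apply: (@Mint_ext (fun x => op (del j) (f i) x * op (del i) (op (del j) v) x)
      (fun x => w x * (op (del i) (op (del j) v) x * op (del j) (op (del i) v) x))) => //.
      by move=> x Ox; rewrite opf //; ring.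
    by move=> x Kx; rewrite zff // mul0r.
  apply: (@Mint_ext (fun x => f i x * (- (n%:R - 1) * ee j x * op (del i) (op (del j) v) x
      - - (n%:R - 1) * ee i x * op (del j) (op (del j) v) x + \sum_k (op (del j) (del i k) x
      - op (del i) (del j k) x) * partial k (op (del j) v) x)) (G i j)) => //; last first.
    by move=> x Kx; rewrite zf // mul0r.
  move=> x Ox; rewrite /G; congr (_ * (_ + _)).
  rewrite [op (del i) (op (del j) v) x]/op [op (del j) (op (del j) v) x]/op !big_distrr -sumrB.
  apply: eq_bigr => k _ /=; rewrite !del_del // (del_sym j i); ring.
have I1 i j : inK (fun x => w x * (op (del i) (op (del i) v) x * op (del j) (op (del j) v) x)).
  by apply: (inKM c0w); have [c _] := id2 i i; exact: (inKM c (id2 j j)).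
have I2 i j : inK (fun x => w x * (op (del i) (op (del j) v) x * op (del j) (op (del i) v) x)).
  by apply: (inKM c0w); have [c _] := id2 i j; exact: (inKM c (id2 j i)).
have I3 : inK (fun x => w x * \sum_i op (del i) v x ^+ 2).
  apply: (inKM c0w); apply: inK_sum => // i; split.
    exact: (C0onX oO 2 (C1on0 (C1_opdel i))).
  by move=> x Kx; rewrite zero_op // expr0n.
transitivity (\sum_i \sum_j Mint (fun x => w x * (op (del i) (op (del i) v) x * op (del j) (op (del j) v) x))).
  under eq_bigr => i _ do rewrite -(Mint_sum (I1 i)).
  rewrite -Mint_sum => [|i]; last by apply: inK_sum.
  apply: J_ext => x; congr (_ * _); rewrite expr2 /Lam big_distrl big_distrr /=.
  by apply: eq_bigr => i _; rewrite !big_distrr.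
under eq_bigr => i _ do under eq_bigr => j _ do rewrite key.
under eq_bigr => i _ do rewrite big_split /=.
rewrite big_split /=; congr (_ + _).
  under eq_bigr => i _ do rewrite -(Mint_sum (I2 i)).
  rewrite -Mint_sum => [|i]; last by apply: inK_sum.
  apply: J_ext => x; congr (_ * _); rewrite big_distrr /=.
  by apply: eq_bigr => i _; rewrite !big_distrr.
under eq_bigr => i _ do rewrite -(Mint_sum (iG i)).
rewrite -Mint_sum => [|i]; last by apply: inK_sum.
rewrite -(MintZ _ I3); apply: Mint_ext.
- move=> x Ox.
  (* Summed over [j], the first group collapses by [sum_ee_deldel]; the second is a multiple of
     [ee i * del i v] and disappears in the sum over [i]. *)
  have E i : \sum_j G i j x = (n%:R - 2) * (w x * op (del i) v x ^+ 2)
      + (n%:R - 2) * (w x * Lam v x) * (ee i x * op (del i) v x).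
    transitivity (- (n%:R - 2) * f i x * (\sum_j op (del i) (op (del j) v) x * ee j x) +
        (n%:R - 2) * f i x * ee i x * \sum_j op (del j) (op (del j) v) x).
      by rewrite !big_distrr -big_split /=; apply: eq_bigr => j _; rewrite /G; ring.
    by rewrite sum_ee_deldel // -/(Lam v x) /f; ring.
  under eq_bigr => i _ do rewrite E.
  by rewrite big_split /= -!big_distrr /= sum_ee_op // mulr0 addr0.
- by move=> x Kx; rewrite big1 // => i _; rewrite big1 // => j _; rewrite zG.
- by case: I3 => _ H x Kx; rewrite H // mulr0.
Qed.

(** The spectral gap is needed on every sphere, with a factor depending on the radius; without polar
    coordinates this is expressed by a nonnegative radial weight under the integral. *)
Lemma Mint_Lam_sqr_ge : (2 < n)%N -> (forall x, Om x -> 0 <= w x) ->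
  (n%:R - 1) * Mint (fun x => w x * \sum_i op (del i) v x ^+ 2) <=
  Mint (fun x => w x * Lam v x ^+ 2).
Proof.
move=> n2 w0; have E := Mint_Lam_sqr_eq.
have iL : inK (fun x => w x * Lam v x ^+ 2).
  apply: (inKM (C1on0 C1w)); have [c z] := inK_Lam; split; first exact: (C0onX oO 2 c).
  by move=> x Kx; rewrite z // expr0n.
have id2 i j : inK (op (del i) (op (del j) v)).
  split; last exact: zero_opop.
  by apply: C0_opop => k; exact: C1_del.
have iT : inK (fun x => w x * \sum_i \sum_j op (del i) (op (del j) v) x * op (del j) (op (del i) v) x).
  apply: (inKM (C1on0 C1w)); apply: inK_sum => // i; apply: inK_sum => // j.
  by have [c _] := id2 i j; exact: (inKM c (id2 j i)).
have T : 0 <= Mint (fun x => (n%:R - 1) * (w x * \sum_i \sum_j op (del i) (op (del j) v) x * op (del j) (op (del i) v) x)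
    + -1 * (w x * Lam v x ^+ 2)).
  apply: Mint_ge0.
    by case: iT => _ z1; case: iL => _ z2 x Kx; rewrite z1 // z2 // !mulr0 addr0.
  move=> x Ox; rewrite mulrCA mulN1r -mulrN -mulrDr mulr_ge0 ?w0 // subr_ge0.
  apply: (@trace_sqr_le _ _ (fun i j => op (del i) (op (del j) v) x) (fun i => op (del i) v x)
    (fun i => ee i x)); first exact: ltnW.
  - exact: sum_ee2.
  - exact: sum_ee_op.
  - by move=> j; exact: sum_ee_op.
  - by move=> i; exact: sum_ee_deldel.
  - by move=> i j; rewrite del_del_comm.
have iZ (c : R) g : inK g -> inK (fun x => c * g x) by move=> ig; exact: (inKM (C0on_cst _ c) ig).
rewrite (MintD (iZ _ _ iT) (iZ _ _ iL)) (MintZ _ iT) (MintZ _ iL) in T.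
exact: gap_arith n2 E T.
Qed.

End OneFunction.
End Integrals.

(** * Conjugation of the Laplace-Beltrami operator *)

(** Here [p = 1 / rho], [k = 1 / sinh rho], [t = coth rho], [L = Lam v], and [G], [H],
    [Q] are the sums of [(del_i v)^2], [del_i v * (del_i v)'] and [(del_i v)'^2]. The
    last subtracted group collects terms of integral zero. *)
Lemma rellich_identity (R : realFieldType) (K v v1 v2 L G H Q p k t : R) :
  t ^+ 2 = 1 + k ^+ 2 ->
  let a := K ^+ 2 in let b := K ^+ 2 - K in
  (v2 - (a + b * k ^+ 2) * v + k ^+ 2 * L) ^+ 2
  - v ^+ 2 * (a ^+ 2 + a / 2 * p ^+ 2 + 9 / 16 * p ^+ 4 + (b ^+ 2 - 2 * b) * k ^+ 4
      + 2 * b * (a - 1) * k ^+ 2 + b / 2 * (p ^+ 2 * k ^+ 2))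
  - (k ^+ 4 * L ^+ 2 - (2 * K) * (k ^+ 4 * G))
  - (2^-1 * (2 * v1 * v2 * p - v1 ^+ 2 * p ^+ 2)
     + 3 / 8 * (2 * v * v1 * p ^+ 3 - 3 * v ^+ 2 * p ^+ 4)
     + a * (2 * v * v1 * p - v ^+ 2 * p ^+ 2)
     + b * (2 * v * v1 * p * k ^+ 2 - v ^+ 2 * p ^+ 2 * k ^+ 2 - 2 * t * k ^+ 2 * p * v ^+ 2)
     - 2 * a * (v1 ^+ 2 + v * v2)
     - 2 * b * (- 2 * t * k ^+ 2 * v * v1 + k ^+ 2 * v1 ^+ 2 + k ^+ 2 * v * v2)
     - 2 * a * (k ^+ 2 * (v * L + G)) - 2 * b * (k ^+ 4 * (v * L + G))
     + 4 * (t * k ^+ 2 * (v1 * L + H))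
     + 2 * ((k ^+ 2 * v2 - 2 * t * k ^+ 2 * v1) * L - k ^+ 2 * Q))
  = (v2 - v1 * p / 2) ^+ 2 + 4^-1 * (v1 * p - 3 / 2 * v * p ^+ 2) ^+ 2
    + 2 * a * (v1 - v * p / 2) ^+ 2 + 2 * b * (k * (v1 - (t + p / 2) * v)) ^+ 2
    + 2 * (k ^+ 2 * Q - 2 * t * k ^+ 2 * H + t ^+ 2 * k ^+ 2 * G)
    + G * (2 * (a - 1) * k ^+ 2 + (2 * b + 2 * K - 2) * k ^+ 4).
Proof.
move=> Et a b.
(* As polynomials the two sides differ by a multiple of [1 + k ^+ 2 - t ^+ 2]; once that multiple is
   added [field] applies, and [Et] then removes it. *)
transitivity ((v2 - v1 * p / 2) ^+ 2 + 4^-1 * (v1 * p - 3 / 2 * v * p ^+ 2) ^+ 2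
    + 2 * a * (v1 - v * p / 2) ^+ 2 + 2 * b * (k * (v1 - (t + p / 2) * v)) ^+ 2
    + 2 * (k ^+ 2 * Q - 2 * t * k ^+ 2 * H + t ^+ 2 * k ^+ 2 * G)
    + G * (2 * (a - 1) * k ^+ 2 + (2 * b + 2 * K - 2) * k ^+ 4)
    + (1 + k ^+ 2 - t ^+ 2) * (2 * b * k ^+ 2 * v ^+ 2 + 2 * k ^+ 2 * G)).
  by rewrite /a /b; field.
by rewrite Et subrr mul0r addr0.
Qed.

Section Conjugation.
Context {R : realType} {n : nat}.
Implicit Types (f g h v w : 'rV[R]_n -> R) (x : 'rV[R]_n) (a : 'I_n -> 'rV[R]_n -> R).

Local Notation Om := (@punctured_ball R n).
Local Notation r := (@euclid_norm R n).
Let oO : open Om := open_Om.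

Definition kappa : R := (n%:R - 1) / 2.

(** [sg = (sinh rho) ^ kappa], where [sinh rho = 2 r / (1 - r ^ 2)]. *)
Definition sg x : R :=
  expR (kappa * (ln 2 + (-1 * ln (1 + -1 * sqn x) + 2^-1 * ln (sqn x)))).

Let C2_arg : C2on Om (fun x => ln 2 + (-1 * ln (1 + -1 * sqn x) + 2^-1 * ln (sqn x))).
Proof.
exact: (C2onD oO (C2on_cst oO _) (C2onD oO (C2onZ oO _ C2_ln1q) (C2onZ oO _ C2_lnq))).
Qed.

Lemma C2_sg : C2on Om sg.
Proof. exact: (C2on_expR oO (C2onZ oO _ C2_arg)). Qed.

Lemma C1_sg : C1on Om sg. Proof. exact: (C2on1 C2_sg). Qed.

Lemma one_sub_sqn x : Om x -> 0 < 1 + -1 * sqn x.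
Proof. by move=> Ox; rewrite mulN1r subr_gt0 sqn_lt1. Qed.

Lemma op_sg a x : Om x ->
  op a sg x = sg x * kappa * (2 / (1 - sqn x) + (sqn x)^-1) * radc a x.
Proof.
move=> Ox; have q0 := sqn_gt0 Ox; have q1 := one_sub_sqn Ox.
have c1 : C1on Om (fun x => ln (1 + -1 * sqn x)) by exact: (C2on1 C2_ln1q).
have c2 : C1on Om (fun x => ln (sqn x)) by exact: (C2on1 C2_lnq).
have c3 : C1on Om (fun x => 1 + -1 * sqn x) by exact: (C2on1 C2_1q).
have c4 : C1on Om (fun x => -1 * sqn x) by exact: (C1onZ oO _ C1_sqn).
rewrite (op_expR a (C1onZ oO _ (C2on1 C2_arg)) Ox) -/(sg x).
rewrite (opZ oO a _ (C2on1 C2_arg) Ox).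
rewrite (opD a (C1on_cst oO _) (C1onD oO (C1onZ oO _ c1) (C1onZ oO _ c2)) Ox) op_cst.
rewrite (opD a (C1onZ oO _ c1) (C1onZ oO _ c2) Ox) (opZ oO a _ c1 Ox) (opZ oO a _ c2 Ox).
rewrite (op_ln a c3 Ox q1) (op_ln a C1_sqn Ox q0).
rewrite (opD a (C1on_cst oO _) c4 Ox) op_cst (opZ oO a _ C1_sqn Ox) op_sqn //.
rewrite mulN1r in q1 *.
by field; rewrite !gt_eqF.
Qed.

Lemma E_sg x : Om x -> op Efield sg x = kappa * ct x * sg x.
Proof.
move=> Ox; have q0 := sqn_gt0 Ox; have q1 := one_sub_sqn Ox; rewrite mulN1r in q1.
rewrite op_sg // radc_E /cs /ct; field.
by rewrite !gt_eqF.
Qed.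

Lemma del_sg i x : Om x -> op (del i) sg x = 0.
Proof. by move=> Ox; rewrite op_sg // radc_del // mulr0. Qed.

Lemma sg_sqr x : (0 < n)%N -> Om x -> sg x ^+ 2 = (cs x)^-1 ^+ n.-1.
Proof.
move=> n0 Ox; have q0 := sqn_gt0 Ox; have q1 := one_sub_sqn Ox.
rewrite /sg -expRM_natl mulrA.
have -> : 2%:R * kappa = n.-1%:R.
  by rewrite -[in RHS]subn1 natrB // /kappa; field.
rewrite expRM_natl; congr (_ ^+ _).
rewrite !expRD mulN1r expRN !lnK ?posrE // -r_expR // mulN1r /cs /ri.
rewrite mulN1r in q1; have r0 := r_neq0 Ox.
by field; rewrite ?r0 ?gt_eqF.
Qed.

Lemma conf_cs x : Om x -> conf x = ri x / cs x.
Proof.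
move=> Ox; have q1 := one_sub_sqn Ox; rewrite mulN1r in q1.
have := ri_gt0 Ox; rewrite /conf r_sqr /cs => r0; field.
by rewrite !gt_eqF.
Qed.

(** The hyperbolic volume in polar form, [(sinh rho)^(n-1)] times [drho dsigma]. It turns the norms
    of [u] into integrals [Mint] of [v ^+ 2]. *)
Lemma dens_sg x : (0 < n)%N -> Om x -> conf x ^+ n = dens x * sg x ^+ 2.
Proof.
move=> n0 Ox; rewrite conf_cs // sg_sqr // /dens mulrAC -exprS prednK //.
by rewrite exprMn mulrC.
Qed.

Lemma C1_conf : C1on Om (@conf R n).
Proof.
have c3 : C1on Om (fun x => 1 + -1 * sqn x) by exact: (C2on1 C2_1q).
have c4 : C1on Om (fun x => (1 + -1 * sqn x)^-1).
  by apply: (C1on_inv oO c3) => x Ox; rewrite gt_eqF // one_sub_sqn.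
apply: (C1on_ext oO _ (C1onZ oO 2 c4)) => x Ox.
by rewrite /conf r_sqr mulN1r.
Qed.

Lemma op_conf a x : Om x -> op a (@conf R n) x = conf x ^+ 2 * radc a x.
Proof.
move=> Ox; have q1 := one_sub_sqn Ox.
have c3 : C1on Om (fun x => 1 + -1 * sqn x) by exact: (C2on1 C2_1q).
have c4 : C1on Om (fun x => (1 + -1 * sqn x)^-1).
  by apply: (C1on_inv oO c3) => y Oy; rewrite gt_eqF // one_sub_sqn.
have c5 : C1on Om (fun x => -1 * sqn x) by exact: (C1onZ oO _ C1_sqn).
rewrite (op_ext oO a (g := fun x => 2 * (1 + -1 * sqn x)^-1)) //; last first.
  by move=> y _; rewrite /conf r_sqr mulN1r.
rewrite (opZ oO a _ c4 Ox) (op_inv a c3 Ox) ?gt_eqF //.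
rewrite (opD a (C1on_cst oO _) c5 Ox) op_cst (opZ oO a _ C1_sqn Ox) op_sqn //.
rewrite /conf r_sqr; rewrite mulN1r in q1 *.
by field; rewrite gt_eqF.
Qed.

Section LaplaceBeltrami.
Variable u : 'rV[R]_n -> R.
Hypotheses (C2u : C2on Om u) (n3 : (2 < n)%N).

(** Euler derivative, Euclidean Laplacian and Hessian in the direction [x]: [LB_polar] is checked by
    writing every term through these three. *)
Let Du x : R := \sum_k x 0 k * partial k u x.
Let Lapl x : R := \sum_k partial k (partial k u) x.
Let Hess x : R := \sum_k \sum_l x 0 k * x 0 l * partial l (partial k u) x.

Let opE_u x : op Efield u x = cs x * Du x.
Proof. by rewrite /op /Du big_distrr; apply: eq_bigr => k _ /=; rewrite mulrA. Qed.

Let opEE_u x : Om x -> op Efield (op Efield u) x =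
  (cs x ^+ 2 - ct x * cs x) * Du x + cs x ^+ 2 * Hess x.
Proof.
move=> Ox; rewrite (op_op oO _ C1_E C2u Ox); congr (_ + _).
  rewrite /Du big_distrr; apply: eq_bigr => k _ /=.
  rewrite (opM _ C1_cs (C1on_coord oO k) Ox) op_coord E_cs // /Efield; ring.
rewrite /Hess big_distrr; apply: eq_bigr => k _; rewrite big_distrr.
by apply: eq_bigr => l _; rewrite /Efield /=; ring.
Qed.

Let dsum (F : 'I_n -> R) i : \sum_j (j == i)%:R * F j = F i.
Proof.
rewrite (bigD1 i) //= eqxx mul1r big1 ?addr0 // => j ji.
by rewrite (negbTE ji) mul0r.
Qed.

Let Lam_u x : Om x -> Lam u x = - (n%:R - 1) * Du x + sqn x * Lapl x - Hess x.
Proof.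
move=> Ox; rewrite /Lam.
under eq_bigr => i _ do rewrite (op_op oO _ (C1_del i) C2u Ox).
rewrite big_split /= -addrA; congr (_ + _).
  rewrite exchange_big /= /Du big_distrr; apply: eq_bigr => k _ /=.
  rewrite -big_distrl /= mulrA; congr (_ * _).
  under eq_bigr => i _ do rewrite del_del //.
  rewrite sumrN big_split /= sum_ee_del // addr0 -big_distrl /=.
  have -> : \sum_i del i i x = r x * (n%:R - 1).
    rewrite /del; under eq_bigr => i _ do rewrite eqxx mulr1 -expr2 mulrC.
    rewrite sumrB -big_distrr /= -/(sqn x) mulrC sqn_ri // sumr_const card_ord.
    by rewrite mulrBr mulr1 mulr_natr.
  have -> : r x * (n%:R - 1) * ee k x = (n%:R - 1) * x 0 k * (r x * ri x).
    by rewrite /ee; ring.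
  by rewrite r_ri //; ring.
rewrite exchange_big /=.
(* The Gram matrix of the fields [del i]: [|x|^2] times the tangential projection. *)
have E k l : \sum_i del i k x * del i l x = (l == k)%:R * sqn x - x 0 k * x 0 l.
  transitivity (\sum_i ((i == k)%:R * (r x ^+ 2 * (i == l)%:R - x 0 i * x 0 l * (r x * ri x))
     - (i == l)%:R * (x 0 i * x 0 k * (r x * ri x)) + x 0 k * x 0 l * ri x ^+ 2 * x 0 i ^+ 2)).
    by apply: eq_bigr => i _; rewrite /del; ring.
  rewrite big_split /= sumrB !dsum -big_distrr /= -/(sqn x) r_ri // r_sqr (eq_sym k l).
  have -> : x 0 k * x 0 l * ri x ^+ 2 * sqn x = x 0 k * x 0 l * (sqn x * ri x * ri x) by ring.
  by rewrite sqn_ri // r_ri //; ring.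
rewrite /Lapl /Hess big_distrr /= -sumrB; apply: eq_bigr => k _.
rewrite exchange_big /=.
under eq_bigr => l _ do rewrite -big_distrl /= E mulrBl -mulrA.
by rewrite sumrB dsum.
Qed.

(** The Laplacian of the warped metric [drho^2 + sinh^2 dsigma^2]. The terms in [Hess] cancel
    between the radial and the angular part. *)
Lemma LB_polar x : Om x ->
  LB u x = op Efield (op Efield u) x + 2 * kappa * ct x * op Efield u x
    + cs x ^+ 2 * Lam u x.
Proof.
move=> Ox; rewrite opEE_u // Lam_u // opE_u.
have c0 : conf x != 0.
  by rewrite conf_cs // gt_eqF // divr_gt0 ?ri_gt0 ?cs_gt0.
have [_ cpu] := C2u.
have -> : LB u x = (conf x)^-1 ^+ 2 * Lapl x + (n%:R - 2) * (conf x)^-1 * Du x.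
  (* Writing [n = k.+3] resolves the truncated [n - 2] and the predecessor in [opX]. *)
  rewrite /LB; have [k nk] : exists k, n = k.+3 by exists (n - 3)%N; rewrite -addn3 subnK.
  have En : (conf x ^+ n)^-1 = (conf x ^+ k.+1)^-1 * (conf x)^-1 ^+ 2.
    have H (c : R) : c ^+ n = c ^+ k.+1 * c ^+ 2 by rewrite nk -exprD addn2.
    by rewrite H invfM exprVn.
  have -> : \sum_i partial i (fun y => conf y ^+ (n - 2) * partial i u y) x =
      conf x ^+ k.+1 * Lapl x + conf x ^+ k.+2 * (n%:R - 2) * Du x.
    rewrite /Lapl /Du !big_distrr -big_split /=; apply: eq_bigr => i _.
    rewrite (partialM i (C1onX oO _ C1_conf) (cpu i) Ox).
    rewrite [partial i (fun y => conf y ^+ _) x]partial_op_delta opX //; last exact: C1_conf.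
    rewrite op_conf // radc_delta.
    have -> : (n - 2 = k.+1)%N by rewrite nk subSS subSS subn0.
    have -> : n%:R - 2 = k.+1%:R :> R by rewrite [in LHS]nk -addn2 natrD addrK.
    by rewrite /= !exprS; ring.
  have k0 : conf x ^+ k != 0 by rewrite expf_neq0.
  rewrite En (exprS _ k.+1) (exprS _ k); set c := conf x in c0 k0 *; set e := c ^+ k in k0 *.
  by field; rewrite k0 c0.
have q1 := one_sub_sqn Ox; rewrite mulN1r in q1.
(* Here [ct x - cs x] equals [r x]. *)
have -> : (conf x)^-1 = cs x * (ct x - cs x).
  have -> : cs x * (ct x - cs x) = (1 - sqn x) / 2 * (sqn x * ri x * ri x).
    by rewrite /cs /ct; field.
  by rewrite sqn_ri // r_ri // /conf r_sqr; field; rewrite gt_eqF.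
have -> : (cs x * (ct x - cs x)) ^+ 2 = cs x ^+ 2 * sqn x.
  have -> : (cs x * (ct x - cs x)) ^+ 2 = cs x ^+ 2 * sqn x * (sqn x * ri x * ri x).
    by rewrite /cs /ct; field.
  by rewrite sqn_ri // r_ri // mulr1.
by rewrite /kappa; field.
Qed.

Definition vfun x : R := sg x * u x.

Lemma C2_vfun : C2on Om vfun. Proof. exact: (C2onM oO C2_sg C2u). Qed.

(** The weight absorbs the first-order term: since [sg' = K coth * sg], the second derivative of
    [sg * u] contains exactly [2 K coth * u'], and [coth^2 = 1 + 1 / sinh^2] gives the potential. *)
Lemma LB_conj x : Om x -> sg x * LB u x =
  op Efield (op Efield vfun) x - (kappa ^+ 2 + (kappa ^+ 2 - kappa) * cs x ^+ 2) * vfun x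
  + cs x ^+ 2 * Lam vfun x.
Proof.
move=> Ox; rewrite LB_polar //.
have c1u := C2on1 C2u; have cE := C1_opE C2u.
have Ev y : Om y -> op Efield vfun y = sg y * (op Efield u y + kappa * (ct y * u y)).
  by move=> Oy; rewrite (opM _ C1_sg c1u Oy) E_sg //; ring.
have c3 := C1onZ oO kappa (C1onM oO C1_ct c1u).
have -> : op Efield (op Efield vfun) x = sg x * (op Efield (op Efield u) x
    + 2 * kappa * ct x * op Efield u x + (kappa ^+ 2 * ct x ^+ 2 - kappa * cs x ^+ 2) * u x).
  rewrite (op_ext oO _ Ev Ox) (opM _ C1_sg (C1onD oO cE c3) Ox) E_sg //.
  rewrite (opD _ cE c3 Ox) (opZ oO _ _ (C1onM oO C1_ct c1u) Ox) (opM _ C1_ct c1u Ox) E_ct //.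
  by ring.
have -> : Lam vfun x = sg x * Lam u x.
  rewrite /Lam big_distrr; apply: eq_bigr => i _ /=.
  have dv y : Om y -> op (del i) vfun y = sg y * op (del i) u y.
    by move=> Oy; rewrite (opM _ C1_sg c1u Oy) del_sg // mulr0 addr0.
  rewrite (op_ext oO _ dv Ox) (opM _ C1_sg (C1_opdel C2u i) Ox) del_sg //.
  by rewrite mulr0 addr0.
by rewrite ct_sqr // /vfun; ring.
Qed.

End LaplaceBeltrami.
End Conjugation.

(** * The inequality *)

Section Inequality.
Context {R : realType} {n : nat}.
Implicit Types (f g h v w : 'rV[R]_n -> R) (x : 'rV[R]_n).

Local Notation Om := (@punctured_ball R n).
Let oO : open Om := open_Om.
Variable K : set 'rV[R]_n.
Hypotheses (compactK : compact K) (KOm : K `<=` Om) (n3 : (2 < n)%N).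

Local Notation inK := (inK Om K).
Local Notation zeroK := (zeroK K).

(** All integrations by parts are collected as functions of integral zero, so that the inequality
    comes down to one pointwise identity. *)
Variant null g : Prop := MkNull of inK g & Mint g = 0.

Lemma nullD f g : null f -> null g -> null (fun x => f x + g x).
Proof.
move=> [i1 e1] [i2 e2]; split; first exact: inKD.
by rewrite (MintD compactK KOm i1 i2) e1 e2 addr0.
Qed.

Lemma nullZ (c : R) f : null f -> null (fun x => c * f x).
Proof.
move=> [i1 e1]; split; first exact: (inKM (C0on_cst _ c) i1).
by rewrite (MintZ compactK KOm c i1) e1 mulr0.
Qed.

Lemma null_E g : C1on Om g -> zeroK g -> null (op Efield g).
Proof.
move=> cg zg; split; last exact: (Mint_E compactK KOm cg zg).
by apply: (inK_op oO compactK) => // j; exact: (C1on0 (C1_E j)).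
Qed.

(** At the origin and outside the ball, where quotients by [rho] take default values, both
    integrands are zero because they vanish off [K]. *)
Lemma hnorm2_Mint f g : zeroK f -> inK g ->
  (forall x, Om x -> f x ^+ 2 * conf x ^+ n = dens x * g x) ->
  hnorm2 f = (Mint g)%:E.
Proof.
move=> zf ig E; rewrite -(integral_Rn_Cc (inK_dens compactK KOm ig)) /hnorm2.
congr integral_Rn; apply/funext => x; have [Kx|Kx] := pselect (K x).
  by have Ox := KOm Kx; rewrite (r_lt1 Ox) E.
have [_ zg] := ig; rewrite zf // zg // expr0n mul0r mulr0.
by case: ifP.
Qed.

Section Vfun.
Variable v : 'rV[R]_n -> R.
Hypotheses (C2v : C2on Om v) (zv : zeroK v).

Let k : R := @kappa R n.
Let a : R := k ^+ 2.
Let b : R := k ^+ 2 - k.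
Let v1 := op Efield v.
Let v2 := op Efield v1.
Let L := Lam v.
Let G x : R := \sum_i op (del i) v x ^+ 2.
Let H x : R := \sum_i op (del i) v x * op Efield (op (del i) v) x.
Let Q x : R := \sum_i op Efield (op (del i) v) x ^+ 2.

Definition Tfun x : R :=
  op Efield (op Efield v) x
  - (@kappa R n ^+ 2 + (@kappa R n ^+ 2 - @kappa R n) * cs x ^+ 2) * v x
  + cs x ^+ 2 * Lam v x.

Definition potential (c1 c2 c3 c4 c5 c6 : R) x : R :=
  c1 * v x ^+ 2 + c2 * (v x ^+ 2 * pp x ^+ 2) + c3 * (v x ^+ 2 * pp x ^+ 4)
  + c4 * (v x ^+ 2 * cs x ^+ 4) + c5 * (v x ^+ 2 * cs x ^+ 2)
  + c6 * (v x ^+ 2 * (pp x ^+ 2 * cs x ^+ 2)).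

Let c1v : C1on Om v := C2on1 C2v.
Let c1v1 : C1on Om v1 := C1_opE C2v.
Let zv1 : zeroK v1. Proof. exact: zero_op. Qed.
Let c0k : C0on Om cs := C1on0 C1_cs.
Let c0p : C0on Om pp := C1on0 C1_pp.
Let c1M f g : C1on Om f -> C1on Om g -> C1on Om (fun x => f x * g x).
Proof. exact: (C1onM oO). Qed.

(** Derivatives along [Efield], of integral zero. [n1] and [n2] give the Rellich constant [9/16];
    [n3'] and [n4] are Hardy's inequality for [v] and for [v / sinh rho]; [n5] and [n6] trade
    [v v''] for [- v'^2]. *)
Let n1 := op Efield (fun x => v1 x * v1 x * pp x).
Let n2 := op Efield (fun x => v x * v x * (pp x * pp x * pp x)).
Let n3' := op Efield (fun x => v x * v x * pp x).
Let n4 := op Efield (fun x => v x * v x * (pp x * (cs x * cs x))).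
Let n5 := op Efield (fun x => v x * v1 x).
Let n6 := op Efield (fun x => cs x * cs x * (v x * v1 x)).
Let zLam h x : R := h x * L x + \sum_i op (del i) h x * op (del i) v x.
(** Treats the mixed product of [v''] and [Lam v], by [Mint_ELam] with the weight [cs ^+ 2]. *)
Let n9 x : R := op Efield (fun y => cs y * cs y * op Efield v y) x * Lam v x
  + -1 * (cs x * cs x * \sum_i op Efield (op (del i) v) x ^+ 2).

Let null_zLam h : C1on Om h -> null (zLam h).
Proof.
move=> ch.
have i1 : inK (fun x => h x * L x).
  exact: (inKM (C1on0 ch) (inK_Lam compactK C2v zv)).
have i2 : inK (fun x => \sum_i op (del i) h x * op (del i) v x).
  apply: (inK_sum oO) => i; apply: inKM.
    by apply: (C0on_op oO) => // j; exact: (C1on0 (C1_del i j)).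
  by split; [exact: (C1on0 (C1_opdel C2v i))|exact: zero_op].
split; first exact: inKD.
by rewrite (MintD compactK KOm i1 i2) (Mint_Lam compactK KOm C2v zv ch) addNr.
Qed.

Let null_n9 : null n9.
Proof.
have ckk := c1M C1_cs C1_cs.
have rk i x : Om x -> op (del i) (fun x => cs x * cs x) x = 0.
  by move=> Ox; rewrite (opM _ C1_cs C1_cs Ox) del_cs // mulr0 addr0.
have i1 : inK (fun x => op Efield (fun y => cs y * cs y * op Efield v y) x * Lam v x).
  apply: (inKM _ (inK_Lam compactK C2v zv)).
  by apply: (C0on_op oO) => [j|]; [exact: (C1on0 (C1_E j))|exact: c1M].
have i2 : inK (fun x => cs x * cs x * \sum_i op Efield (op (del i) v) x ^+ 2).
  apply: (inKM (C1on0 ckk)); apply: (inK_sum oO) => i; split.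
    by apply: (C0onX oO); apply: (C0_opop C2v) => j; exact: C1_E.
  by move=> x Kx; rewrite (zero_opop compactK zv _ _ Kx) expr0n.
split; first exact: (inKD i1 (inKM (C0on_cst _ (-1)) i2)).
rewrite (MintD compactK KOm i1 (inKM (C0on_cst _ (-1)) i2)).
rewrite (MintZ compactK KOm (-1) i2) (Mint_ELam compactK KOm C2v zv ckk rk).
by rewrite mulN1r subrr.
Qed.

(** The deficit in the spectral gap with weight [cs ^+ 4], where [2 * k] is [n - 1]. Its sign is
    known only after integration. *)
Let dfun x : R := cs x ^+ 4 * L x ^+ 2 + - (2 * k) * (cs x ^+ 4 * G x).

Let inK_dfun : inK dfun.
Proof.
have [cL zL] := inK_Lam compactK C2v zv.
apply: inKD.
  apply: (inKM (C0onX oO 4 c0k)); split; first exact: (C0onX oO 2 cL).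
  by move=> x Kx; rewrite /L zL // expr0n.
apply: (inKM (C0on_cst _ _)); apply: (inKM (C0onX oO 4 c0k)); apply: (inK_sum oO) => i.
split; first exact: (C0onX oO 2 (C1on0 (C1_opdel C2v i))).
by move=> x Kx; rewrite (zero_op compactK zv _ Kx) expr0n.
Qed.

Let twok : 2 * k = n%:R - 1.
Proof. by rewrite /k /kappa; field. Qed.

Let Mint_dfun : 0 <= Mint dfun.
Proof.
have [cL zL] := inK_Lam compactK C2v zv.
have i1 : inK (fun x => cs x ^+ 4 * L x ^+ 2).
  apply: (inKM (C0onX oO 4 c0k)); split; first exact: (C0onX oO 2 cL).
  by move=> x Kx; rewrite /L zL // expr0n.
have i2 : inK (fun x => cs x ^+ 4 * G x).
  apply: (inKM (C0onX oO 4 c0k)); apply: (inK_sum oO) => i.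
  split; first exact: (C0onX oO 2 (C1on0 (C1_opdel C2v i))).
  by move=> x Kx; rewrite (zero_op compactK zv _ Kx) expr0n.
rewrite (MintD compactK KOm i1 (inKM (C0on_cst _ (- (2 * k))) i2)).
rewrite (MintZ compactK KOm _ i2) mulNr subr_ge0 twok.
apply: (Mint_Lam_sqr_ge compactK KOm C2v zv (C1onX oO 4 C1_cs)) => //.
- by move=> i x Ox; rewrite opX //; [rewrite del_cs // mulr0|exact: C1_cs].
- by move=> x Ox; rewrite exprn_ge0 // ltW // cs_gt0.
Qed.

Let Zfun x : R :=
  2^-1 * n1 x + 3 / 8 * n2 x + a * n3' x + b * n4 x + - (2 * a) * n5 x
  + - (2 * b) * n6 x + - (2 * a) * zLam (fun x => cs x * cs x * v x) x
  + - (2 * b) * zLam (fun x => cs x * cs x * (cs x * cs x) * v x) x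
  + 4 * zLam (fun x => ct x * (cs x * cs x) * v1 x) x + 2 * n9 x.

Let null_Zfun : null Zfun.
Proof.
have ckk := c1M C1_cs C1_cs.
apply: nullD; last exact: (nullZ _ null_n9).
apply: nullD; last by apply: nullZ; apply: null_zLam; exact: (c1M (c1M C1_ct ckk) c1v1).
apply: nullD; last by apply: nullZ; apply: null_zLam; exact: (c1M (c1M ckk ckk) c1v).
apply: nullD; last by apply: nullZ; apply: null_zLam; exact: (c1M ckk c1v).
apply: nullD; last first.
  apply: nullZ; apply: null_E; first exact: (c1M ckk (c1M c1v c1v1)).
  by move=> x Kx; rewrite zv // mul0r mulr0.
apply: nullD; last first.
  apply: nullZ; apply: null_E; first exact: (c1M c1v c1v1).
  by move=> x Kx; rewrite zv // mul0r.
apply: nullD; last first.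
  apply: nullZ; apply: null_E; first exact: (c1M (c1M c1v c1v) (c1M C1_pp ckk)).
  by move=> x Kx; rewrite zv // !mul0r.
apply: nullD; last first.
  apply: nullZ; apply: null_E; first exact: (c1M (c1M c1v c1v) C1_pp).
  by move=> x Kx; rewrite zv // !mul0r.
apply: nullD; last first.
  apply: nullZ; apply: null_E; first exact: (c1M (c1M c1v c1v) (c1M (c1M C1_pp C1_pp) C1_pp)).
  by move=> x Kx; rewrite zv // !mul0r.
apply: nullZ; apply: null_E; first exact: (c1M (c1M c1v1 c1v1) C1_pp).
by move=> x Kx; rewrite zv1 // !mul0r.
Qed.

Lemma inK_v2 w : C0on Om w -> inK (fun x => v x ^+ 2 * w x).
Proof.
move=> cw; split; first exact: (C0onM (C0onX oO 2 (C1on0 c1v)) cw).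
by move=> x Kx; rewrite zv // expr0n mul0r.
Qed.

Lemma inK_vv : inK (fun x => v x ^+ 2).
Proof.
split; first exact: (C0onX oO 2 (C1on0 c1v)).
by move=> x Kx; rewrite zv // expr0n.
Qed.

Let cpk : C0on Om (fun x => pp x ^+ 2 * cs x ^+ 2) := C0onM (C0onX oO 2 c0p) (C0onX oO 2 c0k).

Lemma inK_T2 : inK (fun x => Tfun x ^+ 2).
Proof.
have [cL zL] := inK_Lam compactK C2v zv.
split; last first.
  by move=> x Kx; rewrite /Tfun zL // zv // (zero_opop compactK zv _ _ Kx) !mulr0 subr0 addr0 expr0n.
apply: (C0onX oO); apply: C0onD; last exact: (C0onM (C0onX oO 2 c0k) cL).
apply: (C0onB oO); first exact: (C0_opEE C2v).
apply: (C0onM _ (C1on0 c1v)); apply: (C0onD (C0on_cst _ _)).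
exact: (C0onM (C0on_cst _ _) (C0onX oO 2 c0k)).
Qed.

Lemma inK_potential c1 c2 c3 c4 c5 c6 : inK (potential c1 c2 c3 c4 c5 c6).
Proof.
have z (c : R) g : inK g -> inK (fun x => c * g x) by move=> ig; exact: (inKM (C0on_cst _ c) ig).
apply: inKD; last exact: (z _ _ (inK_v2 cpk)).
apply: inKD; last exact: (z _ _ (inK_v2 (C0onX oO 2 c0k))).
apply: inKD; last exact: (z _ _ (inK_v2 (C0onX oO 4 c0k))).
apply: inKD; last exact: (z _ _ (inK_v2 (C0onX oO 4 c0p))).
apply: inKD; last exact: (z _ _ (inK_v2 (C0onX oO 2 c0p))).
exact: (z _ _ inK_vv).
Qed.

Lemma Mint_potential c1 c2 c3 c4 c5 c6 : Mint (potential c1 c2 c3 c4 c5 c6) =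
  c1 * Mint (fun x => v x ^+ 2) + c2 * Mint (fun x => v x ^+ 2 * pp x ^+ 2)
  + c3 * Mint (fun x => v x ^+ 2 * pp x ^+ 4) + c4 * Mint (fun x => v x ^+ 2 * cs x ^+ 4)
  + c5 * Mint (fun x => v x ^+ 2 * cs x ^+ 2)
  + c6 * Mint (fun x => v x ^+ 2 * (pp x ^+ 2 * cs x ^+ 2)).
Proof.
have z (c : R) g : inK g -> inK (fun x => c * g x) by move=> ig; exact: (inKM (C0on_cst _ c) ig).
have i1 := inK_vv.
have i2 := inK_v2 (C0onX oO 2 c0p).
have i3 := inK_v2 (C0onX oO 4 c0p).
have i4 := inK_v2 (C0onX oO 4 c0k).
have i5 := inK_v2 (C0onX oO 2 c0k).
have i6 := inK_v2 cpk.
have j2 := inKD (z c1 _ i1) (z c2 _ i2).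
have j3 := inKD j2 (z c3 _ i3).
have j4 := inKD j3 (z c4 _ i4).
have j5 := inKD j4 (z c5 _ i5).
rewrite (MintD compactK KOm j5 (z c6 _ i6)) (MintD compactK KOm j4 (z c5 _ i5)).
rewrite (MintD compactK KOm j3 (z c4 _ i4)) (MintD compactK KOm j2 (z c3 _ i3)).
rewrite (MintD compactK KOm (z c1 _ i1) (z c2 _ i2)).
rewrite (MintZ compactK KOm _ i1) (MintZ compactK KOm _ i2) (MintZ compactK KOm _ i3).
by rewrite (MintZ compactK KOm _ i4) (MintZ compactK KOm _ i5) (MintZ compactK KOm _ i6).
Qed.

Let k1 : 1 <= k.
Proof.
rewrite /k /kappa ler_pdivlMr // lerBrDr.
have -> : 1 * 2 + 1 = 3%:R :> R by ring.
by rewrite ler_nat.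
Qed.

(** Subtracting the potential, [dfun] and [Zfun] from [Tfun ^+ 2] leaves, by [rellich_identity], a
    function that is nonnegative at every point of the punctured ball. *)
Lemma Tfun_ge : Mint (potential (a ^+ 2) (a / 2) (9 / 16) (b ^+ 2 - 2 * b) (2 * b * (a - 1)) (b / 2))
  <= Mint (fun x => Tfun x ^+ 2).
Proof.
set F := potential _ _ _ _ _ _.
have iF : inK F by exact: inK_potential.
have [iZ eZ] := null_Zfun.
have z (c : R) g : inK g -> inK (fun x => c * g x) by move=> ig; exact: (inKM (C0on_cst _ c) ig).
have j1 := inKD inK_T2 (z (-1) _ iF).
have j2 := inKD j1 (z (-1) _ inK_dfun).
have j3 := inKD j2 (z (-1) _ iZ).
suff P : 0 <= Mint (fun x => Tfun x ^+ 2 + -1 * F x + -1 * dfun x + -1 * Zfun x).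
  move: P; rewrite (MintD compactK KOm j2 (z (-1) _ iZ)) (MintD compactK KOm j1 (z (-1) _ inK_dfun)).
  rewrite (MintD compactK KOm inK_T2 (z (-1) _ iF)) (MintZ compactK KOm _ iZ) eZ mulr0 addr0.
  rewrite (MintZ compactK KOm _ iF) (MintZ compactK KOm _ inK_dfun) !mulN1r subr_ge0 => le1.
  by rewrite -subr_ge0; exact: (le_trans Mint_dfun).
apply: (Mint_ge0 KOm); first by case: j3.
move=> x Ox.
have En1 : n1 x = 2 * v1 x * v2 x * pp x - v1 x ^+ 2 * pp x ^+ 2.
  rewrite /n1 (opM _ (c1M c1v1 c1v1) C1_pp Ox) (opM _ c1v1 c1v1 Ox) E_pp // -/v2; ring.
have En2 : n2 x = 2 * v x * v1 x * pp x ^+ 3 - 3 * v x ^+ 2 * pp x ^+ 4.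
  rewrite /n2 (opM _ (c1M c1v c1v) (c1M (c1M C1_pp C1_pp) C1_pp) Ox) (opM _ c1v c1v Ox).
  rewrite (opM _ (c1M C1_pp C1_pp) C1_pp Ox) (opM _ C1_pp C1_pp Ox) E_pp // -/v1; ring.
have En3 : n3' x = 2 * v x * v1 x * pp x - v x ^+ 2 * pp x ^+ 2.
  rewrite /n3' (opM _ (c1M c1v c1v) C1_pp Ox) (opM _ c1v c1v Ox) E_pp // -/v1; ring.
have En4 : n4 x = 2 * v x * v1 x * pp x * cs x ^+ 2 - v x ^+ 2 * pp x ^+ 2 * cs x ^+ 2
    - 2 * ct x * cs x ^+ 2 * pp x * v x ^+ 2.
  rewrite /n4 (opM _ (c1M c1v c1v) (c1M C1_pp (c1M C1_cs C1_cs)) Ox) (opM _ c1v c1v Ox).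
  rewrite (opM _ C1_pp (c1M C1_cs C1_cs) Ox) (opM _ C1_cs C1_cs Ox) E_pp // E_cs // -/v1; ring.
have En5 : n5 x = v1 x ^+ 2 + v x * v2 x.
  rewrite /n5 (opM _ c1v c1v1 Ox) -/v1 -/v2; ring.
have En6 : n6 x = - 2 * ct x * cs x ^+ 2 * v x * v1 x + cs x ^+ 2 * v1 x ^+ 2 + cs x ^+ 2 * v x * v2 x.
  rewrite /n6 (opM _ (c1M C1_cs C1_cs) (c1M c1v c1v1) Ox) (opM _ c1v c1v1 Ox).
  rewrite (opM _ C1_cs C1_cs Ox) E_cs // -/v1 -/v2; ring.
have dkk i : op (del i) (fun x => cs x * cs x) x = 0.
  by rewrite (opM _ C1_cs C1_cs Ox) del_cs // mulr0 addr0.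
have Ez7 : zLam (fun x => cs x * cs x * v x) x = cs x ^+ 2 * (v x * L x + G x).
  rewrite /zLam mulrDr; congr (_ + _); first ring.
  rewrite /G big_distrr; apply: eq_bigr => i _ /=.
  rewrite (opM _ (c1M C1_cs C1_cs) c1v Ox) dkk; ring.
have Ez7b : zLam (fun x => cs x * cs x * (cs x * cs x) * v x) x = cs x ^+ 4 * (v x * L x + G x).
  rewrite /zLam mulrDr; congr (_ + _); first ring.
  rewrite /G big_distrr; apply: eq_bigr => i _ /=; have ckk := c1M C1_cs C1_cs.
  rewrite (opM _ (c1M ckk ckk) c1v Ox) (opM _ ckk ckk Ox) dkk; ring.
have Ez8 : zLam (fun x => ct x * (cs x * cs x) * v1 x) x = ct x * cs x ^+ 2 * (v1 x * L x + H x).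
  rewrite /zLam mulrDr; congr (_ + _); first ring.
  rewrite /H big_distrr; apply: eq_bigr => i _ /=; have ckk := c1M C1_cs C1_cs.
  rewrite (opM _ (c1M C1_ct ckk) c1v1 Ox) (opM _ C1_ct ckk Ox) dkk del_ct //.
  rewrite (E_del_comm compactK KOm C2v zv i Ox); ring.
have En9 : n9 x = (cs x ^+ 2 * v2 x - 2 * ct x * cs x ^+ 2 * v1 x) * L x - cs x ^+ 2 * Q x.
  rewrite /n9 (opM _ (c1M C1_cs C1_cs) c1v1 Ox) (opM _ C1_cs C1_cs Ox) E_cs // -/v1 -/v2 -/L -/(Q x); ring.
have := rellich_identity k (v x) (v1 x) (v2 x) (L x) (G x) (H x) (Q x) (pp x) (ct_sqr Ox).
rewrite /= -/a -/b => RI.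
have -> : Tfun x ^+ 2 + -1 * F x + -1 * dfun x + -1 * Zfun x =
  (v2 x - v1 x * pp x / 2) ^+ 2 + 4^-1 * (v1 x * pp x - 3 / 2 * v x * pp x ^+ 2) ^+ 2
    + 2 * a * (v1 x - v x * pp x / 2) ^+ 2 + 2 * b * (cs x * (v1 x - (ct x + pp x / 2) * v x)) ^+ 2
    + 2 * (cs x ^+ 2 * Q x - 2 * ct x * cs x ^+ 2 * H x + ct x ^+ 2 * cs x ^+ 2 * G x)
    + G x * (2 * (a - 1) * cs x ^+ 2 + (2 * b + 2 * k - 2) * cs x ^+ 4).
  rewrite -RI /Zfun En1 En2 En3 En4 En5 En6 Ez7 Ez7b Ez8 En9 /Tfun /F /potential /dfun.
  rewrite -/v1 -/v2 -/L -/k -/a -/b; ring.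
(* From [1 <= k], that is from [n >= 3], all coefficients of the remaining squares are
   nonnegative. *)
have b0 : 0 <= b by rewrite /b expr2 -{3}(mulr1 k) -mulrBr mulr_ge0 ?subr_ge0 // (le_trans ler01).
have a1 : 0 <= a - 1 by rewrite subr_ge0 /a exprn_ege1.
have G0 : 0 <= G x by apply: sumr_ge0 => i _; exact: sqr_ge0.
(* Each summand is the square of the [rho]-derivative of [cs * del_i v], because [E_cs] contributes
   [- ct * cs]. *)
have S0 : 0 <= cs x ^+ 2 * Q x - 2 * ct x * cs x ^+ 2 * H x + ct x ^+ 2 * cs x ^+ 2 * G x.
  have -> : cs x ^+ 2 * Q x - 2 * ct x * cs x ^+ 2 * H x + ct x ^+ 2 * cs x ^+ 2 * G x =
    \sum_i (cs x * (op Efield (op (del i) v) x - ct x * op (del i) v x)) ^+ 2.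
    rewrite /Q /H /G !big_distrr -sumrB -big_split /=; apply: eq_bigr => i _; ring.
  by apply: sumr_ge0 => i _; exact: sqr_ge0.
have k2 : 0 <= 2 * b + 2 * k - 2.
  have -> : 2 * b + 2 * k - 2 = 2 * b + 2 * (k - 1) by ring.
  by rewrite addr_ge0 // mulr_ge0 // subr_ge0.
have a0 : 0 <= a by rewrite /a sqr_ge0.
have cc0 m : 0 <= cs x ^+ m by rewrite exprn_ge0 // ltW // cs_gt0.
apply: addr_ge0; last by apply: mulr_ge0 => //; apply: addr_ge0; apply: mulr_ge0 => //; exact: mulr_ge0.
apply: addr_ge0; last exact: mulr_ge0.
apply: addr_ge0; last by apply: mulr_ge0; [exact: mulr_ge0|exact: sqr_ge0].
apply: addr_ge0; last by apply: mulr_ge0; [exact: mulr_ge0|exact: sqr_ge0].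
by apply: addr_ge0; [exact: sqr_ge0|apply: mulr_ge0; [rewrite invr_ge0|exact: sqr_ge0]].
Qed.

End Vfun.
End Inequality.

(** * From weighted integrals back to the hyperbolic norms *)

Lemma C2_C2on (R : realType) n (Om : set 'rV[R]_n) (u : 'rV[R]_n -> R) : C2 u -> C2on Om u.
Proof.
move=> [c0 [d1 [c1 [d2 c2]]]].
split; first by split; [split => x _; exact: c0|move=> i; split; [move=> x _; exact: d1|split => x _; exact: c1]].
move=> i; split; first by split => x _; exact: c1.
by move=> j; split; [move=> x _; exact: d2|split => x _; exact: c2].
Qed.

(** The norms are exhibited as real numbers because for [n = 4] the coefficient with [N - 5] is
    negative and the estimate must be rearranged; the last two inequalities serve that
    rearrangement. *)
Lemma hnorm2_Cc2 (R : realType) n (u : 'rV[R]_n -> R) : (2 < n)%N -> Cc2_punctured u ->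
  let rho := @hdist R n in
  let s := fun x => sinh (rho x) in
  let N := n%:R : R in
  exists B A1 A2 A3 A4 A5 A6 : R,
    [/\ hnorm2 (LB u) = B%:E, hnorm2 u = A1%:E,
       hnorm2 (fun x => u x / rho x) = A2%:E & hnorm2 (fun x => u x / rho x ^+ 2) = A3%:E] /\
    [/\ hnorm2 (fun x => u x / s x ^+ 2) = A4%:E, hnorm2 (fun x => u x / s x) = A5%:E &
       hnorm2 (fun x => u x / (rho x * s x)) = A6%:E] /\
    [/\ (N - 1) ^+ 4 / 16 * A1 + (N - 1) ^+ 2 / 8 * A2 + 9 / 16 * A3
        + (N ^+ 2 - 1) * (N - 3) * (N - 5) / 16 * A4
        + (N ^+ 2 - 1) * (N - 3) ^+ 2 / 8 * A5 + (N - 1) * (N - 3) / 8 * A6 <= B,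
       A4 <= A3 & A4 <= A6].
Proof.
move=> n3 [C2u [K [cK [KOm zu]]]] rho s N.
pose Om := @punctured_ball R n.
have C2on_u : C2on Om u by exact: C2_C2on.
have zK : zeroK K u by [].
pose v := vfun u.
have C2v : C2on Om v by exact: C2_vfun.
have zv : zeroK K v by apply: zeroKMr.
have oO : open Om := open_Om.
have c0k : C0on Om cs := C1on0 C1_cs.
have c0p : C0on Om pp := C1on0 C1_pp.
have cpk : C0on Om (fun x => pp x ^+ 2 * cs x ^+ 2) := C0onM (C0onX oO 2 c0p) (C0onX oO 2 c0k).
have n0 : (0 < n)%N by apply: leq_trans n3.
have wt f (w : 'rV[R]_n -> R) : (forall x, Om x -> f x = u x * w x) -> forall x, Om x ->
    f x ^+ 2 * conf x ^+ n = dens x * (v x ^+ 2 * w x ^+ 2).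
  by move=> fw x Ox; rewrite fw // dens_sg // /v /vfun; ring.
have zf (w : 'rV[R]_n -> R) : zeroK K (fun x => u x * w x).
  by move=> x Kx; rewrite zu // mul0r.
exists (Mint (fun x => Tfun v x ^+ 2)), (Mint (fun x => v x ^+ 2)),
  (Mint (fun x => v x ^+ 2 * pp x ^+ 2)), (Mint (fun x => v x ^+ 2 * pp x ^+ 4)),
  (Mint (fun x => v x ^+ 2 * cs x ^+ 4)), (Mint (fun x => v x ^+ 2 * cs x ^+ 2)),
  (Mint (fun x => v x ^+ 2 * (pp x ^+ 2 * cs x ^+ 2))).
have sE x : Om x -> s x = (cs x)^-1 by exact: sinh_rho.
split; last split.
- split.
  + apply: (hnorm2_Mint cK KOm) => [|| x Ox].
    * move=> x Kx; rewrite /LB big1 ?mulr0 // => i _.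
      by apply: (zeroK_partial cK) => //; apply: zeroKMr; exact: zeroK_partial.
    * exact: inK_T2.
    by rewrite dens_sg // /Tfun -LB_conj //; ring.
  + apply: (hnorm2_Mint cK KOm) => //; first exact: (inK_vv C2v zv).
    by move=> x Ox; rewrite dens_sg // /v /vfun; ring.
  + apply: (hnorm2_Mint cK KOm) => //; first exact: (inK_v2 C2v zv (C0onX oO 2 c0p)).
    exact: (wt (fun y => u y / rho y) pp).
  + apply: (hnorm2_Mint cK KOm) => //; first exact: (inK_v2 C2v zv (C0onX oO 4 c0p)).
    move=> x Ox; have E y : Om y -> u y / rho y ^+ 2 = u y * pp y ^+ 2.
      by rewrite /pp exprVn.
    by rewrite (wt (fun y => u y / rho y ^+ 2) _ E x Ox) -exprM.
- split.
  + apply: (hnorm2_Mint cK KOm) => //; first exact: (inK_v2 C2v zv (C0onX oO 4 c0k)).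
    move=> x Ox; have E y : Om y -> u y / s y ^+ 2 = u y * cs y ^+ 2.
      by move=> Oy; rewrite sE // exprVn invrK.
    by rewrite (wt (fun y => u y / s y ^+ 2) _ E x Ox) -exprM.
  + apply: (hnorm2_Mint cK KOm) => //; first exact: (inK_v2 C2v zv (C0onX oO 2 c0k)).
    move=> x Ox; have E y : Om y -> u y / s y = u y * cs y by move=> Oy; rewrite sE // invrK.
    by rewrite (wt (fun y => u y / s y) _ E x Ox).
  + apply: (hnorm2_Mint cK KOm) => //; first exact: (inK_v2 C2v zv cpk).
    move=> x Ox; have E y : Om y -> u y / (rho y * s y) = u y * (pp y * cs y).
      by move=> Oy; rewrite sE // invfM invrK.
    by rewrite (wt (fun y => u y / (rho y * s y)) _ E x Ox) (exprMn _ (pp x)).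
have pk x : Om x -> 0 <= cs x <= pp x.
  move=> Ox; have r0 := rho_gt0 Ox; rewrite ltW ?cs_gt0 //= /pp.
  rewrite -[leLHS]invrK lef_pV2 ?posrE ?invr_gt0 ?cs_gt0 // -sinh_rho //.
  exact: (ler_sinh (ltW r0)).
have mono (w w' : 'rV[R]_n -> R) : C0on Om w -> C0on Om w' -> (forall x, Om x -> w x <= w' x) ->
    Mint (fun x => v x ^+ 2 * w x) <= Mint (fun x => v x ^+ 2 * w' x).
  move=> cw cw' ww.
  have i1 := inK_v2 C2v zv cw; have i2 := inK_v2 C2v zv cw'.
  have i3 := inKM (C0on_cst Om (-1)) i1.
  rewrite -subr_ge0 -mulN1r -(MintZ cK KOm _ i1) -(MintD cK KOm i2 i3).
  apply: (Mint_ge0 KOm); first by case: (inKD i2 i3).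
  by move=> x Ox; rewrite mulN1r -mulrN -mulrDr mulr_ge0 ?sqr_ge0 // subr_ge0 ww.
split.
- have := Tfun_ge cK KOm n3 C2v zv; rewrite (Mint_potential cK KOm C2v zv).
  apply: le_trans; rewrite le_eqVlt; apply/orP; left; apply/eqP.
  (* With [a = kappa^2] and [b = kappa^2 - kappa] one has [b = (N-1)(N-3)/4], [b - 2 = (N+1)(N-5)/4]
     and [a - 1 = (N+1)(N-3)/4], whence the factors of the statement. *)
  by rewrite /kappa -/N; field.
- apply: mono; [exact: (C0onX oO 4 c0k)|exact: (C0onX oO 4 c0p)|].
  by move=> x Ox; have /andP[k0 kp] := pk x Ox; rewrite lerXn2r // nnegrE // (le_trans k0).
- apply: mono => //; first exact: (C0onX oO 4 c0k).
  move=> x Ox; have /andP[k0 kp] := pk x Ox.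
  have -> : cs x ^+ 4 = cs x ^+ 2 * cs x ^+ 2 by ring.
  by rewrite ler_wpM2r ?sqr_ge0 // lerXn2r // nnegrE // (le_trans k0).
Qed.

Unset Implicit Arguments.

Theorem theorem1p7 (R : realType) :
  (forall (n : nat) (u : 'rV[R]_n -> R), (3 <= n)%N -> Cc2_punctured u ->
     let rho := @hdist R n in
     let s := fun x => sinh (rho x) in
     let N := n%:R : R in
     (hnorm2 (LB u) >=
        ((N - 1) ^+ 4 / 16)%:E * hnorm2 u
      + ((N - 1) ^+ 2 / 8)%:E * hnorm2 (fun x => (u x / rho x)%R)
      + (9 / 16)%:E * hnorm2 (fun x => (u x / rho x ^+ 2)%R)
      + ((N ^+ 2 - 1) * (N - 3) * (N - 5) / 16)%:E
          * hnorm2 (fun x => (u x / s x ^+ 2)%R)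
      + ((N ^+ 2 - 1) * (N - 3) ^+ 2 / 8)%:E * hnorm2 (fun x => (u x / s x)%R)
      + ((N - 1) * (N - 3) / 8)%:E * hnorm2 (fun x => (u x / (rho x * s x))%R))%E)
  /\
  (forall u : 'rV[R]_3 -> R, Cc2_punctured u ->
     let rho := @hdist R 3 in
     (hnorm2 (LB u) >=
        hnorm2 u + (1 / 2)%:E * hnorm2 (fun x => (u x / rho x)%R)
      + (9 / 16)%:E * hnorm2 (fun x => (u x / rho x ^+ 2)%R))%E)
  /\
  (forall u : 'rV[R]_4 -> R, Cc2_punctured u ->
     let rho := @hdist R 4 in
     (hnorm2 (LB u) >=
        (81 / 16)%:E * hnorm2 u + (9 / 8)%:E * hnorm2 (fun x => (u x / rho x)%R)
      + (15 / 8)%:E * hnorm2 (fun x => (u x / sinh (rho x))%R))%E).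
Proof.
split; [|split].
- move=> n u n3 Cu; have := hnorm2_Cc2 n3 Cu; cbv zeta.
  move=> [B [A1 [A2 [A3 [A4 [A5 [A6 [[-> -> -> ->] [[-> -> ->] [H _ _]]]]]]]]]].
  by rewrite -!EFinM -!EFinD lee_fin.
- move=> u Cu; have := hnorm2_Cc2 (isT : (2 < 3)%N) Cu; cbv zeta.
  move=> [B [A1 [A2 [A3 [A4 [A5 [A6 [[-> -> -> ->] [_ [H _ _]]]]]]]]]].
  rewrite -!EFinM -!EFinD lee_fin; apply: le_trans H.
  (* The last three coefficients contain the factor [N - 3 = 0]. *)
  by rewrite le_eqVlt; apply/orP; left; apply/eqP; field.
- move=> u Cu; have := hnorm2_Cc2 (isT : (2 < 4)%N) Cu; cbv zeta.
  move=> [B [A1 [A2 [A3 [A4 [A5 [A6 [[-> -> -> _] [[_ -> _] [H h1 h2]]]]]]]]]].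
  rewrite -!EFinM -!EFinD lee_fin; apply: le_trans H; rewrite -subr_ge0.
  set d := (X in 0 <= X).
  (* For [N = 4] the coefficient of [A4] is [-15/16], and [9/16 + 3/8 = 15/16]: the terms in [A3]
     and [A6] absorb it exactly. *)
  have -> : d = 9 / 16 * (A3 - A4) + 3 / 8 * (A6 - A4) by rewrite /d; field.
  by rewrite addr_ge0 // mulr_ge0 ?subr_ge0 // divr_ge0.
Qed.
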